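(* Let $G$ be an infinite residually finite (countable discrete) group. Let $(Z,G)$ be a minimal equicontinuous topological dynamical system having a free orbit and such that $Z$ is a Cantor set. Let $(Y,G)$ be a minimal topological dynamical system that is an extension of $(Z,G)$ through a topological factor map $\pi:Y\to Z$. Then there exist a minimal extension $(X,G)$ of $(Z,G)$ through an almost one-to-one factor map $\tau:X\to Z$, and a Borel equivariant map $\psi:Y\to X$, satisfying the following: (1) $\tau\circ\psi=\pi$. (2) $\psi$ is one-to-one on a set $\pi^{-1}(\tilde Z)$, where $\tilde Z\subseteq Z$ is a set of full measure with respect to the unique invariant probability measure of $(Z,G)$. (3) The map $\psi$ induces an affine bijection $\psi^*$ between $\mathcal{M}(Y,G)$ and $\mathcal{M}(X,G)$, given by $\psi^*(\mu)(A)=\mu(\psi^{-1}(A))$ for every $\mu\in\mathcal{M}(Y,G)$ and every Borel set $A\subseteq X$. (4) If in addition $Y$ is a Cantor set, then $X$ is also a Cantor set and $\psi^*$ is an affine homeomorphism between $\mathcal{M}(Y,G)$ and $\mathcal{M}(X,G)$.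
   Context: A topological dynamical system $(X,G)$ is a non-empty compact metric space $X$ together with a continuous action of a countable discrete group $G$. It is minimal if every orbit $\{gx:g\in G\}$ is dense in $X$. It has a free orbit if there is $x\in X$ whose stabilizer $\{g\in G: gx=x\}$ is trivial. It is equicontinuous if for every $\varepsilon>0$ there is $\delta>0$ such that $d(x,y)<\delta$ implies $d(gx,gy)<\varepsilon$ for all $x,y\in X$ and $g\in G$. A Cantor set is a non-empty, compact, metric, totally disconnected space without isolated points. A map $\pi:X\to Y$ between systems is equivariant if $\pi(gx)=g\pi(x)$ for all $g\in G$, $x\in X$; a factor map (topological factor map) is a continuous, surjective, equivariant map, and in that case $(X,G)$ is called an extension of $(Y,G)$. A factor map $\pi:X\to Y$ is almost one-to-one if $\{y\in Y: |\pi^{-1}\{y\}|=1\}$ is dense in $Y$. $\mathcal{M}(X,G)$ denotes the (possibly empty) convex set of $G$-invariant Borel probability measures on $X$, with the weak topology (convergence of integrals of continuous functions). A minimal equicontinuous system has a unique invariant probability measure. A group $G$ is residually finite if for every $g\neq 1_G$ there are a finite group $F$ and a homomorphism $\varphi:G\to F$ with $\varphi(g)\neq 1_F$. *)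

(* Defs.v *)
From HB Require Import structures.
From mathcomp Require Import all_boot all_order all_algebra fingroup.
From mathcomp Require Import all_classical all_reals all_analysis.

Set Implicit Arguments.
Unset Strict Implicit.
Unset Printing Implicit Defensive.

Import Order.TTheory GRing.Theory Num.Theory.
Import numFieldNormedType.Exports.

Local Open Scope classical_set_scope.
Local Open Scope ring_scope.

(* Pointedness encodes non-emptiness; it is also what the library requires in
   order to equip a type with a sigma-algebra. *)
#[short(type="pmetricType")]
HB.structure Definition PointedMetric (R : numDomainType) :=
  {M of Pointed M & Metric R M}.

Definition residually_finite (G : groupType) : Prop :=
  forall g : G, g != 1%g ->
    exists (F : finGroupType) (phi : {multiplicative G -> F}), phi g != 1%g.

(* [G] carries the discrete topology, so the action [G * X -> X] is continuous
   iff every [act g] is. *)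
Record dynSystem (R : realType) (G : groupType) := DynSystem {
  space :> pmetricType R ;
  act : G -> space -> space ;
  space_compact : compact [set: space] ;
  act1 : forall x, act 1%g x = x ;
  actM : forall g h x, act (g * h)%g x = act g (act h x) ;
  act_continuous : forall g, continuous (act g) }.

Arguments act {R G} _ _ _.

Section systems.
Context {R : realType} {G : groupType}.
Implicit Types X Y : dynSystem R G.

Definition minimal X : Prop :=
  forall x : X, dense [set act X g x | g in [set: G]].

Definition has_free_orbit X : Prop :=
  exists x : X, [set g | act X g x = x] = [set 1%g].

Definition equicontinuous_system X : Prop :=
  forall e : R, 0 < e -> exists2 d : R, 0 < d &
    forall (x y : X) (g : G), mdist x y < d -> mdist (act X g x) (act X g y) < e.

Definition equivariant X Y (f : X -> Y) : Prop :=
  forall g x, f (act X g x) = act Y g (f x).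

Definition factor_map X Y (f : X -> Y) : Prop :=
  [/\ continuous f, set_surj [set: X] [set: Y] f & equivariant f].

Definition almost_one_to_one X Y (f : X -> Y) : Prop :=
  dense [set y : Y | exists x : X, f @^-1` [set y] = [set x]].

End systems.

Definition cantor_set (R : realType) (X : pmetricType R) : Prop :=
  [/\ compact [set: X], totally_disconnected [set: X]
    & isolated [set: X] = set0].

Definition borel (T : ptopologicalType) := g_sigma_algebraType (@open T).

Definition borel_map (S T : ptopologicalType) (f : S -> T) : Prop :=
  measurable_fun [set: borel S] (f : borel S -> borel T).

(* The space of invariant Borel probability measures. A measure of the library
   is a function on all subsets, constrained only on the measurable ones; the
   last field fixes its value on the other subsets, so that two elements are
   equal iff they agree on the Borel sets. *)
Record invMeasure (R : realType) (G : groupType) (X : dynSystem R G) :=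
  InvMeasure {
  inv_measure :> probability (borel X) R ;
  inv_measure_act : forall g (A : set (borel X)), measurable A ->
    inv_measure (act X g @^-1` A) = inv_measure A ;
  inv_measure_nonborel : forall A : set (borel X), ~ measurable A ->
    inv_measure A = 0%E }.

HB.instance Definition _ (R : realType) (G : groupType) (X : dynSystem R G) :=
  gen_eqMixin (invMeasure X).
HB.instance Definition _ (R : realType) (G : groupType) (X : dynSystem R G) :=
  gen_choiceMixin (invMeasure X).

Definition integrals (R : realType) (G : groupType) (X : dynSystem R G)
    (mu : invMeasure X) : {ptws continuousType X R -> R} :=
  fun f => \int[mu]_x f x.

(* Weak topology: the coarsest one making all the maps [mu |-> \int[mu]_x f x],
   with [f] continuous, continuous. *)
HB.instance Definition _ (R : realType) (G : groupType) (X : dynSystem R G) :=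
  Topological.copy (invMeasure X) (initial_topology (@integrals R G X)).

Section measure_maps.
Context {R : realType} {G : groupType} {X Y : dynSystem R G}.

(* [rho] is the convex combination [t mu + (1 - t) nu]. *)
Definition is_mixture (Z : dynSystem R G) (t : R) (mu nu rho : invMeasure Z) :=
  forall A : set (borel Z), measurable A ->
    rho A = (t%:E * mu A + (1 - t)%:E * nu A)%E.

Definition affine (F : invMeasure Y -> invMeasure X) : Prop :=
  forall (t : R) (mu nu rho : invMeasure Y), 0 <= t <= 1 ->
    is_mixture t mu nu rho -> is_mixture t (F mu) (F nu) (F rho).

End measure_maps.

Definition homeomorphism (S T : topologicalType) (f : S -> T) : Prop :=
  continuous f /\
  exists g : T -> S, [/\ cancel f g, cancel g f & continuous g].

(* Main.v *)
(* Fix [z0] in [Z] with free orbit and [y0] over [z0]. Finite sets [F n] and small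
   clopen neighbourhoods [E n] of [z0] are chosen inductively; the pieces [f E n]
   ([f] in [F n]), deprived of the earlier stages, fill a dense open set of small
   measure. On the piece [f E n] the symbol of a point of [Y] is [f y0], off the
   pieces it is the point itself, [psi y] codes the orbit of [y], and [X] is the
   closed set of limits of such codings. Almost every orbit leaves the pieces, so
   [y] can be read off [psi y] almost surely; conversely almost every [x] in [X] is
   the code of a point once its symbols off the pieces are translates of a single
   point of [Y], for every invariant measure. If [G] is amenable, this holds when
   [F n] minimises a perimeter-to-volume functional: few edges of a Folner window
   then leave the pieces. Otherwise the points near the boundary of the pieces carry
   labels recording a paradoxical decomposition of the orbit of [z0]: a point of [X]
   with nonzero labels inherits the paradox, which no invariant measure allows. *)
Require Import Defs.
From HB Require Import structures.
From mathcomp Require Import all_boot all_order all_algebra fingroup finmap.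
From mathcomp Require Import all_classical all_reals all_analysis.
From mathcomp Require Import measurable_realfun ring lra zify.
Import Order.TTheory GRing.Theory Num.Theory.
Import numFieldNormedType.Exports.
Set Implicit Arguments.
Unset Strict Implicit.
Unset Printing Implicit Defensive.
Local Open Scope classical_set_scope.
Local Open Scope ring_scope.

(** * Metric spaces *)

(** Off the pieces, the symbols of a limit point come from translates [f y0] of ever later stages,
    and two such sites carry related symbols only when one piece contains both. Nothing in the
    closure forbids limits that straddle the rims of pieces, so every invariant measure of [X], not
    only those that come from [Y], must be shown to ignore them. In the amenable case a window of an
    orbit may cut a piece in a small part rich in boundary, which a good overall ratio of boundary
    to size does not exclude. A minimiser obeys a bound inside each window, since cutting the window
    out of it cannot improve it. In the nonamenable case the labels must record the paradox by
    finitely many values, constant on each translate of a small clopen set. The paradox thus has to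
    be locally constant, whence a Hall matching built by clopen steps. A label is 0 or a power of
    1/2. These values form a closed totally disconnected set, so labels do not spoil total
    disconnectedness of [X]; and labels that vanish in the core of the stages let unlabelled codes
    of points of [Y] be limits. *)

Section halves.
Context {R : realType}.
Implicit Types r : R.

Lemma half_gt0 n : 0 < (2^-1 : R) ^+ n.
Proof. by rewrite exprn_gt0// invr_gt0. Qed.

Lemma half_small (e : R) : 0 < e -> exists m, 2 * (2^-1 : R) ^+ m < e.
Proof.
move=> e0; have e20 : 0 < e / 2 by rewrite divr_gt0.
have := @cvg_expr R (2^-1).
rewrite ger0_norm ?invr_ge0// invf_lt1// ltr1n => /(_ isT) /cvgrPdist_lt /(_ _ e20).
move=> [n _ /(_ n (leqnn n))]; rewrite /= sub0r normrN ger0_norm; last by rewrite ltW// half_gt0.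
by exists n; lra.
Qed.

Lemma inv_succ_small (e : R) : 0 < e -> exists N, forall n, (N <= n)%N -> (n.+1%:R^-1 : R) < e.
Proof.
by move=> e0; have [N _ h] := near_infty_natSinv_lt (PosNum e0); exists N => n /h. Qed.

Lemma half_le i j : (i <= j)%N -> (2^-1 : R) ^+ j <= 2^-1 ^+ i.
Proof. by apply: ler_wiXn2l; rewrite ?invr_ge0 ?invf_le1 ?ler1n. Qed.

Lemma half_lt i j : (i < j)%N -> (2^-1 : R) ^+ j <= 2^-1 ^+ i / 2.
Proof.
by move=> ij; rewrite -exprSr; exact: half_le.
Qed.

(** The threshold lies strictly between the consecutive values [2^-(k+1)] and [2^-k], so it is never
    attained. This makes sublevel sets of labels clopen. *)
Lemma half_gap r k : r = 0 \/ (exists j, r = 2^-1 ^+ j) ->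
  r <= 2^-1 ^+ k * (3 / 4) -> r < 2^-1 ^+ k * (3 / 4).
Proof.
have k0 := half_gt0 k; move=> [->|[j ->]]; first by move=> _; rewrite mulr_gt0// divr_gt0.
have [lt|lt|<-] := ltngtP k j; last lra.
- have := half_lt lt; lra.
- have := half_lt lt; lra.
Qed.

Lemma half_sep r r' : r = 0 \/ (exists j, r = 2^-1 ^+ j) -> r' = 0 \/ (exists j, r' = 2^-1 ^+ j) ->
  r < r' -> exists k, r < 2^-1 ^+ k * (3 / 4) /\ 2^-1 ^+ k * (3 / 4) <= r'.
Proof.
move=> hr [->|[k ->]].
  by have [->|[j ->]] := hr; rewrite ?ltxx// ltNge ltW// half_gt0.
move=> rk; exists k; have k0 := half_gt0 k; split; last lra.
move: rk; have [->|[j ->]] := hr; first by rewrite mulr_gt0// divr_gt0.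
have [lt|lt|<-] := ltngtP k j; last by rewrite ltxx.
- have := half_lt lt; lra.
- have := half_lt lt; lra.
Qed.

(** The other admissible values are at distance at least [2^-k / 2]. Labels can thus be read exactly
    from approximations. *)
Lemma half_close r k : r = 0 \/ (exists j, r = 2^-1 ^+ j) ->
  `|r - 2^-1 ^+ k| < 2^-1 ^+ k / 4 -> r = 2^-1 ^+ k.
Proof.
have k0 := half_gt0 k; move=> [->|[j ->]].
  by rewrite sub0r normrN gtr0_norm//; lra.
have j0 := half_gt0 j.
rewrite ltr_norml => /andP[h1 h2]; have [lt|lt|->//] := ltngtP k j.
- have := half_lt lt; lra.
- have := half_lt lt; lra.
Qed.

End halves.

Section metric_continuity.
Context {R : realType}.

Lemma mdist_continuousP (T : topologicalType) (V : metricType R) (f : T -> V) x :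
  {for x, continuous f} <-> forall e, 0 < e -> \forall t \near x, mdist (f x) (f t) < e.
Proof. exact: metricType_numDomainType.cvgrPdist_lt. Qed.

Lemma mdist_nbhsP (V : metricType R) (x : V) (A : set V) :
  nbhs x A <-> exists2 e : R, 0 < e & forall y, mdist x y < e -> A y.
Proof.
split; first by move/metricType_numDomainType.nbhs_mdistP.
by move=> h; apply/metricType_numDomainType.nbhs_mdistP.
Qed.

End metric_continuity.

(** * Maximum metric on products *)

Section prodmetric.
Context {R : realType} {A B : metricType R}.
Definition prod_dist (x y : A * B) : R := Num.max (mdist x.1 y.1) (mdist x.2 y.2).
Lemma prod_dist_ge0 x y : 0 <= prod_dist x y.
Proof. by rewrite le_max mdist_ge0. Qed.
Lemma prod_dist_pos x y : prod_dist x y = 0 -> x = y.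
Proof.
move=> h; have : prod_dist x y <= 0 by rewrite h.
rewrite ge_max => /andP[h1 h2]; case: x y h1 h2 {h} => a b [a' b'] /= h1 h2.
by congr pair; apply: mdist_positivity; apply/eqP; rewrite eq_le mdist_ge0 ?h1 ?h2.
Qed.
Lemma prod_distE x d : ball x d = [set y | prod_dist x y < d].
Proof.
apply/seteqP; split => y; rewrite /ball/= /prod_ball/= !ballEmdist/= /prod_dist gt_max.
  by move=> [-> ->].
by move=> /andP[].
Qed.
HB.instance Definition _ := PseudoMetric_isMetric.Build R (A * B)%type prod_dist_ge0 prod_dist_pos prod_distE.
End prodmetric.

HB.instance Definition _ (R : realType) (A B : pmetricType R) := Pointed.on (A * B)%type.
HB.instance Definition _ (R : realType) := Pointed.on R^o.

(** * Metric on countable products *)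

Section funmetric.
Context {R : realType} {I : Type} (idx : I -> nat) (idx_inj : injective idx) {U : pmetricType R}.

(** Truncating the coordinate [i] at [2^-idx i] makes the supremum a metric for pointwise
    convergence. The value 0 adjoined in [fdist] keeps the supremum meaningful when no index is at
    hand. *)
Definition fdset (x y : I -> U) : set R :=
  [set r | exists i, r = Num.min ((2^-1) ^+ (idx i)) (mdist (x i) (y i))].
Definition fdist (x y : I -> U) : R := sup (0 |` fdset x y).

Lemma fdset_sup x y : has_sup (0 |` fdset x y).
Proof.
split; first by exists 0; left.
exists 1 => r [->|[i ->]]; rewrite // ge_min exprn_ile1 ?invr_ge0 ?invf_le1 ?ler1n ?ltr0n //.
Qed.

Lemma fdist_ge x y i : Num.min ((2^-1) ^+ (idx i)) (mdist (x i) (y i)) <= fdist x y.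
Proof. by apply: sup_upper_bound; [exact: fdset_sup|right; exists i]. Qed.
Lemma fdist_ge0 x y : 0 <= fdist x y.
Proof. by apply: sup_upper_bound; [exact: fdset_sup|left]. Qed.
Lemma fdist_le x y c : 0 <= c -> (forall i, Num.min ((2^-1) ^+ (idx i)) (mdist (x i) (y i)) <= c) ->
  fdist x y <= c.
Proof.
move=> c0 h; apply: ge_sup; first by have [] := fdset_sup x y.
by move=> r [->//|[i ->]].
Qed.

Lemma fdistxx x : fdist x x = 0.
Proof.
apply/eqP; rewrite eq_le fdist_ge0 andbT; apply: fdist_le => // i.
by rewrite mdistxx ge_min lexx orbT.
Qed.
Lemma fdist_pos x y : fdist x y = 0 -> x = y.
Proof.
move=> h; apply/funext => i; apply: mdist_positivity; apply/eqP.
have := fdist_ge x y i; rewrite h ge_min leNgt half_gt0/= => h1.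
by rewrite eq_le h1 mdist_ge0.
Qed.
Lemma fdist_sym x y : fdist x y = fdist y x.
Proof.
rewrite /fdist; congr (sup (0 |` _)); apply/seteqP.
by split=> r [i ->]; exists i; rewrite metric_sym.
Qed.
Lemma fdist_tri y x z : fdist x z <= fdist x y + fdist y z.
Proof.
apply: fdist_le => [|i]; first by rewrite addr_ge0 ?fdist_ge0.
have := fdist_ge x y i; have := fdist_ge y z i.
have := metric_triangle (x i) (y i) (z i).
have := @half_gt0 R (idx i); move: (_ ^+ _) => r.
have := mdist_ge0 (x i) (y i); have := mdist_ge0 (y i) (z i).
move: (mdist _ _) (mdist _ _) (mdist _ _) => a b c.
by rewrite !minEle; case: ifP; case: ifP; case: ifP; lra.
Qed.
End funmetric.

(** Enumeration, subset and base point are bundled so that the subset gets one canonical pointed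
    metric structure. Compactness is a separate matter, decided by closedness in the pointwise
    topology. *)
Record fspace (R : realType) (I : Type) (U : pmetricType R) := FSpace {
  fs_idx : I -> nat ; fs_en : nat -> I ; fs_idxK : cancel fs_idx fs_en ;
  fs_P : set (I -> U) ; fs_pt : I -> U ; fs_ptP : fs_P fs_pt }.
Arguments fs_idx {R I U}. Arguments fs_P {R I U}. Arguments fs_en {R I U}.

Definition fsub (R : realType) (I : Type) (U : pmetricType R) (S : fspace I U) :=
  {x : I -> U | fs_P S x}.

Section fsub.
Context (R : realType) (I : Type) (U : pmetricType R) (S : fspace I U).
HB.instance Definition _ := gen_eqMixin (fsub S).
HB.instance Definition _ := gen_choiceMixin (fsub S).
HB.instance Definition _ := isPointed.Build (fsub S) (exist _ _ (fs_ptP S)).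
Let fsd (x y : fsub S) := fdist (fs_idx S) (sval x) (sval y).
Let fsdxx x : fsd x x = 0. Proof. exact: fdistxx. Qed.
Let fsd_pos x y : fsd x y = 0 -> x = y.
Proof.
move: x y => [x px] [y py]; rewrite /fsd/= => /fdist_pos xy; subst y.
by congr exist; exact: Prop_irrelevance.
Qed.
Let fsd_sym x y : fsd x y = fsd y x. Proof. exact: fdist_sym. Qed.
Let fsd_tri y x z : fsd x z <= fsd x y + fsd y z. Proof. exact: fdist_tri. Qed.
HB.instance Definition _ := isMetric.Build R (fsub S) fsdxx fsd_pos fsd_sym fsd_tri.

Lemma fsub_mdist (x y : fsub S) : mdist x y = fdist (fs_idx S) (sval x) (sval y).
Proof. by []. Qed.

Lemma fsub_ball (e : R) : 0 < e -> exists n, forall x y : fsub S,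
  (forall k, (k < n)%N -> mdist (sval x (fs_en S k)) (sval y (fs_en S k)) < e) ->
  mdist x y <= e.
Proof.
move=> e0.
have [n ne2] := half_small e0.
have ne : (2^-1 : R) ^+ n < e by have := @half_gt0 R n; lra.
exists n => x y h; rewrite fsub_mdist; apply: fdist_le => [|i]; first exact: ltW.
rewrite ge_min; have [lt|ge] := ltnP (fs_idx S i) n.
  by have := h _ lt; rewrite fs_idxK => /ltW ->; rewrite orbT.
rewrite (le_trans _ (ltW ne))//.
exact: half_le.
Qed.

Lemma fsub_proj i : continuous (fun x : fsub S => sval x i).
Proof.
move=> x; apply/mdist_continuousP => e e0.
pose r := Num.min ((2^-1 : R) ^+ fs_idx S i) e.
have r0 : 0 < r by rewrite lt_min e0 half_gt0.
apply/mdist_nbhsP; exists r => // y xy.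
have := le_lt_trans (fdist_ge (fs_idx S) (sval x) (sval y) i) xy.
by rewrite /r lt_min !gt_min ltxx /=; case/andP => da /orP[|//]; apply: lt_trans.
Qed.

Lemma fsub_continuous (T : topologicalType) (f : T -> fsub S) :
  (forall i, continuous (fun t => sval (f t) i)) -> continuous f.
Proof.
move=> h x; apply/mdist_continuousP => e e0.
have e20 : 0 < e / 2 by rewrite divr_gt0.
have [n hn] := fsub_ball e20.
have : \forall t \near x, forall k : 'I_n, mdist (sval (f x) (fs_en S k)) (sval (f t) (fs_en S k)) < e / 2.
  apply: filter_forall => k.
  have := h (fs_en S k) x; by move/mdist_continuousP; exact.
apply: filterS => t ht; apply: (le_lt_trans (hn _ _ _)); last lra.
by move=> k kn; exact: (ht (Ordinal kn)).
Qed.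

(** Tychonoff gives a pointwise cluster point; it is also one for the metric, because finitely many
    coordinates control a ball. *)
Lemma fsub_compact (A : I -> set U) : (forall i, compact (A i)) ->
  (forall x, fs_P S x -> forall i, A i (x i)) ->
  closed (fs_P S : set {ptws I -> U}) -> compact [set: fsub S].
Proof.
move=> cA PA clP F FF _.
have cK : compact (fs_P S : set {ptws I -> U}).
  apply: (subclosed_compact clP (@tychonoff {classic I} _ A cA)).
  exact: PA.
have FF' : ProperFilter ((sval : fsub S -> {ptws I -> U}) @ F).
  exact: fmap_proper_filter.
have [|f [Pf clf]] := cK _ FF'.
  apply: (@filterS _ F _ setT) (filterT) => x _; exact: (proj2_sig x).
exists (exist _ f Pf); split => // B A' FB /mdist_nbhsP [e e0 sA].
have e20 : 0 < e / 2 by rewrite divr_gt0.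
have [n hn] := fsub_ball e20.
have FB' : ((sval : fsub S -> {ptws I -> U}) @ F) [set sval b | b in (B : set (fsub S))].
  by apply: (@filterS _ F _ (B : set (fsub S))) FB => b Bb; exists b.
have nfk (k : 'I_n) : nbhs (f : {ptws I -> U}) [set g : I -> U |
    mdist ((f : I -> U) (fs_en S k)) (g (fs_en S k)) < e / 2].
  have /mdist_continuousP := @proj_continuous {classic I} (fun=> U) (fs_en S k) f.
  exact.
have nf : nbhs (f : {ptws I -> U}) [set g : I -> U | forall k : 'I_n,
    mdist ((f : I -> U) (fs_en S k)) (g (fs_en S k)) < e / 2].
  exact: (@filter_forall _ _ (fun (k : 'I_n) (g : {ptws I -> U}) => mdist ((f : I -> U) (fs_en S k)) ((g : I -> U) (fs_en S k)) < e / 2) _ (nbhs_filter (f : {ptws I -> U})) nfk).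
have [_ [[b Bb <-] hb]] := clf _ _ FB' nf.
exists b; split => //; apply: sA => /=; apply: le_lt_trans (hn _ _ _) _; last lra.
by move=> k kn; exact: (hb (Ordinal kn)).
Qed.

End fsub.

(** * Clopen sets in compact spaces *)

Section compact_spaces.
Context {R : realType}.
Implicit Types T : pmetricType R.

Lemma compact_finite_cover T (I : choiceType) (D : set I) (f : I -> set T) :
  compact [set: T] -> (forall i, D i -> open (f i)) ->
  (forall x, exists2 i, D i & f i x) ->
  exists E : {fset I}, (forall i, i \in E -> D i) /\ forall x, exists2 i, i \in E & f i x.
Proof.
rewrite compact_cover => cT of_ cov.
have [|E sED Ecov] := cT I D f of_; first by move=> x _; have [i ? ?] := cov x; exists i.
exists E; split=> [i iE|x]; first by have := sED i iE; rewrite inE.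
by have [i /= iE fx] := Ecov x Logic.I; exists i.
Qed.

Lemma clopen_bigcap (T : topologicalType) (I : choiceType) (E : {fset I}) (f : I -> set T) :
  (forall i, i \in E -> clopen (f i)) -> clopen (\bigcap_(i in [set` E]) f i).
Proof.
by rewrite bigcap_fset big_seq => h; apply: big_ind => //; [exact: clopenT|exact: clopenI].
Qed.

Lemma clopen_bigcup (T : topologicalType) (I : choiceType) (E : {fset I}) (f : I -> set T) :
  (forall i, i \in E -> clopen (f i)) -> clopen (\bigcup_(i in [set` E]) f i).
Proof.
by rewrite bigcup_fset big_seq => h; apply: big_ind => //; [exact: clopen0|exact: clopenU].
Qed.

(** In a compact Hausdorff space the intersection [Q] of all clopen sets containing [x] is
    connected, hence reduced to [x]; any other point is then missed by one of these clopen sets. *)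
Lemma totally_disconnected_zero_dimensional T :
  compact [set: T] -> totally_disconnected [set: T] -> zero_dimensional T.
Proof.
move=> cT tdT x y xy; apply: contrapT => nU.
have hT : hausdorff_space T := @metric_hausdorff R T.
pose Q := [set z | forall C, clopen C -> C x -> C z].
have Qx : Q x by [].
have clQ : closed Q.
  have -> : Q = \bigcap_(C in [set C | clopen C /\ C x]) C.
    apply/seteqP; split => [z Qz C [] /=|z h C cC Cx]; first exact: Qz.
    exact: h.
  by apply: closed_bigI => C [[]].
have Qy : Q y.
  by move=> C cC Cx; apply: contrapT => nCy; apply: nU; exists C.
have Qsub : Q `<=` [set x].
  rewrite -(tdT x I); apply: connected_component_max => //.
  move=> B [b Bb] [C oC BE] [D clD BE'].
  apply: contrapT => nBQ.
  pose B' := Q `\` B.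
  have clB : closed B by rewrite BE'; exact: closedI.
  have clB' : closed B'.
    rewrite /B' BE setDE setCI setIUr setICr set0U.
    by apply: closedI => //; exact: open_closedC.
  have BB' : B `&` B' = set0 by rewrite /B' setDE setIA setIAC setICr set0I.
  have BQ : B `<=` Q by rewrite BE; exact: subIsetl.
  have [b' B'b'] : B' !=set0.
    apply/set0P/eqP => B'0; apply: nBQ; apply/seteqP; split => // z Qz.
    by apply: contrapT => nBz; have : B' z by []; rewrite B'0.
  have [U [V [oU oV BU B'V UV]]] : exists U V, [/\ open U, open V, B `<=` U, B' `<=` V & U `&` V = set0].
    by have /(@normal_openP R) := compact_normal hT cT; apply.
  have UVF z : U z -> V z -> False by move=> Uz Vz; have : (U `&` V) z by []; rewrite UV.
  (* By compactness finitely many clopen neighbourhoods of [x] already intersect inside the union of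
     [U] and [V]. *)
  have [||E [EC Ecov]] := @compact_finite_cover T (set T) [set C | clopen C /\ C x] (fun C => ~` C `|` (U `|` V)) cT.
  - by move=> C' [[? ?] _]; apply: openU; [exact: closed_openC|exact: openU].
  - move=> z; have [Qz|nQz] := pselect (Q z).
      exists setT; first by split => //; exact: clopenT.
      right; have [/BU|nBz] := pselect (B z); first by left.
      by right; apply: B'V.
    apply: contrapT => h; apply: nQz => C' cC' C'x; apply: contrapT => nz.
    by apply: h; exists C' => //; left.
  pose W := \bigcap_(C in [set` E]) C.
  have [cW Wx] : clopen W /\ W x.
    split; last by move=> C' /= /EC[].
    by apply: clopen_bigcap => C' /EC[].
  have WUV z : W z -> U z \/ V z.
    by move=> Wz; have [C' C'E [|//]] := Ecov z; case; exact: Wz.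
  have cWU : clopen (W `&` U).
    case: cW => oW clW; split; first exact: openI.
    have -> : W `&` U = W `&` ~` V.
      apply/seteqP; split => z [Wz h]; split => //; first by move=> /(UVF _ h).
      by case: (WUV _ Wz).
    by apply: closedI => //; exact: open_closedC.
  have cWV : clopen (W `&` V).
    case: cW => oW clW; split; first exact: openI.
    have -> : W `&` V = W `&` ~` U.
      apply/seteqP; split => z [Wz h]; split => //; first by move=> /UVF; apply.
      by case: (WUV _ Wz).
    by apply: closedI => //; exact: open_closedC.
  (* The traces of [U] and [V] on [W] are clopen. The one containing [x] contains [Q], against the
     part of [Q] lying in the other. *)
  case: (WUV _ Wx) => [Ux|Vx].
    have [_ Ub'] : (W `&` U) b' by case: B'b' => + _; apply.
    exact: (UVF _ Ub' (B'V _ B'b')).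
  have [_ Vb] : (W `&` V) b by exact: (BQ _ Bb).
  exact: (UVF _ (BU _ Bb) Vb).
by move: xy; rewrite (Qsub _ Qy) eqxx.
Qed.

Lemma clopen_nbhs T (x : T) (A : set T) : compact [set: T] ->
  totally_disconnected [set: T] -> nbhs x A -> exists C, [/\ clopen C, C x & C `<=` A].
Proof.
move=> cT tdT xA.
have zT := totally_disconnected_zero_dimensional cT tdT.
have [C [Cx cC] CA] := zero_dimensional_cvg (@metric_hausdorff R T) zT cT xA.
by exists C.
Qed.

End compact_spaces.

(** * Minimal systems *)

Section dynamics.
Context {R : realType} {G : groupType}.
Implicit Types X : dynSystem R G.

Lemma actVK X g (x : X) : act X g^-1%g (act X g x) = x.
Proof. by rewrite -actM mulVg act1. Qed.

Lemma actKV X g (x : X) : act X g (act X g^-1%g x) = x.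
Proof. by rewrite -actM mulgV act1. Qed.

Lemma act_clopen X g (A : set X) : clopen A -> clopen (act X g @^-1` A).
Proof. by move=> cA; apply: preimage_clopen => //; exact: act_continuous. Qed.

Lemma act_open X g (A : set X) : open A -> open (act X g @^-1` A).
Proof. by move=> oA; apply: open_comp => // x _; exact: act_continuous. Qed.

Lemma dense_orbit X (x : X) (O : set X) : minimal X -> open O -> O !=set0 ->
  exists g, O (act X g x).
Proof. by move=> mX oO O0; have [y [Oy [g _ gy]]] := mX x O O0 oO; exists g; rewrite gy. Qed.

Lemma minimal_cover X (O : set X) : minimal X -> open O -> O !=set0 ->
  exists D : {fset G}, forall x, exists2 g, g \in D & O (act X g x).
Proof.
move=> mX oO O0.
have [||D [_ hD]] := @compact_finite_cover R X G setT (fun g => act X g @^-1` O)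
  (@space_compact R G X).
- by move=> g _; exact: act_open.
- by move=> x; have [g Og] := dense_orbit x mX oO O0; exists g.
by exists D.
Qed.

Lemma near_fset (T : topologicalType) (I : choiceType) (A : {fset I}) (P : I -> T -> Prop) (x : T) :
  (forall i, i \in A -> \forall y \near x, P i y) ->
  \forall y \near x, forall i, i \in A -> P i y.
Proof.
move=> h; have h' := @filter_bigI T I A P (nbhs x) (nbhs_filter x) h.
apply: filterS h' => y hy i iA; exact: (hy i iA).
Qed.

(** Distinct elements of [A] move [E] to disjoint sets, so an invariant probability gives [E] at
    most the inverse of the size of [A]. *)
Definition separates X (A : {fset G}) (E : set X) := forall a b, a \in A -> b \in A ->
  forall e e', E e -> E e' -> act X a e = act X b e' -> a = b.

Lemma separates_near X (x : X) (A : {fset G}) :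
  [set g | act X g x = x] = [set 1%g] ->
  exists2 N, nbhs x N & separates A N.
Proof.
move=> fx.
have inj a b : act X a x = act X b x -> a = b.
  move=> ab; have : [set g | act X g x = x] (b^-1 * a)%g by rewrite /= actM ab actVK.
  by rewrite fx /= => /mulg1_eq; rewrite invgK.
have ex (p : G * G) : {N : set X | nbhs x N /\ (p.1 != p.2 ->
    forall e e', N e -> N e' -> act X p.1 e <> act X p.2 e')}.
  apply: cid; have [->|ne] := eqVneq p.1 p.2; first by exists setT; split => //; exact: filterT.
  have hne : act X p.1 x != act X p.2 x by apply/negP => /eqP/inj; exact/eqP.
  have := @metric_hausdorff R X; rewrite open_hausdorff => hX.
  have [[A1 B1] /= [Ax Bx] [oA oB AB]] := hX _ _ hne.
  exists (act X p.1 @^-1` A1 `&` act X p.2 @^-1` B1); split.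
    apply: filterI.
      by apply: act_continuous; apply: open_nbhs_nbhs; split => //; move: Ax; rewrite inE.
    by apply: act_continuous; apply: open_nbhs_nbhs; split => //; move: Bx; rewrite inE.
  move=> _ e e' [Ae _] [_ Be] eq.
  have : (A1 `&` B1) (act X p.1 e) by split => //; rewrite /= eq.
  by rewrite (eqP AB).
pose N p := sval (ex p).
exists [set y | forall p, p \in (A `*` A)%fset -> N p y].
  by apply: near_fset => p _; rewrite /N; case: (ex p) => ? [].
move=> a b aA bA e e' Ne Ne' eq; apply: contrapT => /eqP ab.
have pA : (a, b) \in (A `*` A)%fset by rewrite in_fsetM /= aA.
have := (svalP (ex (a, b))).2 ab e e' (Ne _ pA) (Ne' _ pA); exact.
Qed.

Lemma separatesS X (A : {fset G}) (E E' : set X) : E `<=` E' -> separates A E' -> separates A E.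
Proof. by move=> EE s a b aA bA e e' /EE ? /EE ?; exact: s. Qed.

Lemma mdist_gt0 (V : metricType R) (x y : V) : x <> y -> 0 < mdist x y.
Proof. by move=> xy; rewrite lt_def mdist_ge0 andbT; apply/eqP => /mdist_positivity. Qed.

Lemma finite_open_isolated X (x u : X) (U : set X) (A : {fset G}) : open U -> U u ->
  (forall v, U v -> exists2 a, a \in A & v = act X a x) -> isolated [set: X] u.
Proof.
move=> oU Uu hA; split; first by rewrite inE.
exists [set u]; last by rewrite setIT.
have n1 : \forall v \near u, forall a, a \in A -> v = act X a x -> act X a x = u.
  apply: near_fset => a _; have [e|ne] := pselect (act X a x = u); first by apply: nearW.
  have d0 : 0 < mdist u (act X a x) by apply: mdist_gt0 => e; apply: ne.
  apply/mdist_nbhsP; exists (mdist u (act X a x)) => // v + va.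
  by rewrite va ltxx.
apply: filterS2 n1 (open_nbhs_nbhs (conj oU Uu)) => v hv Uv; have [a aA va] := hA _ Uv.
by rewrite /= {1}va; exact: hv.
Qed.

Definition firsts (K : choiceType) (s : nat -> K) n : {fset K} := [fset s j | j in iota 0 n]%fset.

Lemma mem_firsts (K : choiceType) (s : nat -> K) j n : (j < n)%N -> s j \in firsts s n.
Proof. by move=> jn; apply/imfsetP; exists j => //=; rewrite mem_iota. Qed.

Lemma clopen_act_near X (x : X) (A : {fset G}) (C : set X) : clopen C ->
  \forall e \near x, forall a, a \in A -> (C (act X a e) <-> C (act X a x)).
Proof.
move=> cC; apply: near_fset => a _.
have cC' := act_clopen a cC; case: (cC') => oC clC.
have [Cx|nCx] := pselect (C (act X a x)).
  have : nbhs x (act X a @^-1` C) by apply: open_nbhs_nbhs.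
  by apply: filterS => y Cy.
have : nbhs x (~` (act X a @^-1` C)) by apply: open_nbhs_nbhs; split => //; exact: closed_openC.
by apply: filterS => y Cy; split.
Qed.

Lemma group_enum : countable [set: G] -> exists s : nat -> G, forall g, exists n, s n = g.
Proof.
move=> /countable_injP [f finj].
exists (fun n => xget 1%g [set g | f g = n]) => g; exists (f g).
have /= fy := @xgetI _ 1%g [set g' | f g' = f g] g erefl.
by apply: (finj _ _ _ _ fy); rewrite inE.
Qed.

End dynamics.

(** * Clopen paradoxical decompositions *)

Local Open Scope fset_scope.

Section fset_packing.
Lemma fset_packing (K V : choiceType) (C : {fset K}) (f : K -> {fset V}) (A : {fset V}) c :
  (forall x, x \in C -> f x `<=` A /\ (c <= #|` f x|)%N) ->
  (forall x y v, x \in C -> y \in C -> v \in f x -> v \in f y -> x = y) ->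
  (#|` C| * c <= #|` A|)%N.
Proof.
move: A; have [n] := ubnP (#|` C|); elim: n C => // n IH C + A hf hd.
have [->|[x xC]] := fset_0Vmem C; first by rewrite cardfs0.
rewrite (cardfsD1 x) xC add1n ltnS => hn.
have [fxA cfx] := hf _ xC.
have := IH (C `\ x) hn (A `\` f x); rewrite (cardfsDS fxA) => h.
have fA := fsubset_leq_card fxA.
suff : (#|` C `\ x| * c <= #|` A| - #|` f x|)%N by rewrite mulSn; lia.
apply: h.
  move=> y; rewrite !inE => /andP[yx yC]; have [fyA cfy] := hf _ yC; split => //.
  apply/fsubsetP => v vy; rewrite inE (fsubsetP fyA _ vy) andbT.
  by apply/negP => vx; move/eqP: yx; apply; exact: hd vy vx.
by move=> y z v; rewrite !inE => /andP[_ yC] /andP[_ zC]; exact: hd.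
Qed.
End fset_packing.

Lemma leq_card_fset_inj (K V : choiceType) (A : {fset K}) (B : {fset V}) (f : K -> V) :
  (forall a, a \in A -> f a \in B) -> {in A &, injective f} -> (#|` A| <= #|` B|)%N.
Proof.
move=> fAB finj; rewrite -(card_in_imfset imfset_key finj).
by apply: fsubset_leq_card; apply/fsubsetP => _ /imfsetP[a /= aA ->]; exact: fAB.
Qed.

(** * Hall's condition, tested on connected sets *)

Section hall.
Variables (V W : choiceType) (nb : V -> {fset W}).

Definition nbs (A : {fset V}) : {fset W} := \bigcup_(a <- A) nb a.

Lemma nbsP A w : reflect (exists2 a, a \in A & w \in nb a) (w \in nbs A).
Proof.
rewrite /nbs; apply: (iffP (bigfcupP _ _ _ _)).
  by move=> [a /andP[aA _] wa]; exists a.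
by move=> [a aA wa]; exists a => //; rewrite aA.
Qed.

Lemma nbsU A B : nbs (A `|` B) = nbs A `|` nbs B.
Proof.
apply/fsetP => w; rewrite inE; apply/nbsP/orP.
  by move=> [a]; rewrite inE => /orP[] h ?; [left|right]; apply/nbsP; exists a.
by move=> [] /nbsP[a h ?]; exists a => //; rewrite inE h ?orbT.
Qed.

Lemma nbsS A B : A `<=` B -> nbs A `<=` nbs B.
Proof.
by move=> /fsubsetP AB; apply/fsubsetP => w /nbsP[a /AB ? ?]; apply/nbsP; exists a.
Qed.

(** Connectedness of [A] in the graph that joins two vertices sharing a neighbour. *)
Definition conn A := forall B, B `<=` A -> B != fset0 -> B != A ->
  nbs B `&` nbs (A `\` B) != fset0.

(** A disconnected set splits into parts with disjoint neighbourhoods, and Hall's inequality adds up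
    over them. Connected sets are those on which a local argument can work. *)
Lemma hall_of_conn (und : V -> Prop) (avail : pred W) :
  (forall A, (forall a, a \in A -> und a) -> conn A ->
     (#|` A| <= #|` [fset w in nbs A | avail w]|)%N) ->
  forall A, (forall a, a \in A -> und a) ->
    (#|` A| <= #|` [fset w in nbs A | avail w]|)%N.
Proof.
move=> h A; have [n] := ubnP (#|` A|); elim: n A => // n IH A An uA.
have [cA|] := pselect (conn A); first exact: h.
move=> /existsNP[B] /not_implyP[BA] /not_implyP[B0] /not_implyP[BneA] /negP/negPn/eqP dis.
have cB : (#|` B| < #|` A|)%N by apply: fproper_ltn_card; rewrite fproperEneq BneA.
have cB0 : (0 < #|` B|)%N by rewrite cardfs_gt0.
have AB : A = B `|` (A `\` B) by rewrite fsetUDl fsetDv fsetD0; apply/esym/fsetUidPr.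
have cAB : #|` A| = (#|` B| + #|` A `\` B|)%N.
  by rewrite cardfsDS// subnKC// fsubset_leq_card.
have hB := IH B (leq_trans cB An) (fun a aB => uA a (fsubsetP BA _ aB)).
have hAB : (#|` A `\` B| <= #|` [fset w in nbs (A `\` B) | avail w]|)%N.
  apply: IH; last by move=> a; rewrite inE => /andP[_ /uA].
  by move: cAB An cB0; lia.
rewrite cAB; apply: leq_trans (leq_add hB hAB) _.
rewrite -cardfsUI (_ : _ `&` _ = fset0) ?cardfs0 ?addn0.
  apply: fsubset_leq_card; apply/fsubsetP => w; rewrite [in nbs A]AB nbsU !inE.
  by case/orP => /andP[-> ->] //; rewrite orbT.
apply/fsetP => w; have := congr1 (fun F : {fset W} => w \in F) dis; rewrite /= !inE.
by do 2 case: (_ \in nbs _) => //=; rewrite andbF.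
Qed.

(** If each available neighbour of [v] were needed elsewhere, each would be a neighbour of some
    tight set. Submodularity makes the union of these sets tight, and adjoining [v] to it violates
    Hall's inequality. *)
Lemma hall_step (und : V -> Prop) (avail : pred W) (v : V) : und v ->
  (forall A, (forall a, a \in A -> und a) ->
    (#|` A| <= #|` [fset w in nbs A | avail w]|)%N) ->
  exists w, [/\ w \in nb v, avail w & forall A, (forall a, a \in A -> und a) ->
    v \notin A -> (#|` A| <= #|` [fset w in nbs A | avail w] `\ w|)%N].
Proof.
move=> uv hall; apply: contrapT => nex.
pose N A := [fset w in nbs A | avail w].
have NU A B : N (A `|` B) = N A `|` N B.
  by apply/fsetP => w; rewrite /N nbsU !inE; case: (avail w); rewrite ?andbT ?andbF.
(* Together with [hall] this is an equality: a tight set can spare none of its available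
   neighbours. *)
pose tight A := [/\ (forall a, a \in A -> und a), v \notin A & (#|` N A| <= #|` A|)%N].
have tightU A B : tight A -> tight B -> tight (A `|` B).
  move=> [uA vA tA] [uB vB tB]; split.
  - by move=> a; rewrite inE => /orP[/uA|/uB].
  - by rewrite inE negb_or vA.
  - have := hall (A `&` B) (fun a aAB => uA a (fsubsetP (fsubsetIl _ _) a aAB)).
    rewrite -/(N _) NU => h.
    have h2 : (#|` N (A `&` B)| <= #|` N A `&` N B|)%N.
      apply: fsubset_leq_card; rewrite fsubsetI; apply/andP; split; apply/fsubsetP => w;
      rewrite /N !inE => /andP[wn ->]; rewrite andbT;
      by apply: (fsubsetP (nbsS _)) wn; rewrite ?fsubsetIl ?fsubsetIr.
    have := cardfsUI A B; have := cardfsUI (N A) (N B); lia.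
have cover (s : seq W) : (forall w, w \in s -> w \in N [fset v]) ->
    exists2 A, tight A & forall w, w \in s -> w \in N A.
  elim: s => [_|w s IH hs].
    exists fset0; last by [].
    split; rewrite ?inE// cardfs0 leqn0 cardfs_eq0; apply/eqP/fsetP => w.
    by rewrite /N !inE; apply/negbTE/negP => /andP[/nbsP[a]]; rewrite inE.
  have [|A tA hA] := IH; first by move=> w' ws; apply: hs; rewrite inE ws orbT.
  have wN : w \in N [fset v] by apply: hs; rewrite inE eqxx.
  have [B tB wB] : exists2 B, tight B & w \in N B.
    apply: contrapT => nB; apply: nex; exists w.
    move: (wN); rewrite /N !inE => /andP[/nbsP[a]]; rewrite inE => /eqP-> wv aw.
    split => // A' uA' vA'; rewrite leqNgt; apply/negP => lt.
    apply: nB; exists A'; last first.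
      apply/negPn/negP => nw; move: lt; rewrite (_ : _ `\ w = N A') ?ltnNge ?hall//.
      by apply/fsetP => x; rewrite in_fsetD1; case: eqVneq => //= ->; rewrite (negbTE nw).
    split => //; move: lt; rewrite -/(N A') (cardfsD1 w (N A')); case: (w \in N A'); lia.
  exists (A `|` B); first exact: tightU.
  by move=> w'; rewrite NU in_fsetU in_cons => /predU1P[->|/hA ->//]; rewrite wB orbT.
have [//|A [uA vA tA] hA] := cover (N [fset v]).
have h := hall (v |` A).
move: h; rewrite -/(N _) NU cardfsU1 vA.
have /fsetUidPr -> : N [fset v] `<=` N A by apply/fsubsetP.
have hv a : a \in v |` A -> und a by rewrite in_fset1U => /orP[/eqP->|/uA].
by move=> /(_ hv); lia.
Qed.

Fixpoint conn_ball (A : {fset V}) (a : V) (k : nat) : {fset V} :=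
  if k is k'.+1 then conn_ball A a k' `|` [fset b in A | nb b `&` nbs (conn_ball A a k') != fset0]
  else [fset a].

Lemma conn_ball_sub A a k : a \in A -> conn_ball A a k `<=` A.
Proof.
move=> aA; elim: k => [|k IH] /=; first by rewrite fsub1set.
by rewrite fsubUset IH; apply/fsubsetP => b; rewrite !inE => /andP[].
Qed.

(** In a connected set the ball gains a vertex at every step until it is everything. Hence a small
    connected set fits in a bounded window, and a large one contains large balls. *)
Lemma conn_ball_card A a k : conn A -> a \in A ->
  conn_ball A a k = A \/ (k < #|` conn_ball A a k|)%N.
Proof.
move=> cA aA; elim: k => [|k IH] /=; first by right; rewrite cardfs1.
set B := conn_ball A a k in IH *; have BA : B `<=` A by exact: conn_ball_sub.
set C := B `|` _.
have CA : C `<=` A by exact: (conn_ball_sub k.+1 aA).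
have BC : B `<=` C by exact: fsubsetUl.
case: IH => [BE|ltB]; first by left; apply/eqP; rewrite eqEfsubset CA -[X in X `<=` _]BE BC.
have [BE|BneA] := eqVneq B A; first by left; apply/eqP; rewrite eqEfsubset CA -[X in X `<=` _]BE BC.
right; have B0 : B != fset0 by rewrite -cardfs_gt0 (leq_ltn_trans _ ltB).
have /fset0Pn[w] := cA B BA B0 BneA.
rewrite inE => /andP[wB /nbsP[b]]; rewrite !inE => /andP[bB bA] wb.
apply: leq_ltn_trans ltB _; apply: fproper_ltn_card; rewrite fproperE BC.
apply/negP => /fsubsetP /(_ b); rewrite (negbTE bB) => h.
suff : false by []; apply: h; rewrite !inE bA (negbTE bB) /=; apply/fset0Pn; exists w.
by rewrite inE wb.
Qed.

End hall.

Lemma slack_halve k a n : (k.+1 * a <= k * n)%N -> ((2 * k).+1 * a <= 2 * k * n)%N.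
Proof. nia. Qed.

(** The growth factor [1 + 1/k] drops to [1 + 1/(2k)] when the number [c] of lost targets is at most
    [a/(2k)]: the surplus is halved, never exhausted. *)
Lemma slack_remove k a n c : (0 < k)%N -> (c * 2 * k <= a)%N -> (k.+1 * a <= k * n)%N ->
  (a <= n - c)%N /\ ((2 * k).+1 * a <= 2 * k * (n - c))%N.
Proof.
move=> k0 h1 h2; have h3 : (k * (a + 2 * c) <= k * n)%N by nia.
rewrite leq_pmul2l// in h3.
have [d nE] : exists d, n = (d + c)%N by exists (n - c)%N; lia.
by subst n; rewrite addnK; split; nia.
Qed.

(** * A matching along a free orbit, built by clopen steps *)

Section paradox.
Context {R : realType} {G : groupType} (Z : dynSystem R G).
Hypothesis tdZ : totally_disconnected [set: Z].
Variables (z0 : Z) (T : {fset G}).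
Hypothesis free_z0 : [set g | act Z g z0 = z0] = [set 1%g].
Hypothesis T_expands : forall A : {fset G},
  (4 * #|` A| <= #|` [fset (t * a)%g | t in T, a in A]|)%N.

Let cZ : compact [set: Z] := @space_compact R G Z.

(** The vertices are two copies of [G]. Matching both into a single [G] by left multiplications from
    [T] is a paradoxical decomposition. *)
Definition tnb (a : bool * G) : {fset G} := [fset (t * a.2)%g | t in T].

(** A partial matching given on the space itself: copy [i] of [z] goes to the translate of [z] by
    [pp_fun i z], and [pp_used] contains the targets taken. Along the orbit of [z0] it becomes a
    partial matching of [bool * G] into [G]. *)
Record partial_paradox := PartialParadox {
  pp_dom : bool -> set Z ; pp_used : set Z ; pp_fun : bool -> Z -> G }.
Implicit Types st : partial_paradox.

Let und st (a : bool * G) : Prop := ~ pp_dom st a.1 (act Z a.2 z0).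
Let avail st : pred G := fun x => `[< ~ pp_used st (act Z x z0) >].
Let nbA st (A : {fset bool * G}) := [fset w in nbs tnb A | avail st w].

(* The linear surplus in [ppi_hall] absorbs the loss caused by infinitely many
   simultaneous choices, provided that they are far apart in every orbit. *)
Record pp_inv st : Prop := PPInv {
  ppi_dom : forall i, clopen (pp_dom st i) ;
  ppi_used : clopen (pp_used st) ;
  ppi_loc : forall i z, pp_dom st i z -> \forall z' \near z, pp_fun st i z' = pp_fun st i z ;
  ppi_T : forall i z, pp_dom st i z -> pp_fun st i z \in T ;
  ppi_img : forall i z, pp_dom st i z -> pp_used st (act Z (pp_fun st i z) z) ;
  ppi_inj : forall z i j g h, pp_dom st i (act Z g z) -> pp_dom st j (act Z h z) ->
    (pp_fun st i (act Z g z) * g)%g = (pp_fun st j (act Z h z) * h)%g -> (i, g) = (j, h) ;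
  ppi_hall : exists r k, (0 < k)%N /\ forall A, (forall a, a \in A -> und st a) ->
    conn tnb A -> (#|` A| <= #|` nbA st A|)%N /\
    ((r <= #|` A|)%N -> (k.+1 * #|` A| <= k * #|` nbA st A|)%N) }.

Definition pp_ext st st' := forall i z, pp_dom st i z ->
  pp_dom st' i z /\ pp_fun st' i z = pp_fun st i z.

Let step_set : {fset G} := [fset (t^-1 * t')%g | t in T, t' in T].
Fixpoint window (k : nat) : {fset G} :=
  if k is k'.+1 then window k' `|` [fset (w * w')%g | w in step_set, w' in window k'] else [fset 1%g].

(** Vertices sharing a neighbour differ by some [t^-1 * t'], so a ball of given radius lies within a
    finite set of displacements that does not depend on [A]. *)
Lemma ball_window A a k b : b \in conn_ball tnb A a k ->
  exists2 w, w \in window k & b.2 = (w * a.2)%g.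
Proof.
elim: k b => [|k IH] b /=.
  by rewrite inE => /eqP->; exists 1%g; rewrite ?inE ?mul1g.
rewrite in_fsetU => /orP[/IH [w wk bE]|].
  by exists w => //; rewrite in_fsetU wk.
rewrite !inE => /andP[bA /fset0Pn[x]]; rewrite inE => /andP[/imfsetP[t /= tT xE] /nbsP[c cB]].
move=> /imfsetP[t' /= t'T xE']; have [w wk cE] := IH _ cB.
exists ((t^-1 * t') * w)%g; last by rewrite -!mulgA -cE -xE' xE mulKg.
rewrite in_fsetU; apply/orP; right; apply/imfset2P; exists (t^-1 * t')%g => /=.
  by apply/imfset2P; exists t => //; exists t'.
by exists w.
Qed.

Definition pp_start := PartialParadox (fun=> set0) set0 (fun _ _ => 1%g).

(** Of the factor 4 in [T_expands], the two copies of [G] consume a factor 2; the other 2 is the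
    surplus for [k = 1]. *)
Lemma pp_start_inv : pp_inv pp_start.
Proof.
split => //=; [by move=> _; exact: clopen0|exact: clopen0|].
exists 0%N, 1%N; split => // A _ _.
suff h : (2 * #|` A| <= #|` nbA pp_start A|)%N.
  by rewrite mul1n; split => // ; apply: leq_trans h; rewrite leq_pmull.
have -> : nbA pp_start A = [fset (t * a)%g | t in T, a in [fset v.2 | v in A]].
  apply/fsetP => x; rewrite !inE; apply/andP/imfset2P => /=.
    move=> [/nbsP[a aA /imfsetP[t /= tT ->]] _]; exists t => //; exists a.2 => //.
    by apply/imfsetP; exists a.
  move=> [t tT [_ /imfsetP[a /= aA ->] ->]]; split; last exact/asboolP.
  by apply/nbsP; exists a => //; apply/imfsetP; exists t.
apply: leq_trans (T_expands _).
rewrite (_ : 4 = 2 * 2)%N // -mulnA leq_pmul2l //.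
have hb b : (#|` [fset v in A | v.1 == b]| <= #|` [fset v.2 | v in A]|)%N.
  apply: (leq_card_fset_inj (f := snd)) => [a|a a'].
    by rewrite !inE => /andP[aA _]; apply/imfsetP; exists a.
  rewrite !inE => /andP[_ /eqP h1] /andP[_ /eqP h2] h3.
  by case: a a' h1 h2 h3 => ? ? [? ?] /= -> -> ->.
have : A `<=` [fset v in A | v.1 == true] `|` [fset v in A | v.1 == false].
  by apply/fsubsetP => -[b g] bgA; rewrite !inE /= bgA; case: b {bgA}.
move=> /fsubset_leq_card /leq_trans; apply; rewrite cardfsU.
by apply: leq_trans (leq_subr _ _) _; rewrite mul2n -addnn leq_add.
Qed.

(** Hall's condition supplies a target for one vertex, and the choice is repeated over a small
    clopen set. This takes infinitely many targets in the orbit of [z0], but far apart: on a large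
    connected set the surplus pays for them, while a small one meets at most one of them and looks
    like a set near [z0]. *)
Lemma pp_step st v : pp_inv st ->
  exists st', [/\ pp_inv st', pp_ext st st' & pp_dom st' v.1 (act Z v.2 z0)].
Proof.
case: v => i g /= inv.
have [dv|ndv] := pselect (pp_dom st i (act Z g z0)); first by exists st; split => //.
have [r [k [k0 hs]]] := ppi_hall inv.
have hall := @hall_of_conn _ _ tnb (und st) (avail st) (fun A uA cA => (hs A uA cA).1).
have [u [unb au hu]] := @hall_step _ _ tnb (und st) (avail st) (i, g) ndv hall.
have /imfsetP[t /= tT uE] := unb.
(* From size [m] on, the surplus is available ([r]) and covers one lost target even after halving
   ([2 * k]). *)
pose m := (r + 2 * k)%N.
(* Seen from a point of [E], [Win] contains every vertex of a connected set of size below [m] that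
   loses a target, the neighbours of these vertices, and [u] and [g]. On [Win] the state at a point
   of [E] will be the state at [z0]. *)
pose Win1 := [fset (w * (t'^-1 * u))%g | w in window m, t' in T].
pose Win := Win1 `|` [fset (t' * x)%g | t' in T, x in Win1] `|` [fset u; g].
(* If balls of radius [m] belonging to two lost targets meet, the corresponding points of [E] differ
   by an element of [Wsp]; separation then makes the targets equal. *)
pose P := [fset (t' * w^-1)%g | t' in T, w in window m].
pose Q := [fset (w * t'^-1)%g | w in window m, t' in T].
pose Wsp := 1%g |` [fset (u^-1 * (p * q * u))%g | p in P, q in Q].
have [N1 nN1 sN1] := separates_near Wsp free_z0.
have nD j := clopen_act_near z0 Win (ppi_dom inv j).
have nU := clopen_act_near z0 Win (ppi_used inv).
have [E [cE Ez0 EN]] := clopen_nbhs cZ tdZ (filterI nN1 (filterI (filterI (nD true) (nD false)) nU)).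
have EN1 : separates Wsp E by apply: separatesS sN1 => e /EN[].
have ED j e x : x \in Win -> E e -> pp_dom st j (act Z x e) <-> pp_dom st j (act Z x z0).
  by move=> xW /EN[_ [[h1 h2] _]]; case: j; [exact: h1|exact: h2].
have EU e x : x \in Win -> E e -> pp_used st (act Z x e) <-> pp_used st (act Z x z0).
  by move=> xW /EN[_ [_ h]]; exact: h.
pose gE := [set z | E (act Z g^-1%g z)]; pose uEs := [set z | E (act Z u^-1%g z)].
have gW : g \in Win by rewrite !inE eqxx !orbT.
have uW : u \in Win by rewrite !inE eqxx !orbT.
have gED z : gE z -> ~ pp_dom st i z.
  by move=> gz; rewrite -(actKV g z) => /(ED _ _ _ gW gz).
have uEU z : uEs z -> ~ pp_used st z.
  move=> uz; rewrite -(actKV u z) => /(EU _ _ uW uz); exact/asboolP.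
pose dom' (j : bool) : set Z := if j == i then (pp_dom st j `|` gE)%classic else pp_dom st j.
pose fun' j z := if (j == i) && `[< gE z >] then t else pp_fun st j z.
pose st' := PartialParadox dom' (pp_used st `|` uEs)%classic fun'.
have dom'P j z : dom' j z -> pp_dom st j z \/ j = i /\ gE z.
  by rewrite /dom'; case: eqP => [->|_]; [case => ?; [left|right]|left].
have domS j z : pp_dom st j z -> dom' j z by rewrite /dom'; case: eqP => // _; left.
have gEdom z : gE z -> dom' i z by rewrite /dom' eqxx; right.
have fun_old j z : pp_dom st j z -> fun' j z = pp_fun st j z.
  by rewrite /fun'; case: eqP => //= -> dz; case: asboolP => // /gED.
have fun_new z : gE z -> fun' i z = t by rewrite /fun' eqxx /=; case: asboolP.
have cgE : clopen gE by exact: act_clopen.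
have cuE : clopen uEs by exact: act_clopen.
have domj_nbhs j z : pp_dom st j z -> nbhs z (pp_dom st j).
  by move=> dz; apply: open_nbhs_nbhs; split => //; case: (ppi_dom inv j).
have gE_nbhs z : gE z -> nbhs z gE.
  by move=> dz; apply: open_nbhs_nbhs; split => //; case: cgE.
exists st'; split => //=; [|by move=> j z dz; split; [exact: domS|exact: fun_old]|]; last first.
  by apply: gEdom; rewrite /gE /= actVK.
split => /=.
- by move=> j; rewrite /dom'; case: eqP => _; [apply: clopenU => //|]; exact: ppi_dom.
- by apply: clopenU => //; exact: ppi_used.
- move=> j z /dom'P[dz|[-> gz]].
    rewrite fun_old//; apply: filterS2 (domj_nbhs _ _ dz) (ppi_loc inv dz) => z' dz' <-.
    exact: fun_old.
  by rewrite fun_new//; apply: filterS (gE_nbhs _ gz) => z' gz'; exact: fun_new.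
- move=> j z /dom'P[dz|[-> gz]]; first by rewrite fun_old//; exact: (ppi_T inv).
  by rewrite fun_new.
- move=> j z /dom'P[dz|[-> gz]]; first by left; rewrite fun_old//; exact: (ppi_img inv).
  right; rewrite fun_new// /uEs /= uE invgM -actM mulgVK; exact: gz.
- move=> z j1 j2 g1 g2 /dom'P[d1|[-> d1]] /dom'P[d2|[-> d2]].
  + by rewrite !fun_old//; exact: (ppi_inj inv).
  + rewrite (fun_old _ _ d1) (fun_new _ d2) => eq; exfalso.
    have := ppi_img inv d1; rewrite -actM eq actM; apply: uEU.
    by rewrite /uEs /= uE invgM -actM mulgVK.
  + rewrite (fun_old _ _ d2) (fun_new _ d1) => eq; exfalso.
    have := ppi_img inv d2; rewrite -actM -eq actM; apply: uEU.
    by rewrite /uEs /= uE invgM -actM mulgVK.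
  + by rewrite !fun_new// => /mulgI ->.
exists m, (2 * k)%N; split; first by rewrite muln_gt0.
move=> A uA' cA.
have uA a : a \in A -> und st a by move=> /uA' h /domS.
have [h1 h2] := hs A uA cA.
(* The available neighbours of [A] that the new choice consumes. *)
pose C := [fset x in nbA st A | `[< E (act Z (u^-1 * x)%g z0) >]].
have CN : C `<=` nbA st A by apply/fsubsetP => x; rewrite !inE => /andP[].
have N'E : nbA st' A = nbA st A `\` C.
  apply/fsetP => x; rewrite !inE /avail /= !asbool_neg asbool_or negb_or /uEs /= -actM.
  by case: (x \in nbs _ _) => //=; case: `[< pp_used _ _>] => //=; rewrite andbT.
have cN' : #|` nbA st' A| = (#|` nbA st A| - #|` C|)%N by rewrite N'E cardfsDS.
have CP x : x \in C -> [/\ E (act Z (u^-1 * x)%g z0), avail st x &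
    exists t' a, [/\ t' \in T, a \in A & x = (t' * a.2)%g]].
  rewrite !inE => /andP[/andP[/nbsP[a aA /imfsetP[t' /= t'T xE]] av] /asboolP Ex].
  by split; [exact: Ex|exact/asboolP|exists t', a].
have Cbig : (#|` C| * 2 * k <= #|` A|)%N -> (r <= #|` A|)%N -> (#|` A| <= #|` nbA st' A|)%N /\
    ((m <= #|` A|)%N -> ((2 * k).+1 * #|` A| <= 2 * k * #|` nbA st' A|)%N).
  by move=> hC /h2 /(slack_remove k0 hC) []; rewrite cN'; split.
have [C0|[x xC]] := fset_0Vmem C.
  rewrite cN' C0 cardfs0 subn0; split => // hm.
  have : (r <= #|` A|)%N by apply: leq_trans hm; rewrite leq_addr.
  by move=> /h2 /slack_halve.
have [t' [a [t'T aA xE]]] : exists t' a, [/\ t' \in T, a \in A & x = (t' * a.2)%g] by case: (CP _ xC).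
have [C1|Cne1] := eqVneq C [fset x].
  have [hm|hm] : (m <= #|` A|)%N \/ (#|` A| < m)%N by case: leqP; [left|right].
    apply: Cbig; rewrite ?C1 ?cardfs1 ?mul1n; apply: leq_trans hm; first exact: leq_addl.
    exact: leq_addr.
  split; last by rewrite leqNgt hm.
  (* A small [A] with the single loss [x]: shifting [A] by [c^-1] turns the loss of [x] into the
     loss of [u] at [z0], for which [hu] was provided. *)
  pose c := (u^-1 * x)%g; have Ec : E (act Z c z0) by case: (CP _ xC).
  have ballA : conn_ball tnb A a m = A.
    have [//|lt] := conn_ball_card m cA aA.
    by have := leq_trans (leq_ltn_trans (ltnW hm) lt) (fsubset_leq_card (conn_ball_sub tnb m aA)); rewrite ltnn.
  pose A0 := [fset (b.1, b.2 * c^-1)%g | b in A].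
  have cA0 : #|` A0| = #|` A|.
    by apply: card_imfset => -[b1 b2] [b1' b2'] /= [-> /mulIg ->].
  have bW b : b \in A -> (b.2 * c^-1)%g \in Win1.
    rewrite -{1}ballA => /ball_window[w wm ->]; apply/imfset2P; exists w => //.
    by exists t' => //; rewrite /c xE !invgM invgK !mulgA mulgK.
  have bWin b : b \in A -> (b.2 * c^-1)%g \in Win.
    by move=> bA; rewrite 2!in_fsetU bW.
  have uA0 b : b \in A0 -> und st b.
    move=> /imfsetP[b' /= b'A ->] /=; rewrite /und /= => h.
    by apply: (uA _ b'A); rewrite /und; move/(ED _ _ _ (bWin _ b'A) Ec): h; rewrite -actM mulgVK.
  have vA0 : (i, g) \notin A0.
    apply/negP => /imfsetP[b /= bA [ib gb]]; apply: (uA' _ bA) => /=; rewrite -ib; apply: gEdom.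
    by rewrite /gE /= gb invgM invgK -!actM mulgVK.
  have := hu A0 uA0 vA0; rewrite cA0 => /leq_trans; apply.
  apply: (leq_card_fset_inj (f := fun y => (y * c)%g)); last by move=> ? ? _ _ /mulIg.
  move=> y; rewrite !inE => /andP[yu /andP[/nbsP[b bA0 /imfsetP[t'' /= t''T yE]] avy]].
  have /imfsetP[b' /= b'A bE] := bA0.
  have yW : y \in Win.
    rewrite in_fsetU in_fsetU; apply/orP; left; apply/orP; right; apply/imfset2P.
    by exists t'' => //; exists (b'.2 * c^-1)%g; rewrite ?bW// yE bE.
  have avyc : avail st (y * c)%g.
    apply/asboolP => /=; rewrite actM => /(EU _ _ yW Ec); exact/asboolP.
  have ycN : (y * c)%g \in nbs tnb A.
    by apply/nbsP; exists b' => //; apply/imfsetP; exists t'' => //=; rewrite yE bE /= -!mulgA mulVg mulg1.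
  have := N'E => /fsetP /(_ (y * c)%g); rewrite [in RHS]in_fsetD C1 !inE ycN avyc /= andbT => ->.
  by apply/eqP => ycx; move/eqP: yu; apply; apply: (mulIg c); rewrite ycx /c mulVKg.
(* With two losses or more, the balls in [A] next to the lost targets are disjoint, so none of them
   exhausts [A] and each has more than [m] points. Losses are thus at most the fraction [1/m] of
   [A]. *)
have [x' x'C x'x] : exists2 x', x' \in C & x' != x.
  apply: contrapT => h; move/eqP: Cne1; apply; apply/fsetP => y; rewrite inE.
  apply/idP/eqP => [yC|->//]; apply: contrapT => /eqP yx; apply: h; by exists y.
have hf (y : G) : exists p : G * (bool * G), y \in C -> [/\ p.1 \in T, p.2 \in A & y = (p.1 * p.2.2)%g].
  have [/CP[_ _ [t1 [a1 h]]]|] := boolP (y \in C); first by exists (t1, a1).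
  by exists (t, (i, g)).
have [f fP] := choice hf.
pose B y := conn_ball tnb A (f y).2 m.
have Bdis y y' b : y \in C -> y' \in C -> b \in B y -> b \in B y' -> y = y'.
  move=> yC y'C /ball_window[w wm bE] /ball_window[w' w'm bE'].
  have [ty ay yE] := fP _ yC; have [ty' ay' yE'] := fP _ y'C.
  have [Ey _ _] := CP _ yC; have [Ey' _ _] := CP _ y'C.
  apply: (mulgI u^-1%g); apply: (mulIg (u^-1 * y')^-1%g); rewrite mulgV.
  apply: (EN1 _ _ _ _ _ _ Ey' Ey); rewrite ?inE ?eqxx//; last first.
    by rewrite act1 -actM mulgVK.
  apply/orP; right; apply/imfset2P; exists ((f y).1 * w^-1)%g.
    by apply/imfset2P; exists (f y).1 => //; exists w.
  exists (w' * (f y').1^-1)%g; first by apply/imfset2P; exists w' => //; exists (f y').1.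
  have y2 : (f y).2.2 = (w^-1 * (w' * (f y').2.2))%g by rewrite -bE' bE mulKg.
  rewrite y2 in yE; move: (f y).1 (f y').1 (f y').2.2 yE yE' => p1 p1' q -> ->.
  by rewrite !invgM invgK !mulgA mulgK.
have Bcard y : y \in C -> (m < #|` B y|)%N.
  move=> yC; have [_ ay _] := fP _ yC.
  have [BE|//] := conn_ball_card m cA ay; exfalso.
  have [y' y'C yy'] : exists2 y', y' \in C & y' != y.
    by have [<-|?] := eqVneq x y; [exists x'|exists x].
  have [_ ay' _] := fP _ y'C.
  have mem_B b k' : b \in A -> b \in conn_ball tnb A b k'.
    by move=> bA; elim: k' => [|k' IH] /=; rewrite ?inE ?eqxx// IH.
  move/eqP: yy'; apply; apply: (Bdis _ _ (f y').2) => //; first exact: mem_B.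
  by rewrite /B BE.
have hm : (#|` C| * m <= #|` A|)%N.
  apply: fset_packing Bdis => y yC.
  by split; [apply: conn_ball_sub; case: (fP _ yC)|exact/ltnW/Bcard].
have C0 : (0 < #|` C|)%N by rewrite cardfs_gt0; apply/fset0Pn; exists x.
apply: Cbig; apply: leq_trans hm.
  by rewrite -mulnA leq_mul2l leq_addl orbT.
by apply: leq_trans (leq_pmull _ C0); rewrite leq_addr.
Qed.

(** Each vertex over the orbit of [z0] is eventually matched and no choice is revised, so the
    choices have a limit on an open set. Injectivity holds along every orbit because [ppi_inj]
    speaks of all points [z]. *)
Lemma paradox_exists (en : nat -> G) : (forall g, exists n, en n = g) ->
  exists (O : set Z) (s : bool -> Z -> G), [/\ open O, forall g, O (act Z g z0),
    forall i z, O z -> s i z \in T,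
    forall i z, O z -> \forall z' \near z, s i z' = s i z &
    forall z i j g h, O (act Z g z) -> O (act Z h z) ->
      (s i (act Z g z) * g)%g = (s j (act Z h z) * h)%g -> (i, g) = (j, h)].
Proof.
move=> enP.
pose e n : bool * G := (odd n, en n./2).
have eP v : exists n, e n = v.
  case: v => b g; have [n <-] := enP g; exists (b + n.*2)%N.
  by rewrite /e oddD odd_double addbF half_bit_double; case: b.
pose S := {st | pp_inv st}.
have hF (p : nat * S) : exists q : S, pp_ext (sval p.2) (sval q) /\
    pp_dom (sval q) (e p.1).1 (act Z (e p.1).2 z0).
  have [st' [inv ext d]] := pp_step (e p.1) (svalP p.2).
  by exists (exist _ st' inv).
have [F FP] := choice hF.
pose fix St n : S := if n is n'.+1 then F (n', St n') else exist _ pp_start pp_start_inv.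
have ext1 n : pp_ext (sval (St n)) (sval (St n.+1)) by have [] := FP (n, St n).
have ext m n : (m <= n)%N -> pp_ext (sval (St m)) (sval (St n)).
  elim: n => [|n IH]; first by rewrite leqn0 => /eqP ->.
  rewrite leq_eqVlt => /predU1P[->//|]; rewrite ltnS => /IH h i z dz.
  by have [d <-] := h _ _ dz; exact: ext1.
pose Oi i := \bigcup_n pp_dom (sval (St n)) i.
have oOi i : open (Oi i).
  by apply: bigcup_open => n _; case: (ppi_dom (svalP (St n)) i).
pose s i z := pp_fun (sval (St (xget 0%N [set n | pp_dom (sval (St n)) i z]))) i z.
have sE n i z : pp_dom (sval (St n)) i z -> s i z = pp_fun (sval (St n)) i z.
  move=> dz; rewrite /s; set n' := xget _ _.
  have dz' : pp_dom (sval (St n')) i z := @xgetI _ 0%N [set n | pp_dom (sval (St n)) i z] n dz.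
  have [le|/ltnW le] := leqP n n'; first by have [_] := ext _ _ le _ _ dz.
  by have [_ ->] := ext _ _ le _ _ dz'.
exists (Oi true `&` Oi false)%classic, s; split.
- exact: openI.
- move=> g; have h i : Oi i (act Z g z0).
    have [n en_] := eP (i, g); exists n.+1 => //=.
    by have [_] := FP (n, St n); rewrite [(n, St n).1]/= en_.
  by split.
- move=> i z [z1 z2]; have [n _ dz] : Oi i z by case: i.
  by rewrite (sE n)//; exact: (ppi_T (svalP (St n))).
- move=> i z [z1 z2]; have [n _ dz] : Oi i z by case: i.
  have nd : nbhs z (pp_dom (sval (St n)) i).
    by apply: open_nbhs_nbhs; split => //; case: (ppi_dom (svalP (St n)) i).
  apply: filterS2 nd (ppi_loc (svalP (St n)) dz) => z' dz'.
  by rewrite !(sE n).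
move=> z i j g h [z1 z2] [z1' z2'].
have [n _ dn] : Oi i (act Z g z) by case: i.
have [m _ dm] : Oi j (act Z h z) by case: j.
have [dn' _] := ext _ _ (leq_maxl n m) _ _ dn.
have [dm' _] := ext _ _ (leq_maxr n m) _ _ dm.
rewrite !(sE (maxn n m))//; exact: (ppi_inj (svalP (St (maxn n m)))).
Qed.

End paradox.

(** * Sets with small perimeter *)

Lemma leq_card_bigfcup (I V : choiceType) (r : seq I) (f : I -> {fset V}) :
  (#|` \bigcup_(i <- r) f i| <= \sum_(i <- r) #|` f i|)%N.
Proof.
elim: r => [|x r IH]; first by rewrite !big_nil cardfs0.
by rewrite !big_cons (leq_trans (leq_card_fsetU _ _).1)// leq_add2l.
Qed.

Lemma folner_count f f1 sg t ps K : (f1 <= t * ps)%N -> (f <= f1 + sg)%N ->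
  ((2 * (t + K)).+1 * sg <= t * f)%N -> (f <= 2 * t * ps)%N.
Proof.
set n := (2 * (t + K)).+1 => c1 c2 c3.
have h : (n * f <= n * f1 + t * f)%N.
  by apply: leq_trans (leq_mul (leqnn n) c2) _; rewrite mulnDr leq_add2l.
have hf : (f <= 2 * f1)%N.
  rewrite -(@leq_pmul2l (n - t)); last by rewrite /n; lia.
  rewrite mulnBl leq_subLR addnC; apply: leq_trans h _; rewrite leq_add2r mulnA leq_mul2r.
  by apply/orP; right; rewrite /n; lia.
by apply: leq_trans hf _; rewrite -mulnA leq_mul2l c1 orbT.
Qed.

Section folner.
Variable G : groupType.
Implicit Types (A B C F K : {fset G}).

Definition folner := forall K n, exists2 F, F != fset0 &
  forall k, k \in K -> (n * #|` [fset f in F | (k * f)%g \notin F]| <= #|` F|)%N.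

Definition gmul A B : {fset G} := [fset (a * b)%g | a in A, b in B].

Lemma gmulP A B x : reflect (exists a b, [/\ a \in A, b \in B & x = (a * b)%g]) (x \in gmul A B).
Proof.
apply: (iffP (imfset2P _ _ _ _ _)) => [[a /= aA [b /= bB ->]]|[a [b [aA bB ->]]]].
  by exists a, b.
by exists a => //; exists b.
Qed.

Lemma mem_gmul A B a b : a \in A -> b \in B -> (a * b)%g \in gmul A B.
Proof. by move=> aA bB; apply/gmulP; exists a, b. Qed.

Lemma gmulA A B C : gmul A (gmul B C) = gmul (gmul A B) C.
Proof.
apply/fsetP => x; apply/gmulP/gmulP.
  move=> [a [_ [aA /gmulP[b [c [bB cC ->]]] ->]]]; exists (a * b)%g, c.
  by rewrite mulgA mem_gmul.
move=> [_ [c [/gmulP[a [b [aA bB ->]]] cC ->]]]; exists a, (b * c)%g.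
by rewrite mulgA mem_gmul.
Qed.

(** A pair [K], [n] without Folner set makes every finite set grow by the factor [1 + 1/n] when
    multiplied by [K] with 1 adjoined. By Bernoulli's inequality [3 * n] iterations yield the factor
    4. *)
Lemma not_folner_expands : ~ folner -> exists T : {fset G}, forall A,
  (4 * #|` A| <= #|` gmul T A|)%N.
Proof.
move=> /existsNP[K] /existsNP[n] nF.
have step A : (n.+1 * #|` A| <= n * #|` gmul (1%g |` K) A|)%N.
  have [->|A0] := eqVneq A fset0; first by rewrite cardfs0 muln0.
  have [k kK lt] : exists2 k, k \in K & (#|` A| < n * #|` [fset f in A | (k * f)%g \notin A]|)%N.
    apply: contrapT => h; apply: nF; exists A => // k kK; rewrite leqNgt; apply/negP => lt.
    by apply: h; exists k.
  have : (#|` A| + #|` [fset f in A | (k * f)%g \notin A]| <= #|` gmul (1%g |` K) A|)%N.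
    pose B := [fset f in A | (k * f)%g \notin A].
    have <- : #|` [fset (k * f)%g | f in B]| = #|` B| by apply: card_imfset; exact: mulgI.
    rewrite -cardfsUI (_ : A `&` _ = fset0) ?cardfs0 ?addn0.
      apply: fsubset_leq_card; apply/fsubsetP => x; rewrite in_fsetU => /orP[xA|].
        by apply/gmulP; exists 1%g, x; rewrite mul1g !inE eqxx.
      move=> /imfsetP[f /=]; rewrite !inE => /andP[fA _] ->.
      by apply: mem_gmul => //; rewrite !inE kK orbT.
    apply/fsetP => x; rewrite [in RHS]inE in_fsetI; apply/negbTE/negP => /andP[xA].
    by move=> /imfsetP[f /=]; rewrite !inE => /andP[_ fA] xE; rewrite -xE xA in fA.
  move: (#|` A|) (#|` [fset f in A | _]|) (#|` gmul _ _|) lt => a b c; nia.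
pose fix T j := if j is j'.+1 then gmul (1%g |` K) (T j') else [fset 1%g].
have iter j A : (n.+1 ^ j * #|` A| <= n ^ j * #|` gmul (T j) A|)%N.
  elim: j => [|j IH] /=.
    rewrite !expn0 !mul1n; apply: fsubset_leq_card; apply/fsubsetP => x xA.
    by apply/gmulP; exists 1%g, x; rewrite mul1g inE eqxx.
  have := step (gmul (T j) A); rewrite gmulA => h; rewrite !expnS.
  move: (#|` gmul (gmul _ _) A|) (#|` gmul (T j) A|) (#|` A|) (n.+1 ^ j)%N (n ^ j)%N IH h => c b a x y.
  by move=> h1 h2; have := leq_mul (leqnn y) h2; have := leq_mul (leqnn n.+1) h1; lia.
have n0 : (0 < n)%N.
  rewrite lt0n; apply/negP => /eqP n0; apply: nF; exists [fset 1%g].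
    by apply/fset0Pn; exists 1%g; rewrite inE.
  by move=> k _; rewrite n0 mul0n.
exists (T (3 * n)%N) => A.
have h : (4 * n ^ (3 * n) <= n.+1 ^ (3 * n))%N.
  have b m : (n ^ m * (n + m) <= n * n.+1 ^ m)%N.
    elim: m => [|m IH]; first by rewrite !expn0 mul1n muln1 addn0.
    rewrite !expnS; move: (n ^ m)%N (n.+1 ^ m)%N IH => x y IH; nia.
  have := b (3 * n)%N; move: (n ^ _)%N (n.+1 ^ _)%N => x y h.
  by rewrite -(@leq_pmul2l n)//; nia.
have := leq_trans (leq_mul h (leqnn #|` A|)) (iter (3 * n)%N A).
rewrite mulnAC mulnC leq_pmul2l // expn_gt0 n0 //.
Qed.

(** * Minimisers of perimeter minus size *)

Section piece.
Variables (s : nat -> G) (r : pred G).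

(** The predicate [r] marks the sites left free by earlier stages. An edge counts as boundary only
    if both of its ends are free, since otherwise it meets an earlier piece. *)
Definition piece_bd C j := [fset a in C | [&& r a, r (s j * a)%g & (s j * a)%g \notin C]].
Definition piece_sites C := [fset a in C | r a].
(** The weights [2^-j] make one functional control all directions with a summable total; the scaling
    by [2 ^ q] keeps it in [nat]. *)
Definition piece_per C q := (\sum_(j < q) 2 ^ (q - j) * #|` piece_bd C j|)%N.

(* [C] minimises [p * perimeter - size] among the subsets of a Folner set;
   comparing it with the complement of a window [D] bounds the perimeter of
   [C] inside [D] by that of [D]. *)
Lemma folner_piece : folner -> (exists T : {fset G}, forall g, exists2 t, t \in T & r (t * g)%g) ->
  forall q p, exists C,
    [/\ (p * piece_per C q < 2 ^ q * #|` piece_sites C|)%N &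
      forall D : pred G,
      (p * (\sum_(j < q) 2 ^ (q - j) * #|` [fset a in piece_bd C j | D a]|) <=
       2 ^ q * #|` [fset a in piece_sites C | D a]| +
       p * (\sum_(j < q) 2 ^ (q - j) *
         #|` [fset a in piece_sites C | D a && ~~ D ((s j)^-1 * a)%g]|))%N].
Proof.
move=> fol [T hT] q p.
(* A sufficiently invariant Folner set: the finite return set [T] forces a fixed proportion, about
   [1 / (2 |T|)], of its elements to be free sites, while its perimeter is as small as desired. *)
have [F F0 Fneg] : exists2 F, F != fset0 & (p * piece_per F q < 2 ^ q * #|` piece_sites F|)%N.
  pose n := (2 * (#|` T| + p * q * #|` T|)).+1.
  have [F F0 hF] := fol (T `|` [fset s j | j in iota 0 q]) n.
  exists F => //.
  have cF0 : (0 < #|` F|)%N by rewrite cardfs_gt0.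
  have hs j : (j < q)%N -> (n * #|` piece_bd F j| <= #|` F|)%N.
    move=> jq; apply: leq_trans (hF (s j) _); last first.
      by rewrite in_fsetU; apply/orP; right; apply/imfsetP; exists j => //=; rewrite mem_iota.
    rewrite leq_mul2l; apply/orP; right; apply: fsubset_leq_card; apply/fsubsetP => a.
    by rewrite !inE => /andP[-> /and3P[_ _ ->]].
  have hper : (n * piece_per F q <= q * (2 ^ q * #|` F|))%N.
    rewrite /piece_per big_distrr /= -[X in (X * (_ * _))%N]card_ord -sum_nat_const.
    apply: leq_sum => j _; rewrite mulnCA; apply: leq_mul; last exact: hs.
    by rewrite leq_pexp2l// leq_subr.
  have hsites : (#|` F| <= 2 * #|` T| * #|` piece_sites F|)%N.
    pose F1 := [fset f in F | [forall t : T, (val t * f)%g \in F]].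
    have c1 : (#|` F1| <= #|` T| * #|` piece_sites F|)%N.
      have : F1 `<=` \bigcup_(t <- T) [fset (t^-1 * a)%g | a in piece_sites F].
        apply/fsubsetP => f; rewrite !inE => /andP[fF /forallP h].
        have [t tT rt] := hT f; apply/bigfcupP; exists t; rewrite ?tT//.
        apply/imfsetP; exists (t * f)%g => /=; last by rewrite mulKg.
        by rewrite !inE rt (h [` tT]).
      move=> /fsubset_leq_card /leq_trans; apply; apply: leq_trans (leq_card_bigfcup _ _) _.
      rewrite card_fset_sum1 big_distrl /=; apply: leq_sum => t _.
      by rewrite mul1n leq_imfset_card.
    have c2 : (#|` F| <= #|` F1| + \sum_(t <- T) #|` [fset f in F | (t * f)%g \notin F]|)%N.
      have : F `<=` F1 `|` \bigcup_(t <- T) [fset f in F | (t * f)%g \notin F].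
        apply/fsubsetP => f fF; rewrite in_fsetU !inE fF /=.
        case: forallP => //= h; apply/bigfcupP; apply: contrapT => h'.
        apply: h => t; apply: contrapT => /negP ht; apply: h'.
        by exists (val t); rewrite ?inE ?fF ?ht ?andbT//; exact: valP.
      move=> /fsubset_leq_card /leq_trans; apply.
      by apply: leq_trans (leq_card_fsetU _ _).1 _; rewrite leq_add2l leq_card_bigfcup.
    have c3 : (n * \sum_(t <- T) #|` [fset f in F | (t * f)%g \notin F]| <= #|` T| * #|` F|)%N.
      rewrite big_distrr /= card_fset_sum1 big_distrl /=; rewrite big_seq [leqRHS]big_seq; apply: leq_sum => t tT.
      by rewrite mul1n hF// in_fsetU tT.
    exact: folner_count c1 c2 c3.
  have sites0 : (0 < #|` piece_sites F|)%N by move: hsites cF0; case: (#|` piece_sites F|); lia.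
  rewrite -(@ltn_pmul2l n)//; apply: leq_ltn_trans (_ : p * q * (2 ^ q * #|` F|) < _)%N.
    by move: hper; rewrite /n; nia.
  have q0 : (0 < 2 ^ q)%N by rewrite expn_gt0.
  apply: leq_ltn_trans (_ : p * q * (2 ^ q * (2 * #|` T| * #|` piece_sites F|)) < _)%N.
    by rewrite leq_mul2l leq_mul2l hsites !orbT.
  rewrite /n; move: (2 ^ q)%N q0 (#|` T|) (#|` piece_sites F|) sites0 => a a0 b c c0.
  have : (0 < a * c)%N by rewrite muln_gt0 a0.
  by move: (a * c)%N (mulnC a c); nia.
(* Counting the missing sites instead of subtracting the sites keeps the functional nonnegative, so
   that a minimum exists in [nat]. *)
pose Phi C := (p * piece_per C q + 2 ^ q * (#|` F| - #|` piece_sites C|))%N.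
have ex : exists m, `[< exists2 C, C `<=` F & Phi C = m >] by exists (Phi F); apply/asboolP; exists F.
case: (ex_minnP ex) => m /asboolP[C CF Cm] Cmin; exists C.
have sitesF A : A `<=` F -> (#|` piece_sites A| <= #|` F|)%N.
  move=> AF; apply: fsubset_leq_card; apply/fsubsetP => a; rewrite !inE => /andP[aA _].
  exact: (fsubsetP AF).
have min A : A `<=` F -> (Phi C <= Phi A)%N.
  by move=> AF; rewrite Cm; apply: Cmin; apply/asboolP; exists A.
split.
  have := min F (fsubset_refl F); rewrite /Phi.
  have e1 : (2 ^ q * (#|` F| - #|` piece_sites C|) + 2 ^ q * #|` piece_sites C| = 2 ^ q * #|` F|)%N.
    by rewrite -mulnDr subnK// sitesF.
  have e2 : (2 ^ q * (#|` F| - #|` piece_sites F|) + 2 ^ q * #|` piece_sites F| = 2 ^ q * #|` F|)%N.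
    by rewrite -mulnDr subnK// sitesF.
  by move: Fneg e1 e2; lia.
move=> D.
(* Cutting out the window removes the boundary inside it and creates new boundary only along edges
   that enter it. *)
pose C' := [fset a in C | ~~ D a].
have C'F : C' `<=` F.
  by apply: fsubset_trans CF; apply/fsubsetP => a; rewrite !inE => /andP[].
have hsz : #|` piece_sites C| = (#|` [fset a in piece_sites C | D a]| + #|` piece_sites C'|)%N.
  rewrite -(cardfsID [fset a in piece_sites C | D a] (piece_sites C)).
  congr addn; congr (size (enum_fset _)); apply/fsetP => a; rewrite !inE.
    by case: (a \in C) => //=; case: (r a) => //=.
  by case: (a \in C) => //=; case: (r a) => //=; case: (D a).
have hbd j : (#|` piece_bd C' j| + #|` [fset a in piece_bd C j | D a]| <= #|` piece_bd C j| +
    #|` [fset a in piece_sites C | D a && ~~ D ((s j)^-1 * a)%g]|)%N.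
  pose B1 := [fset a in piece_bd C j | ~~ D a].
  pose B2 := [fset a in piece_bd C' j | (s j * a)%g \in C].
  have c1 : (#|` piece_bd C' j| <= #|` B1| + #|` B2|)%N.
    apply: leq_trans (leq_card_fsetU _ _).1; apply: fsubset_leq_card; apply/fsubsetP => a.
    rewrite !inE => /andP[/andP[-> ->] /and3P[-> -> nC]] /=; rewrite nC /=.
    by case: (_ \in C); rewrite ?orbT.
  have c2 : (#|` B1| + #|` [fset a in piece_bd C j | D a]| = #|` piece_bd C j|)%N.
    rewrite -[RHS](cardfsID [fset a in piece_bd C j | D a]) addnC.
    congr addn; congr (size (enum_fset _)); apply/fsetP => a; rewrite !inE.
      by case: (a \in C) => //=; case: (D a) => //=; case: (r a) => //=; case: (r _) => //=; case: (_ \in C).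
    by case: (a \in C) => //=; case: (D a) => //=; case: (r a) => //=; case: (r _) => //=; case: (_ \in C).
  have c3 : (#|` B2| <= #|` [fset a in piece_sites C | D a && ~~ D ((s j)^-1 * a)%g]|)%N.
    apply: (leq_card_fset_inj (f := fun a => (s j * a)%g)); last by move=> ? ? _ _ /mulgI.
    move=> a; rewrite !inE => /andP[/andP[/andP[aC nDa] /and3P[ra rsa]] + sC].
    by rewrite sC rsa mulKg nDa /= negbK andbT => ->.
  lia.
have hper : (piece_per C' q + \sum_(j < q) 2 ^ (q - j) * #|` [fset a in piece_bd C j | D a]| <=
    piece_per C q + \sum_(j < q) 2 ^ (q - j) *
      #|` [fset a in piece_sites C | D a && ~~ D ((s j)^-1 * a)%g]|)%N.
  rewrite /piece_per -!big_split /=; apply: leq_sum => j _.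
  by rewrite -!mulnDr leq_mul2l hbd orbT.
have := min _ C'F; rewrite /Phi.
have e1 : (2 ^ q * (#|` F| - #|` piece_sites C|) + 2 ^ q * #|` piece_sites C| = 2 ^ q * #|` F|)%N.
  by rewrite -mulnDr subnK// sitesF.
have e2 : (2 ^ q * (#|` F| - #|` piece_sites C'|) + 2 ^ q * #|` piece_sites C'| = 2 ^ q * #|` F|)%N.
  by rewrite -mulnDr subnK// sitesF.
have := leq_mul (leqnn p) hper; rewrite !mulnDr.
move: e1 e2; rewrite hsz mulnDr; lia.
Qed.

End piece.
End folner.

Local Close Scope fset_scope.

(** * Invariant measures *)

Section truncate.
Context {R : realType} {d : measure_display} {T : measurableType d} (P : probability T R).

(** Puts a probability in the normal form required by [invMeasure], with value 0 off the measurable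
    sets. *)
Definition mtrunc (A : set T) : \bar R := if `[< measurable A >] then P A else 0%E.

Lemma mtruncE A : measurable A -> mtrunc A = P A.
Proof. by rewrite /mtrunc => mA; rewrite asboolT. Qed.

Let mtrunc0 : mtrunc set0 = 0%E. Proof. by rewrite mtruncE. Qed.
Let mtrunc_ge0 A : (0 <= mtrunc A)%E. Proof. by rewrite /mtrunc; case: ifP. Qed.
Let mtrunc_sigma : semi_sigma_additive mtrunc.
Proof.
move=> F mF tF mU; rewrite mtruncE//.
rewrite (_ : (fun n => _) = (fun n => \sum_(0 <= i < n) P (F i))%E); last first.
  by apply/funext => n; apply: eq_bigr => i _; rewrite mtruncE.
exact: measure_semi_sigma_additive.
Qed.
HB.instance Definition _ := isMeasure.Build d T R mtrunc mtrunc0 mtrunc_ge0 mtrunc_sigma.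
Let mtruncT : mtrunc setT = 1%E. Proof. by rewrite mtruncE// probability_setT. Qed.
HB.instance Definition _ := Measure_isProbability.Build d T R mtrunc mtruncT.

End truncate.

Lemma borel_open (T : ptopologicalType) (A : set T) : open A -> measurable (A : set (borel T)).
Proof. by move=> oA; exact: sub_gen_smallest. Qed.

Lemma borel_closed (T : ptopologicalType) (A : set T) : closed A -> measurable (A : set (borel T)).
Proof.
by move=> cA; rewrite -[A]setCK; apply: measurableC; apply: borel_open; exact: closed_openC.
Qed.

Lemma borel_mapP (S T : ptopologicalType) (f : S -> T) :
  (forall A : set T, open A -> measurable (f @^-1` A : set (borel S))) -> borel_map f.
Proof.
move=> h; apply: (@measurability _ _ (borel S) (borel T) setT (f : borel S -> borel T) (@open T)) => //.
by move=> _ [B oB <-]; rewrite setTI; exact: h.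
Qed.

Lemma continuous_borel (S T : ptopologicalType) (f : S -> T) : continuous f -> borel_map f.
Proof.
by move=> cf; apply: borel_mapP => A oA; apply: borel_open; apply: open_comp => // x _; exact: cf.
Qed.

Lemma borel_preimage (S T : ptopologicalType) (f : S -> T) (A : set (borel T)) : borel_map f ->
  measurable A -> measurable (f @^-1` A : set (borel S)).
Proof. by move=> bf mA; rewrite -[X in measurable X]setTI; exact: bf. Qed.

Section approx.
Context {R : realType}.
Implicit Types T : pmetricType R.

Lemma mdist_unif_continuous T (f : T -> R) (e : R) : compact [set: T] -> continuous f -> 0 < e ->
  exists2 d : R, 0 < d & forall x y, mdist x y < d -> `|f x - f y| < e.
Proof.
move=> cT cf e0.
have := (compact_near_coveringP [set: T]).1 cT R (0^'+)
  (fun d x => forall y, mdist x y < d -> `|f x - f y| < e) _.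
case=> [x _|d /= d0].
  have e20 : 0 < e / 2 by rewrite divr_gt0.
  have /cvgrPdist_lt/(_ _ e20)/mdist_nbhsP[r r0 hr] := cf x.
  exists ([set y | mdist x y < r / 2], [set d | d < r / 2]).
    split; first by apply/mdist_nbhsP; exists (r / 2); rewrite ?divr_gt0.
    by apply: nbhs_right_lt; rewrite divr_gt0.
  move=> [u d] /= [xu dr] y uy.
  have xy : mdist x y < r by have := metric_triangle x u y; lra.
  have xu' : mdist x u < r by lra.
  rewrite (_ : f u - f y = (f x - f y) - (f x - f u)); last by ring.
  by rewrite (le_lt_trans (ler_normB _ _))// (splitr e) ltrD// ?hr//.
move=> /= h'; exists (d / 2); first by rewrite divr_gt0.
move=> x y; apply: (h' (d / 2)) => //=; rewrite ?divr_gt0//.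
by rewrite sub0r normrN ger0_norm; lra.
Qed.

(** [h] takes the value attached to the first member of a finite clopen cover that contains the
    point; it is locally constant although [u] may be discontinuous. *)
Lemma clopen_approx T (V : set T) (u : T -> R) (e M : R) :
  compact [set: T] -> totally_disconnected [set: T] -> 0 < e ->
  (forall x : T, exists2 c : R, `|c| <= M & \forall x' \near x, ~ V x' -> `|c - u x'| < e) ->
  exists h : T -> R, [/\ continuous h, forall x, `|h x| <= M &
    forall x, ~ V x -> `|h x - u x| < e].
Proof.
move=> cT tdT e0 hu.
have step x : exists p : R * set T, [/\ clopen p.2, p.2 x, `|p.1| <= M &
    forall x', p.2 x' -> ~ V x' -> `|p.1 - u x'| < e].
  have [c cM /(clopen_nbhs cT tdT)[C [cC Cx hC]]] := hu x.
  by exists (c, C).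
have [F FP] := choice step.
have [||E [_ hE]] := @compact_finite_cover _ T T setT (fun x => (F x).2) cT.
- by move=> x _; have [[]] := FP x.
- by move=> x; exists x => //; have [] := FP x.
pose ix x := find (fun i => `[< (F i).2 x >]) E.
pose h x := (F (nth point E (ix x))).1.
have hix x : (F (nth point E (ix x))).2 x.
  have /(nth_find point) : has (fun i => `[< (F i).2 x >]) E.
    by have [i iE Fx] := hE x; apply/hasP; exists i => //; exact/asboolP.
  by move/asboolP.
exists h; split.
- move=> x; have n : \forall x' \near x, h x = h x'.
    have : \forall x' \near x, forall i, i \in E -> ((F i).2 x' <-> (F i).2 x).
      apply: near_fset => i _; have [cC _ _ _] := FP i; have [oC clC] := cC.
      have [Cx|nCx] := pselect ((F i).2 x).
        by apply: filterS (open_nbhs_nbhs (conj oC Cx)).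
      by apply: filterS (open_nbhs_nbhs (conj (closed_openC clC) nCx)).
    apply: filterS => x' hx'; rewrite /h /ix; congr (F (nth _ _ _)).1.
    by apply: eq_in_find => i iE; apply/asboolP/asboolP => /(hx' _ iE).
  apply/cvgrPdist_lt => d d0; apply: filterS n => x' ->; by rewrite subrr normr0.
- by move=> x; rewrite /h; have [] := FP (nth point E (ix x)).
- by move=> x; rewrite /h; have [_ _ _] := FP (nth point E (ix x)); apply.
Qed.

Lemma continuous_borel_real T (f : T -> R) : continuous f ->
  measurable_fun [set: borel T] (f : borel T -> R).
Proof.
move=> cf; apply: (measurability _ (RGenOInfty.measurableE R)) => //.
move=> _ [_ [x ->] <-]; rewrite setTI; apply: borel_open; exact: open_comp.
Qed.

(** Finite nets of radius [1/(n+1)] write every open set as a countable union of balls. *)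
Lemma borel_map_balls (S : ptopologicalType) T (f : S -> T) : compact [set: T] ->
  (forall (t : T) (r : R), 0 < r -> measurable ([set x | mdist t (f x) < r] : set (borel S))) ->
  borel_map f.
Proof.
move=> cT hf; apply: borel_mapP => A oA.
have cover n : exists E : {fset T}, forall x, exists2 t, t \in E & mdist t x < (n.+1%:R^-1 : R).
  have n0 : 0 < (n.+1%:R^-1 : R) by rewrite invr_gt0.
  have [||E [_ hE]] := @compact_finite_cover _ T T setT (fun t => [set x | mdist t x < (n.+1%:R^-1 : R)]) cT.
  - move=> t _; rewrite openE => x /= tx; apply/mdist_nbhsP.
    exists (n.+1%:R^-1 - mdist t x); first by rewrite subr_gt0.
    by move=> y; rewrite /= ltrBrDl; apply: le_lt_trans (metric_triangle _ _ _).
  - by move=> x; exists x => //=; rewrite mdistxx.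
  by exists E.
have [E hE] := choice cover.
pose good n t := forall x, mdist t x < (n.+1%:R^-1 : R) -> A x.
have -> : f @^-1` A = \bigcup_n \bigcup_(t in [set t | t \in E n /\ good n t])
    [set x | mdist t (f x) < (n.+1%:R^-1 : R)].
  apply/seteqP; split => [x /= Ax|x [n _ [t [tE gt] /gt]]//].
  have /mdist_nbhsP[d d0 hd] : nbhs (f x) A by apply: open_nbhs_nbhs.
  have d20 : 0 < d / 2 by rewrite divr_gt0.
  have [n /(_ n (leqnn n)) hn] := inv_succ_small d20.
  have [t tE tx] := hE n (f x); exists n => //; exists t => //; split => // y ty.
  apply: hd; apply: le_lt_trans (metric_triangle _ t _) _; rewrite (splitr d).
  by rewrite ltrD//; [rewrite metric_sym|]; apply: lt_trans hn.
apply: bigcupT_measurable => n; apply: fin_bigcup_measurable.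
  by apply: sub_finite_set (finite_fset (E n)) => t [].
by move=> t _; apply: hf; rewrite invr_gt0.
Qed.

End approx.

Section inv.
Context {R : realType} {G : groupType}.
Implicit Types X Y : dynSystem R G.

(** Apart from the underlying function, the packed structure consists of propositions only. *)
Lemma probability_ext d (T : measurableType d) (mu nu : probability T R) :
  (mu : set T -> \bar R) = nu -> mu = nu.
Proof.
case: mu => f c; case: nu => f' c' /= e; subst f'.
congr Probability.Pack.
case: c => [c1 c2 c3 c4 c5 c6 c7]; case: c' => [d1 d2 d3 d4 d5 d6 d7].
have e1 : c1 = d1 by case: c1 d1 {c2 d2} => ? ? [? ?]; congr isContent.Axioms_; exact: Prop_irrelevance.
subst d1.
have -> : c2 = d2 by case: c2 d2 => ? [?]; congr Content_isMeasure.Axioms_; exact: Prop_irrelevance.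
have -> : c3 = d3 by case: c3 d3 => ? [?]; congr isSFinite.Axioms_; exact: Prop_irrelevance.
have -> : c4 = d4 by case: c4 d4 => ? [?]; congr isSigmaFinite.Axioms_; exact: Prop_irrelevance.
have -> : c5 = d5 by case: c5 d5 => ? [?]; congr isFinite.Axioms_; exact: Prop_irrelevance.
have -> : c6 = d6 by case: c6 d6 => ? [?]; congr isSubProbability.Axioms_; exact: Prop_irrelevance.
have -> // : c7 = d7 by case: c7 d7 => ? [?]; congr isProbability.Axioms_; exact: Prop_irrelevance.
Qed.

Lemma inv_ext X (mu nu : invMeasure X) :
  (forall A : set (borel X), measurable A -> mu A = nu A) -> mu = nu.
Proof.
case: mu => mu a n; case: nu => nu a' n' /= h.
have emu : mu = nu.
  apply: probability_ext; apply/funext => A; have [mA|nA] := pselect (measurable A); first exact: h.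
  by rewrite n// n'.
by subst nu; congr InvMeasure; exact: Prop_irrelevance.
Qed.

Lemma act_borel X g : borel_map (act X g).
Proof. by apply: continuous_borel; exact: act_continuous. Qed.

Lemma inv_of_prob X (P : probability (borel X) R) :
  (forall g (A : set (borel X)), measurable A -> P (act X g @^-1` A) = P A) ->
  exists mu : invMeasure X, forall A : set (borel X), measurable A -> mu A = P A.
Proof.
move=> hP.
have h1 g (A : set (borel X)) : measurable A -> mtrunc P (act X g @^-1` A) = mtrunc P A.
  by move=> mA; rewrite !mtruncE ?hP//; exact: borel_preimage (act_borel _) mA.
have h2 (A : set (borel X)) : ~ measurable A -> mtrunc P A = 0%E.
  by move=> nA; rewrite /mtrunc asboolF.
by exists (InvMeasure h1 h2) => A mA; exact: mtruncE.
Qed.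

Lemma inv_le_null X (mu : invMeasure X) (N A B : set (borel X)) : measurable N ->
  mu N = 0%E -> measurable A -> measurable B -> (forall x, ~ N x -> A x -> B x) ->
  (mu A <= mu B)%E.
Proof.
move=> mN N0 mA mB h; apply: (@le_trans _ _ (mu (B `|` N))).
  apply: le_measure; rewrite ?inE//; first exact: measurableU.
  by move=> x Ax; have [Nx|/h/(_ Ax) Bx] := pselect (N x); [right|left].
by apply: le_trans (measureU2 _ mB mN) _; rewrite [X in (_ + X)%E]N0 adde0.
Qed.

Lemma inv_eq_null X (mu : invMeasure X) (N A B : set (borel X)) : measurable N ->
  mu N = 0%E -> measurable A -> measurable B -> (forall x, ~ N x -> A x <-> B x) ->
  mu A = mu B.
Proof.
move=> mN N0 mA mB h; apply/eqP; rewrite eq_le; apply/andP; split;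
  apply: (inv_le_null mN N0) => // x nx; exact: (h x nx).1 || exact: (h x nx).2.
Qed.

Lemma inv_push X Y (f : X -> Y) (mu : invMeasure X) (N : set (borel X)) :
  borel_map f -> measurable N -> mu N = 0%E ->
  (forall g x, ~ N x -> f (act X g x) = act Y g (f x)) ->
  exists nu : invMeasure Y, forall A : set (borel Y), measurable A -> nu A = mu (f @^-1` A).
Proof.
move=> bf mN N0 eqf.
pose mf : {mfun borel X >-> borel Y} := HB.pack (f : borel X -> borel Y) (@isMeasurableFun.Build _ _ (borel X) (borel Y) f bf).
have [|nu hnu] := @inv_of_prob Y (distribution mu mf).
  move=> g A mA; rewrite /distribution /pushforward /=.
  have mA' : measurable (f @^-1` A : set (borel X)) by exact: borel_preimage.
  have ma := @act_borel X g.
  have mB : measurable (act Y g @^-1` A : set (borel Y)).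
    by apply: borel_preimage mA; exact: act_borel.
  rewrite -[RHS](inv_measure_act mu g mA').
  apply: (inv_eq_null mN N0); [exact: borel_preimage mB|exact: borel_preimage mA'|].
  by move=> x nx; rewrite /= eqf.
by exists nu => A mA; rewrite hnu.
Qed.

(** Integrate the number of visits to [B] during [W]; by invariance each element of [W] contributes
    the measure of [B]. *)
Lemma inv_count X (mu : invMeasure X) (W : {fset G}) (B : set (borel X)) k : measurable B ->
  (forall x : X, (#|` [fset f in W | `[< B (act X f x) >]]%fset| <= k)%N) ->
  (#|` W|%:R%:E * mu B <= k%:R%:E)%E.
Proof.
move=> mB hB.
have mf f : measurable (act X f @^-1` B : set (borel X)).
  by apply: borel_preimage mB; exact: act_borel.
have -> : (#|` W|%:R%:E * mu B = \int[mu]_x (\sum_(f <- W) (\1_(act X f @^-1` B : set (borel X)) x)%:E))%E.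
  rewrite ge0_integral_sum//; last by move=> f; apply/measurable_EFinP; exact: measurable_indic.
  rewrite (eq_bigr (fun=> mu B)); last first.
    by move=> f _; rewrite integral_indic// setIT; exact: inv_measure_act.
  rewrite card_fset_sum1 natr_sum -sumEFin ge0_sume_distrl//.
  by apply: eq_bigr => f _; rewrite mul1e.
apply: (@le_trans _ _ (\int[mu]_x (cst k%:R%:E x))%E); last first.
  by rewrite integral_cst// [X in (_ * X)%E](@probability_setT _ _ _ mu) mule1.
apply: ge0_le_integral => //.
- by move=> x _; apply: sume_ge0 => f _; rewrite lee_fin.
- by apply: emeasurable_sum => f; apply/measurable_EFinP; exact: measurable_indic.
- move=> x _; rewrite sumEFin lee_fin.
  under eq_bigr => f _ do rewrite indicE.
  rewrite -natr_sum ler_nat; apply: leq_trans (hB x).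
  rewrite card_fset_sum1 -[leqRHS]big_fset_condE [leqRHS]big_mkcond /=; apply: leq_sum => f _.
  rewrite (_ : (x \in _) = `[< B (act X f x) >]); first by case: asboolP.
  by apply/idP/asboolP; rewrite inE.
Qed.

(** Uniform visit frequencies over finite windows take the place of an ergodic theorem, and serve
    all invariant measures at once. *)
Lemma inv_count0 X (mu : invMeasure X) (B : set (borel X)) : measurable B ->
  (forall n, exists2 W : {fset G}, W != fset0 & forall x : X,
    (n * #|` [fset f in W | `[< B (act X f x) >]]%fset| <= #|` W|)%N) ->
  mu B = 0%E.
Proof.
move=> mB h; apply/eqP; rewrite eq_le measure_ge0 andbT.
have fB : mu B \is a fin_num by exact: fin_num_measure.
rewrite -(fineK fB) lee_fin; apply/ler_addgt0Pr => e e0; rewrite add0r.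
have [N hN] := inv_succ_small e0; have [W W0 hW] := h N.+1.
have cW : (0 < #|` W|)%N by rewrite cardfs_gt0.
have := @inv_count X mu W B (#|` W| %/ N.+1) mB.
have /[swap] /[apply] : forall x : X, (#|` [fset f in W | `[< B (act X f x) >]]%fset| <= #|` W| %/ N.+1)%N.
  by move=> x; rewrite leq_divRL// mulnC.
rewrite -(fineK fB) -EFinM lee_fin => hle; apply: le_trans (ltW (hN N (leqnn N))).
rewrite -(@ler_pM2l _ #|` W|%:R) ?ltr0n//; apply: le_trans hle _.
rewrite ler_pdivlMr ?ltr0n// -natrM ler_nat; exact: leq_trunc_div.
Qed.

Lemma inv_separates X (mu : invMeasure X) (A : {fset G}) (B : set (borel X)) : measurable B ->
  separates A B -> (#|` A|%:R%:E * mu B <= 1)%E.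
Proof.
move=> mB sA.
have -> : #|` A| = #|` [fset a^-1%g | a in A]%fset|.
  by rewrite card_in_imfset//= => a b _ _ /invg_inj.
apply: (@inv_count X mu _ B 1 mB) => x; set D := [fset _ in _ | _]%fset.
have [->|/fset0Pn[f fD]] := eqVneq D fset0; first by rewrite cardfs0.
rewrite -(cardfs1 f); apply: fsubset_leq_card; apply/fsubsetP => f'.
move: fD; rewrite !inE /= => /andP[/imfsetP[/= a aA ->] /asboolP Ba] /andP[/imfsetP[/= b bA ->] /asboolP Bb].
by apply/eqP; congr (_^-1)%g; apply: (sA _ _ bA aA _ _ Bb Ba); rewrite !actKV.
Qed.

Lemma inv_integrable X (mu : invMeasure X) (u : borel X -> R) (M : R) :
  measurable_fun setT u -> (forall x, `|u x| <= M) -> mu.-integrable setT (EFin \o u).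
Proof.
move=> mu_ hM; apply: measurable_bounded_integrable => //.
  by rewrite (le_lt_trans (probability_le1 _ _))// ltry.
exists M; split; first exact: num_real.
by move=> N MN x _ /=; apply: le_trans (hM x) (ltW MN).
Qed.

Lemma inv_integral_close X (mu : invMeasure X) (V : set (borel X)) (u h : borel X -> R) (e d M : R) :
  measurable V -> (mu V <= d%:E)%E -> measurable_fun setT u -> measurable_fun setT h ->
  (forall x, `|u x| <= M) -> (forall x, `|h x| <= M) -> 0 <= e ->
  (forall x, ~ V x -> `|h x - u x| <= e) ->
  `|\int[mu]_x h x - \int[mu]_x u x| <= e + 2 * M * d.
Proof.
move=> mV Vd m_u m_h uM hM e0 close.
have iu := inv_integrable mu m_u uM; have ih := inv_integrable mu m_h hM.
have M0 : 0 <= M by exact: le_trans (normr_ge0 _) (uM point).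
rewrite -RintegralB//.
have m_hu : measurable_fun setT (fun x => h x - u x) by exact: measurable_funB.
have hu2 x : `|h x - u x| <= M + M by rewrite (le_trans (ler_normB _ _))// lerD.
apply: le_trans (le_normr_Rintegral _ (inv_integrable mu m_hu hu2)) _ => //.
have mI : measurable_fun setT (\1_V : borel X -> R) by exact: measurable_indic.
have m_g : measurable_fun setT (fun x : borel X => e + 2 * M * \1_V x).
  by apply: measurable_funD => //; apply: measurable_funM.
have I1 x : `|\1_V x : R| <= 1 by rewrite indicE; case: (x \in V); rewrite ?normr1 ?normr0.
have gM (x : borel X) : `|e + 2 * M * \1_V x| <= e + 2 * M.
  rewrite indicE; case: (x \in V) => /=; rewrite ?mulr1 ?mulr0 ?addr0 ger0_norm; lra.
apply: (@le_trans _ _ (\int[mu]_x (e + 2 * M * \1_V x))).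
  apply: le_Rintegral => //.
  - apply: (@inv_integrable _ _ _ (M + M)); first exact: measurableT_comp.
    by move=> x; rewrite normr_id.
  - exact: inv_integrable gM.
  move=> x _; rewrite indicE; have [|/negP nV] := boolP (x \in V).
    by move=> _ /=; have := hu2 x; rewrite mulr1; lra.
  by rewrite /= mulr0 addr0; apply: close => Vx; apply: nV; rewrite inE.
rewrite RintegralD//; last 2 first.
- by apply: (@inv_integrable _ _ _ e) => // x; rewrite ger0_norm.
- apply: (@inv_integrable _ _ _ (2 * M)); first exact: measurable_funM.
  by move=> x; rewrite normrM (ger0_norm (_ : 0 <= 2 * M)) ?ler_piMr//; lra.
rewrite Rintegral_cst// RintegralZl//; last exact: inv_integrable I1.
rewrite [X in fine X](@probability_setT _ _ _ mu) mulr1 lerD2l ler_wpM2l//; first lra.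
rewrite /Rintegral integral_indic// setIT.
have fV : mu V \is a fin_num by exact: fin_num_measure.
by rewrite -lee_fin fineK.
Qed.

Lemma push_integral X Y (p : X -> Y) (mu : invMeasure X) (nu : invMeasure Y) (f : borel Y -> R) (M : R) :
  borel_map p -> (forall A : set (borel Y), measurable A -> nu A = mu (p @^-1` A)) ->
  measurable_fun setT f -> (forall y, `|f y| <= M) ->
  \int[nu]_y f y = \int[mu]_x (f (p x)).
Proof.
move=> bp hn mf fM; rewrite /Rintegral; congr fine.
rewrite (eq_measure_integral (pushforward mu (p : borel X -> borel Y))); last by move=> A mA _; exact: hn.
rewrite (@integral_pushforward _ _ _ _ _ _ bp mu setT (EFin \o f))//.
  exact/measurable_EFinP.
by rewrite preimage_setT; apply: inv_integrable (fun x => fM (p x)); exact: measurableT_comp mf bp.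
Qed.

(** As [p] is only Borel, composing a test function with it gives no test function. Off [V] it can
    be approximated by a continuous one, and the smallness of [V] is uniform over all invariant
    measures. *)
Lemma push_continuous X Y (p : X -> Y) (F : invMeasure X -> invMeasure Y) :
  totally_disconnected [set: X] -> borel_map p ->
  (forall mu (A : set (borel Y)), measurable A -> F mu A = mu (p @^-1` A)) ->
  (forall e : R, 0 < e -> exists V : set X, [/\ open V,
    forall mu : invMeasure X, (mu V <= e%:E)%E &
    forall x : X, exists q : Y, \forall x' \near x, ~ V x' -> mdist q (p x') < e]) ->
  continuous F.
Proof.
move=> tdX bp hF hV.
have icont (h : continuousType X R) : continuous (fun mu : invMeasure X => integrals mu h).
  move=> mu; apply: (@continuous_comp _ _ _ (@integrals R G X) (fun u : {ptws continuousType X R -> R} => u h)).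
    exact: initial_continuous.
  exact: (@proj_continuous _ (fun=> R : topologicalType) h).
apply: continuous_comp_initial => mu.
have FF : Filter ((integrals (X:=Y) \o F) @ mu).
  by apply: (@fmap_filter _ _ _ _ (nbhs_filter mu)).
suff hsuff : forall f : continuousType Y R, (fun mu' => integrals (F mu') f) @ mu --> integrals (F mu) f.
  apply/(@cvg_sup _ _ _ _ _ FF) => f.
  apply/(@cvg_image _ _ _ _ _ FF).
    by apply/seteqP; split => // r _; exists (fun=> r).
  move=> A /(hsuff f) hA; exists ((fun g : {ptws continuousType Y R -> R} => g f) @^-1` A); first exact: hA.
  by apply/seteqP; split => [_ [g Ag <-]//|r Ar]; exists (fun=> r).
move=> f; apply/(@cvgrPdist_lt _ _ _ _ (nbhs_filter mu)) => e e0.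
have cf : continuous (f : Y -> R) by exact: cts_fun.
have [M [_ hM']] := compact_bounded (@continuous_compact _ _ (f : Y -> R) setT (continuous_subspaceT cf) (@space_compact _ _ Y)).
pose M' := `|M| + 1.
have fM y : `|f y| <= M' by apply: (hM' M'); rewrite /M' ?ltr_pwDr ?ler_norm//; exists y.
have M'0 : 0 < M' by rewrite /M' ltr_pwDr.
(* Twice an approximation error of [2 * e1], plus [e1] for the continuous test function. *)
pose e1 := e / 5; have e10 : 0 < e1 by rewrite /e1 divr_gt0.
have [d d0 hd] := mdist_unif_continuous (@space_compact _ _ Y) cf e10.
pose c := Num.min d (e1 / (2 * M')).
have c0 : 0 < c by rewrite lt_min d0 divr_gt0// mulr_gt0.
have [V [oV smallV hq]] := hV c c0.
have [|h [ch hM h_f]] := @clopen_approx R X V (fun x => f (p x)) e1 M' (@space_compact _ _ X) tdX e10.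
  move=> x; have [q hqx] := hq x; exists (f q); first exact: fM.
  by apply: filterS hqx => x' /[apply]; rewrite lt_min => /andP[/hd].
pose hc : continuousType X R := HB.pack h (isContinuous.Build _ _ h ch).
have bfp : measurable_fun [set: borel X] (fun x : borel X => f (p x)).
  exact: measurableT_comp (continuous_borel_real cf) bp.
have close (nu : invMeasure X) : `|integrals nu hc - integrals (F nu) f| <= 2 * e1.
  rewrite /integrals (@push_integral X Y p nu (F nu) f M' bp (hF nu) (continuous_borel_real cf) fM).
  apply: le_trans (@inv_integral_close X nu V (fun x => f (p x)) h e1 c M' (borel_open oV) (smallV nu) bfp
    (continuous_borel_real ch) (fun x => fM (p x)) hM (ltW e10) (fun x nV => ltW (h_f x nV))) _.
  have : 2 * M' * c <= e1 by rewrite mulrC -ler_pdivlMr ?mulr_gt0// ge_min lexx orbT.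
  lra.
have /cvgrPdist_lt/(_ _ e10) := icont hc mu.
apply: filterS => nu hnu.
have := close mu; have := close nu; move: hnu; rewrite /e1 ltr_norml !ler_norml ltr_norml; lra.
Qed.

End inv.

(** * The almost one-to-one extension of a tower *)

Section tower.
Context {R : realType} {G : groupType} {Z Y : dynSystem R G}.
Variables (pi : Y -> Z) (z0 : Z) (y0 : Y) (s : nat -> G).

Definition coset_cover (F : {fset G}) (E : set Z) : set Z :=
  [set z | exists2 f, f \in F & E (act Z f^-1%g z)].

Fixpoint lower (F : nat -> {fset G}) (E : nat -> set Z) (n : nat) : set Z :=
  if n is n'.+1 then lower F E n' `|` coset_cover (F n') (E n') else set0.

(* [tw_return] and [tw_small] make the stages so thin that almost every orbit
   leaves them; [tw_dense] makes the orbit of [z0] imitate every point of [Y]. *)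
Record tower := Tower {
  tw_F : nat -> {fset G} ; tw_E : nat -> set Z ; tw_lab : nat -> G -> G -> R ;
  tw_D : nat -> {fset G} ;
  tw_clopen : forall n, clopen (tw_E n) ;
  tw_base : forall n, tw_E n z0 ;
  tw_sep : forall n, separates (tw_F n) (tw_E n) ;
  tw_diam : forall n f e, f \in tw_F n -> tw_E n e ->
    mdist (act Z f z0) (act Z f e) < n.+1%:R^-1 ;
  tw_labP : forall n f t, tw_lab n f t = 0 \/ exists k, tw_lab n f t = 2^-1 ^+ k ;
  tw_return : forall n z, exists2 g, g \in tw_D n & ~ lower tw_F tw_E n (act Z g z) ;
  tw_small : forall m n, (m <= n)%N -> exists2 A : {fset G}, separates A (tw_E n) &
    (#|` tw_F n| * #|` tw_D m| * 2 ^ n <= #|` A|)%N ;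
  tw_dense : forall n y, exists h, mdist y (act Y h y0) < n.+1%:R^-1 /\
    forall j, (j < n)%N -> ~ lower tw_F tw_E n (act Z (s j) (pi y)) ->
    [/\ ~ lower tw_F tw_E n (act Z (s j * h)%g z0), (s j * h)%g \in tw_F n &
        forall t, tw_lab n (s j * h)%g t <= n.+1%:R^-1] }.

End tower.

(** Baire's argument with nested nonempty clopen sets in place of closed balls; compactness gives
    the common point. *)
Lemma compact_baire (R : realType) (T : pmetricType R) (O : nat -> set T) :
  compact [set: T] -> totally_disconnected [set: T] ->
  (forall n, open (O n) /\ dense (O n)) -> exists x, forall n, O n x.
Proof.
move=> cT tdT od.
pose S := {C : set T | clopen C /\ C !=set0}.
have step (p : nat * S) : exists C : S, sval C `<=` sval p.2 /\ sval C `<=` O p.1.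
  case: p => n [C [cC C0]] /=; have [oO dO] := od n.
  have [x [Cx Ox]] := dO C C0 cC.1.
  have [C' [cC' C'x C'O]] := clopen_nbhs cT tdT (open_nbhs_nbhs (conj (openI cC.1 oO) (conj Cx Ox))).
  have C'0 : C' !=set0 by exists x.
  by exists (exist _ C' (conj cC' C'0)); split => y /= /C'O[].
have [F FP] := choice step.
have S0 : clopen [set: T] /\ [set: T] !=set0 by split; [exact: clopenT|exists point].
pose fix C n : S := if n is n'.+1 then F (n', C n') else exist _ setT S0.
have dec m n : (m <= n)%N -> sval (C n) `<=` sval (C m).
  elim: n => [|n IH]; first by rewrite leqn0 => /eqP ->.
  rewrite leq_eqVlt => /predU1P[->//|]; rewrite ltnS => /IH h.
  exact: subset_trans (FP (n, C n)).1 h.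
have xex n : exists x, sval (C n) x by have [] := svalP (C n).
have [u uP] := choice xex.
have [x [_ clx]] := cT (u @ \oo) _ filterT.
have Cx n : sval (C n) x.
  have [[_ clC] _] := svalP (C n); apply: clC => B xB.
  have un : (u @ \oo) (sval (C n)) by exists n => // m /= nm; exact: dec nm _ (uP m).
  by have [y [? ?]] := clx _ _ un xB; exists y.
by exists x => n; exact: (FP (n, C n)).2 _ (Cx n.+1).
Qed.

Section hits.
Context {R : realType} {G : groupType}.
Implicit Types X Y : dynSystem R G.

Definition hits X (A : {fset G}) (B : set X) : set X := [set x | exists2 a, a \in A & B (act X a x)].

Lemma hits_open X (A : {fset G}) (B : set X) : open B -> open (hits A B).
Proof.
move=> oB; rewrite (_ : hits A B = \bigcup_(a in [set` A]) (act X a @^-1` B)).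
  by apply: bigcup_open => a _; exact: act_open.
by apply/seteqP; split => x [a aA Ba]; exists a.
Qed.

Lemma inv_le X (mu : invMeasure X) (A B : set (borel X)) :
  measurable A -> measurable B -> A `<=` B -> (mu A <= mu B)%E.
Proof. by move=> mA mB AB; apply: le_measure; rewrite ?inE. Qed.

Lemma hits_measure X (mu : invMeasure X) (A : {fset G}) (B : set X) (c : R) : open B ->
  (mu B <= c%:E)%E -> (mu (hits A B) <= (#|` A|%:R * c)%:E)%E.
Proof.
move=> oB Bc; elim/finSet_rect: A => A IH.
have [->|[a aA]] := fset_0Vmem A.
  rewrite (_ : hits fset0%fset B = set0) ?measure0 ?cardfs0 ?mul0r//.
  by apply/seteqP; split => x // [].
have -> : hits A B = act X a @^-1` B `|` hits (A `\ a)%fset B.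
  apply/seteqP; split => [x [b bA Bb]|x [Ba|[b + Bb]]].
  - by have [<-|ne] := eqVneq b a; [left|right; exists b => //; rewrite in_fsetD1 ne].
  - by exists a.
  - by rewrite in_fsetD1 => /andP[_ bA]; exists b.
have lt : (A `\ a `<` A)%fset by rewrite fproperD1.
apply: le_trans (measureU2 _ _ _) _.
- by apply: borel_open; exact: act_open.
- by apply: borel_open; exact: hits_open.
rewrite (cardfsD1 a A) aA natrD mulrDl mul1r EFinD leeD ?IH//.
by rewrite [leLHS](inv_measure_act mu a (borel_open oB)).
Qed.

Lemma inv_pull X Y (q : X -> Y) (B : set (borel Y)) (c : \bar R) : continuous q -> equivariant q ->
  measurable B -> (forall nu : invMeasure Y, (nu B <= c)%E) ->
  forall mu : invMeasure X, (mu (q @^-1` B) <= c)%E.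
Proof.
move=> cq eq mB h mu.
have [|nu hnu] := @inv_push _ _ X Y q mu set0 (continuous_borel cq) measurable0 (measure0 _).
  by move=> g x _; exact: eq.
by rewrite -hnu.
Qed.

End hits.

(** * The space of configurations over a tower *)

Section frame.
Context {R : realType} {G : groupType} {Z Y : dynSystem R G}.
Variables (pi : Y -> Z) (z0 : Z) (y0 : Y) (s : nat -> G).
Hypotheses (sP : forall g, exists n, s n = g) (pi_factor : factor_map pi) (pi0 : pi y0 = z0).
Hypotheses (mZ : minimal Z) (tdZ : totally_disconnected [set: Z]).
Variable (w : tower pi z0 y0 s).

Local Notation F := (tw_F w).
Local Notation E := (tw_E w).
Local Notation D := (tw_D w).
Local Notation low := (lower F E).
Local Notation lab := (tw_lab w).

Let piE g y : pi (act Y g y) = act Z g (pi y). Proof. by have [_ _] := pi_factor; apply. Qed.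
Let piC : continuous pi. Proof. by have [] := pi_factor. Qed.
Let piS z : exists y, pi y = z.
Proof. by have [_ h _] := pi_factor; have [y _ <-] := h z Logic.I; exists y. Qed.

Lemma coset_cover_clopen (A : {fset G}) (C : set Z) : clopen C -> clopen (coset_cover A C).
Proof.
move=> cC; have -> : coset_cover A C = \bigcup_(f in [set` A]) (act Z f^-1%g @^-1` C).
  by apply/seteqP; split => z [f fA Cz]; exists f.
by apply: clopen_bigcup => f _; exact: act_clopen.
Qed.

Lemma low_clopen n : clopen (low n).
Proof.
elim: n => [|n IH] /=; first exact: clopen0.
by apply: clopenU => //; apply: coset_cover_clopen; exact: tw_clopen.
Qed.

Lemma lowS m n : (m <= n)%N -> low m `<=` low n.
Proof.
elim: n => [|n IH]; first by rewrite leqn0 => /eqP ->.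
rewrite leq_eqVlt => /predU1P[->//|]; rewrite ltnS => /IH h z /h ?; by left.
Qed.

Definition piece (p : nat * G) : set Z :=
  [set z | [/\ p.2 \in F p.1, E p.1 (act Z p.2^-1%g z) & ~ low p.1 z]].

Definition pieces : set Z := [set z | exists p, piece p z].

Lemma piece_low p z n : piece p z -> (p.1 < n)%N -> low n z.
Proof. by move=> [pF pE _] pn; apply: (lowS pn); right; exists p.2. Qed.

Lemma low_piece n z : low n z -> exists2 p, piece p z & (p.1 < n)%N.
Proof.
elim: n => [//|n IH] /=; have [/IH[p pz pn] _|nl] := pselect (low n z).
  by exists p => //; exact: ltnW.
by move=> [//|[f fF fE]]; exists (n, f).
Qed.

Lemma piece_uniq p q z : piece p z -> piece q z -> p = q.
Proof.
move=> pz qz; have [lt|gt|eq] := ltngtP p.1 q.1.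
- by case: (qz) => _ _ []; exact: piece_low pz lt.
- by case: (pz) => _ _ []; exact: piece_low qz gt.
case: p q eq pz qz => n f [m g] /= -> [/= fF fE _] [/= gF gE _].
congr pair; apply: (tw_sep fF gF fE gE); by rewrite !actKV.
Qed.

Lemma piece_clopen p : clopen (piece p).
Proof.
have [pF|pF] := boolP (p.2 \in F p.1); last first.
  have -> : piece p = set0 by apply/seteqP; split => z // [] h; rewrite h in pF.
  exact: clopen0.
have -> : piece p = (act Z p.2^-1%g @^-1` E p.1) `&` ~` low p.1.
  by apply/seteqP; split => z; [case|move=> [h1 h2]; split].
apply: clopenI; first by apply: act_clopen; exact: tw_clopen.
by apply: clopenC; [exact: setT|exact: low_clopen].
Qed.

Lemma piece_near p z : piece p z -> \forall z' \near z, piece p z'.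
Proof. by move=> pz; apply: open_nbhs_nbhs; split => //; case: (piece_clopen p). Qed.

Lemma pieces_open : open pieces.
Proof.
by rewrite openE => z [p pz]; apply: filterS (piece_near pz) => z' pz'; exists p.
Qed.

Definition code z : nat * G := xget (0%N, 1%g) [set p | piece p z].

Lemma codeE p z : piece p z -> code z = p.
Proof.
by move=> pz; apply: piece_uniq (pz); exact: (@xgetI _ (0%N, 1%g) [set p | piece p z] p pz).
Qed.

Lemma codeP z : pieces z -> piece (code z) z.
Proof. by move=> [p pz]; rewrite (codeE pz). Qed.

Lemma code_near z : pieces z -> \forall z' \near z, pieces z' /\ code z' = code z.
Proof.
by move=> /codeP/piece_near; apply: filterS => z' pz'; split; [exists (code z)|exact: codeE].
Qed.

Definition site : pmetricType R := (Z * Y * R^o)%type.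
Definition cval (t : G) (z : Z) : site := (z, act Y (code z).2 y0, lab (code z).1 (code z).2 t).
Definition pval (t : G) (y : Y) : site :=
  if `[< pieces (pi y) >] then cval t (pi y) else (pi y, y, 0).

Lemma site_mdist (u v : site) e : (mdist u v < e) =
  [&& mdist u.1.1 v.1.1 < e, mdist u.1.2 v.1.2 < e & `|v.2 - u.2| < e].
Proof. by rewrite {1}/mdist/= /prod_dist gt_max {1}/mdist/= /prod_dist gt_max -andbA. Qed.

(* The coordinate [(a, b)] of a configuration is the symbol at the site [a],
   with the label of the edge from [a] to [b * a]. *)
Definition config_set : set (G * G -> site) := [set x | forall (A B : {fset G}) e, 0 < e ->
  exists z, forall a, a \in A -> pieces (act Z a z) /\
    forall b, b \in B -> mdist (x (a, b)) (cval b (act Z a z)) < e].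

Lemma lab_ge0 n f t : 0 <= lab n f t.
Proof. by have [->//|[k ->]] := tw_labP w n f t; exact/ltW/half_gt0. Qed.

Lemma lab_le1 n f t : lab n f t <= 1.
Proof.
have [->//|[k ->]] := tw_labP w n f t.
by rewrite exprn_ile1 ?invr_ge0// invf_le1// ler1n.
Qed.

Lemma seq_bound (A : {fset G}) : exists N, forall a, a \in A -> exists2 j, (j < N)%N & s j = a.
Proof.
have [f fP] := choice sP.
exists (\max_(a <- A) f a).+1 => a aA; exists (f a) => //.
by rewrite ltnS; apply: leq_bigmax_seq.
Qed.

Lemma near_act_mdist (X : dynSystem R G) (x : X) (A : {fset G}) e : 0 < e ->
  \forall x' \near x, forall a, a \in A -> mdist (act X a x) (act X a x') < e.
Proof.
move=> e0; apply: near_fset => a _.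
have /mdist_continuousP := @act_continuous R G X a x; exact.
Qed.

Lemma near_pi (y : Y) (P : set Z) : nbhs (pi y) P -> \forall y' \near y, P (pi y').
Proof. exact: piC. Qed.

Lemma near_codes z (A : {fset G}) : \forall z' \near z, forall a, a \in A -> pieces (act Z a z) ->
  pieces (act Z a z') /\ code (act Z a z') = code (act Z a z).
Proof.
apply: near_fset => a _; have [pa|npa] := pselect (pieces (act Z a z)); last by apply: nearW => z'.
have h : \forall z' \near z, pieces (act Z a z') /\ code (act Z a z') = code (act Z a z).
  exact: (@act_continuous R G Z a z _ (code_near pa)).
by apply: filterS h => z' h _.
Qed.

(* The orbit points [h y0] supplied by [tw_dense] approximate the image of [y]. *)
Lemma pval_config y : config_set (fun k => pval k.2 (act Y k.1 y)).
Proof.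
move=> A B e e0.
have n1 := near_act_mdist y A e0.
have n2 := near_pi (near_act_mdist (pi y) A e0).
have n3 := near_pi (near_codes (pi y) A).
have [d d0 hd] := (mdist_nbhsP y _).1 (filterI n1 (filterI n2 n3)).
have [N1 hN1] := seq_bound A.
have [N2 hN2] := inv_succ_small d0; have [N3 hN3] := inv_succ_small e0.
pose n := maxn N1 (maxn N2 N3).
have [h [hy hS]] := tw_dense w n y.
have [c1 [c2 c3]] := hd (act Y h y0) (lt_trans hy (hN2 _ (leq_trans (leq_maxl _ _) (leq_maxr _ _)))).
exists (act Z h z0) => a aA.
have hz : act Z h z0 = pi (act Y h y0) by rewrite piE pi0.
have [pa|npa] := pselect (pieces (act Z a (pi y))).
  have [pa' ca] := c3 _ aA pa; rewrite hz; split => // b bB.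
  rewrite /pval /=; case: asboolP => [_|]; last by rewrite piE.
  rewrite piE site_mdist /cval /= ca mdistxx subrr normr0 e0 !andbT.
  exact: c2.
(* A site of [y] off the pieces is imitated by a site of stage [n], with symbol close to [act Y a y]
   and label at most [1/(n+1)]. *)
have [j jn sj] := hN1 _ aA.
have [|nl inF labs] := hS j (leq_trans jn (leq_maxl _ _)).
  by rewrite sj => /low_piece[p pz _]; apply: npa; exists p.
rewrite sj in nl inF labs.
have pz : piece (n, (a * h)%g) (act Z a (act Z h z0)).
  split => //=; last by rewrite -actM.
  by rewrite -(actM a) actVK; exact: tw_base.
split; first by exists (n, (a * h)%g).
move=> b bB; rewrite /pval /=; case: asboolP; first by rewrite piE.
move=> _; rewrite piE site_mdist /cval (codeE pz) /= subr0 ger0_norm ?lab_ge0//.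
rewrite (le_lt_trans (labs _)) ?andbT; last exact: hN3 (leq_trans (leq_maxr _ _) (leq_maxr _ _)).
by rewrite hz actM; apply/andP; split; [exact: c2|exact: c1].
Qed.

Lemma config_lab x k : config_set x -> 0 <= (x k).2 <= 1.
Proof.
case: k => a b xc.
have h e : 0 < e -> - e < (x (a, b)).2 < 1 + e.
  move=> e0; have [z hz] := xc [fset a]%fset [fset b]%fset e e0.
  have [_ /(_ b (fset11 b))] := hz a (fset11 a); rewrite site_mdist => /and3P[_ _].
  have := lab_ge0 (code (act Z a z)).1 (code (act Z a z)).2 b.
  have := lab_le1 (code (act Z a z)).1 (code (act Z a z)).2 b.
  rewrite /cval /=; move: (lab _ _ _) => l l1 l0; rewrite ltr_norml; lra.
apply/andP; split; apply/ler_addgt0Pl => e /h; lra.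
Qed.

Lemma config_closed : closed (config_set : set {ptws G * G -> site}).
Proof.
move=> x clx A B e e0.
have e20 : 0 < e / 2 by rewrite divr_gt0.
have nx : nbhs (x : {ptws G * G -> site}) [set x' : G * G -> site |
    forall k, k \in (A `*` B)%fset -> mdist ((x : G * G -> site) k) (x' k) < e / 2].
  apply: (@near_fset {ptws G * G -> site} (G * G)%type (A `*` B)%fset
    (fun k x' => mdist ((x : G * G -> site) k) ((x' : G * G -> site) k) < e / 2)) => k _.
  have /mdist_continuousP := @proj_continuous (G * G)%type (fun=> site : topologicalType) k x.
  exact.
have [x' [cx' hx']] := clx _ nx.
have [z hz] := cx' A B _ e20; exists z => a aA; have [pa ha] := hz a aA; split => // b bB.
have kAB : (a, b) \in (A `*` B)%fset by rewrite in_fsetM /= aA.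
have := ha b bB; have := hx' _ kAB.
have := metric_triangle ((x : G * G -> site) (a, b)) (x' (a, b)) (cval b (act Z a z)); lra.
Qed.

Definition pair_en (n : nat) : G * G :=
  let p := odflt (0%N, 0%N) (choice.unpickle n : option (nat * nat)) in (s p.1, s p.2).

Definition pair_idx : G * G -> nat :=
  let f := projT1 (choice sP) in fun k => choice.pickle (f k.1, f k.2).

Lemma pair_idxK : cancel pair_idx pair_en.
Proof.
by move=> [a b]; rewrite /pair_en /pair_idx choice.pickleK /=; case: (choice sP) => f /= fP; rewrite !fP.
Qed.

Definition config_space : fspace (G * G) site :=
  FSpace pair_idxK (pval_config point).

Definition config := fsub config_space.

Lemma config_compact : compact [set: config].
Proof.
apply: (@fsub_compact _ _ _ config_space (fun=> ([set: Z] `*` [set: Y]) `*` `[0, 1]%classic)).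
- move=> _; apply: compact_setX; last exact: segment_compact.
  by apply: compact_setX; exact: space_compact.
- move=> x cx k; split; first by split.
  by rewrite /= in_itv /=; exact: config_lab.
- exact: config_closed.
Qed.

Lemma config_act_subproof (g : G) (x : config) :
  config_set (fun k : G * G => sval x ((k.1 * g)%g, k.2)).
Proof.
move=> A B e e0; have [z hz] := svalP x [fset (a * g)%g | a in A]%fset B e e0.
exists (act Z g z) => a aA; rewrite -actM; apply: hz.
by apply/imfsetP; exists a.
Qed.

Definition config_act (g : G) (x : config) : config := exist _ _ (config_act_subproof g x).

Lemma config_eq (x x' : config) : sval x =1 sval x' -> x = x'.
Proof.
move: x x' => [x px] [x' px'] /= /funext xx'; subst x'.
by congr exist; exact: Prop_irrelevance.
Qed.

Lemma config_act1 x : config_act 1%g x = x.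
Proof. by apply: config_eq => -[a b] /=; rewrite mulg1. Qed.

Lemma config_actM g h x : config_act (g * h)%g x = config_act g (config_act h x).
Proof. by apply: config_eq => -[a b] /=; rewrite mulgA. Qed.

Lemma config_act_continuous g : continuous (config_act g).
Proof. by apply: fsub_continuous => k; exact: fsub_proj. Qed.

Definition configX : dynSystem R G :=
  DynSystem config_compact config_act1 config_actM config_act_continuous.

Local Notation X := configX.

Definition xval (x : X) : G * G -> site := sval x.
Definition tau (x : X) : Z := (xval x (1%g, 1%g)).1.1.
Definition ypart (x : X) (a : G) : Y := (xval x (a, 1%g)).1.2.
Definition rpart (x : X) (a b : G) : R := (xval x (a, b)).2.
Definition psi (y : Y) : X := exist _ _ (pval_config y).

Lemma xval_continuous k : continuous (xval^~ k).
Proof. exact: (@fsub_proj _ _ _ (config_space) k). Qed.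

Lemma fst_continuous (A B : topologicalType) : continuous (fst : A * B -> A).
Proof. by move=> x; exact: cvg_fst. Qed.

Lemma snd_continuous (A B : topologicalType) : continuous (snd : A * B -> B).
Proof. by move=> x; exact: cvg_snd. Qed.

Lemma tau_continuous : continuous tau.
Proof.
move=> x; apply: (@continuous_comp _ _ _ (xval^~ (1%g, 1%g)) (fun u : site => u.1.1)).
  exact: xval_continuous.
apply: (@continuous_comp _ _ _ fst fst); exact: fst_continuous.
Qed.

Lemma ypart_continuous a : continuous (ypart^~ a).
Proof.
move=> x; apply: (@continuous_comp _ _ _ (xval^~ (a, 1%g)) (fun u : site => u.1.2)).
  exact: xval_continuous.
by apply: (@continuous_comp _ _ _ fst snd); [exact: fst_continuous|exact: snd_continuous].
Qed.

Lemma rpart_continuous a b : continuous (fun x => rpart x a b : R^o).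
Proof.
move=> x; apply: (@continuous_comp _ _ _ (xval^~ (a, b)) (fun u : site => u.2)).
  exact: xval_continuous.
exact: snd_continuous.
Qed.

Lemma xval_approx (x : X) (A B : {fset G}) e (N : set Z) : 0 < e -> nbhs (tau x) N ->
  exists2 z, N z & forall a, a \in A -> pieces (act Z a z) /\
    forall b, b \in B -> mdist (xval x (a, b)) (cval b (act Z a z)) < e.
Proof.
move=> e0 /mdist_nbhsP[d d0 hd].
have m0 : 0 < Num.min e d by rewrite lt_min e0.
have [z hz] := svalP x (1%g |` A)%fset (1%g |` B)%fset _ m0.
exists z.
  apply: hd; have [_ /(_ 1%g)] := hz 1%g (fset1U1 _ _); move=> /(_ (fset1U1 _ _)).
  by rewrite site_mdist /cval /= act1 lt_min => /andP[/andP[_ h] _].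
move=> a aA; have [|pa h] := hz a; first by rewrite in_fset1U aA orbT.
split => // b bB; have := h b; rewrite in_fset1U bB orbT => /(_ isT).
by rewrite lt_min => /andP[].
Qed.

Lemma mdist_eq0P (V : metricType R) (x y : V) : (forall e, 0 < e -> mdist x y < e) -> x = y.
Proof.
move=> h; apply: mdist_positivity; apply/eqP; rewrite eq_le mdist_ge0 andbT.
by apply/ler_addgt0Pl => e e0; rewrite addr0; exact/ltW/h.
Qed.

(** Two redundancies of codes survive in the limit: the first component follows the orbit of
    [tau x], and the second ignores the direction [b] of the label. *)
Lemma xval_site (x : X) a b : xval x (a, b) = (act Z a (tau x), ypart x a, rpart x a b).
Proof.
have uE (u : Z * Y * R^o) : u = (u.1.1, u.1.2, u.2) by case: u => -[].
rewrite (uE (xval x (a, b))); congr (_, _, _).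
  apply: mdist_eq0P => e e0; have e20 : 0 < e / 2 by rewrite divr_gt0.
  have [z nz hz] := @xval_approx x [fset a]%fset [fset b]%fset _ _ e20
    (near_act_mdist (tau x) [fset a]%fset e20).
  have [_ /(_ b (fset11 b))] := hz a (fset11 a).
  rewrite site_mdist /= => /and3P[h1 _ _]; have := nz a (fset11 a); rewrite metric_sym => h2.
  have := metric_triangle (xval x (a, b)).1.1 (act Z a z) (act Z a (tau x)); lra.
apply: mdist_eq0P => e e0; have e20 : 0 < e / 2 by rewrite divr_gt0.
have [z _ hz] := @xval_approx x [fset a]%fset [fset b; 1%g]%fset _ _ e20 filterT.
have [_ h] := hz a (fset11 a).
have := h b; have := h 1%g; rewrite !inE !eqxx orbT /= => /(_ isT) + /(_ isT).
rewrite !site_mdist /= => /and3P[_ h1 _] /and3P[_ h2 _].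
apply: le_lt_trans (metric_triangle _ (act Y (code (act Z a z)).2 y0) _) _.
by rewrite (splitr e) ltrD// metric_sym.
Qed.

(** The code is locally constant on the open pieces, so approximating points show the symbol of
    [tau x] itself. Over an orbit contained in the pieces the fibre of [tau] is therefore a single
    point. *)
Lemma xval_piece (x : X) a b : pieces (act Z a (tau x)) -> xval x (a, b) = cval b (act Z a (tau x)).
Proof.
move=> pa; apply: mdist_eq0P => e e0.
have nc : \forall z \near tau x, code (act Z a z) = code (act Z a (tau x)).
  have h := @act_continuous R G Z a (tau x) _ (code_near pa).
  by apply: filterS (h : \forall z \near tau x, _) => z [].
have [z cz hz] := @xval_approx x [fset a]%fset [fset b]%fset _ _ e0 nc.
have [_ /(_ b (fset11 b))] := hz a (fset11 a).
by rewrite xval_site !site_mdist /cval /= cz mdistxx e0 => /and3P[_ -> ->].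
Qed.

Lemma X_eq (x x' : X) : xval x =1 xval x' -> x = x'.
Proof. exact: config_eq. Qed.

Lemma xval_act g (x : X) a b : xval (act X g x) (a, b) = xval x ((a * g)%g, b).
Proof. by []. Qed.

Lemma tau_act : equivariant tau.
Proof. by move=> g x; rewrite /tau xval_act mul1g xval_site. Qed.

Lemma xval_psi y a b : xval (psi y) (a, b) = pval b (act Y a y).
Proof. by []. Qed.

Lemma pval_fst t y : (pval t y).1.1 = pi y.
Proof. by rewrite /pval; case: ifP. Qed.

Lemma tau_psi y : tau (psi y) = pi y.
Proof. by rewrite /tau xval_psi pval_fst act1. Qed.

Lemma psi_act : equivariant psi.
Proof. by move=> g y; apply: X_eq => -[a b]; rewrite xval_act !xval_psi actM. Qed.

Lemma tau_factor : factor_map tau.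
Proof.
split; [exact: tau_continuous| |exact: tau_act].
by move=> z _; have [y <-] := piS z; exists (psi y) => //; exact: tau_psi.
Qed.

(** On a finite window the target is approximated by the code of a point whose sites all lie in
    pieces. That code is stable nearby, and minimality of [Z] brings the orbit of [tau x] there. *)
Lemma configX_minimal : minimal X.
Proof.
move=> x O [x' Ox'] oO.
have /mdist_nbhsP[e e0 he] : nbhs x' O by apply: open_nbhs_nbhs.
have e20 : 0 < e / 2 by rewrite divr_gt0.
have e40 : 0 < e / 4 by rewrite divr_gt0.
have [n hn] := @fsub_ball _ _ _ (config_space) _ e20.
pose A := firsts (fun k => (pair_en k).1) n.
pose B := firsts (fun k => (pair_en k).2) n.
have [z _ hz] := @xval_approx x' A B _ _ e40 filterT.
have N1 := near_act_mdist z A e40.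
have N2 : \forall z' \near z, forall a, a \in A ->
    pieces (act Z a z') /\ code (act Z a z') = code (act Z a z).
  apply: near_fset => a aA; have [pa _] := hz a aA.
  exact: (@act_continuous R G Z a z _ (code_near pa)).
have : nbhs z [set z' | (forall a, a \in A -> mdist (act Z a z) (act Z a z') < e / 4) /\
    forall a, a \in A -> pieces (act Z a z') /\ code (act Z a z') = code (act Z a z)].
  exact: filterI N1 N2.
rewrite nbhsE => -[Q1 [oQ Q1z] sQ1].
have [g Og] := @dense_orbit _ _ _ (tau x) Q1 mZ oQ (ex_intro _ z Q1z).
exists (act X g x); split; last by exists g.
have [d c] := sQ1 _ Og.
apply: he; apply: le_lt_trans (hn x' (act X g x) _) _; last lra.
move=> k kn; rewrite -/(xval x') -/(xval (act X g x)).
have := mem_firsts (fun k => (pair_en k).1) kn; rewrite -/A.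
have := mem_firsts (fun k => (pair_en k).2) kn; rewrite -/B.
change (fs_en _ k) with (pair_en k); move: (pair_en k) => [a b] /= bB aA.
have [pa /(_ b bB) h1] := hz a aA.
have [pa' ca] := c a aA; have da := d a aA.
suff : mdist (xval x' (a, b)) (xval (act X g x) (a, b)) < e / 2 by [].
rewrite xval_act (@xval_piece x); last by rewrite actM.
have h2 : mdist (cval b (act Z a z)) (cval b (act Z (a * g)%g (tau x))) < e / 4.
  by rewrite site_mdist /cval /= actM ca mdistxx subrr normr0 e40 !andbT.
have := metric_triangle (xval x' (a, b)) (cval b (act Z a z)) (cval b (act Z (a * g)%g (tau x))).
lra.
Qed.

Lemma pieces_dense : dense (pieces).
Proof.
move=> O [z Oz] oO; have [y yz] := piS z.
have [pz|npz] := pselect (pieces z); first by exists z.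
have [M sM] := sP 1%g.
have /(near_pi)/mdist_nbhsP[d d0 hd] : nbhs (pi y) O by rewrite yz; apply: open_nbhs_nbhs.
have [N hN] := inv_succ_small d0; pose n := maxn M.+1 N.
have [h [hy hS]] := tw_dense w n y.
exists (act Z h z0); split.
  by rewrite -pi0 -piE; apply: hd; apply: lt_trans hy (hN _ (leq_maxr _ _)).
have [|nl inF _] := hS M (leq_maxl _ _).
  by rewrite sM act1 yz => /low_piece[p pz _]; apply: npz; exists p.
rewrite sM mul1g in nl inF.
by exists (n, h); split => //=; rewrite actVK; exact: tw_base.
Qed.

Lemma exists_generic : exists z, forall g, pieces (act Z g z).
Proof.
have [|z hz] := @compact_baire _ _ (fun n => act Z (s n) @^-1` pieces) (@space_compact _ _ Z) tdZ.
  move=> n; split; first exact: act_open pieces_open.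
  move=> O [x Ox] oO.
  have oQ : open (act Z (s n)^-1%g @^-1` O) by exact: act_open.
  have [|z [Oz pz]] := pieces_dense _ oQ; first by exists (act Z (s n) x); rewrite /= actVK.
  by exists (act Z (s n)^-1%g z); split => //; rewrite /= actKV.
by exists z => g; have [n <-] := sP g; exact: hz.
Qed.

Lemma tau_almost_one_to_one : almost_one_to_one tau.
Proof.
have [z hz] := exists_generic.
move=> O O0 oO; have [g Og] := dense_orbit z mZ oO O0.
exists (act Z g z); split => //=; have [y yz] := piS (act Z g z).
exists (psi y); apply/seteqP; split => [x /= xz|_ -> /=]; last by rewrite tau_psi.
apply: X_eq => -[a b]; rewrite !xval_piece ?tau_psi ?xz ?yz//; rewrite -actM; exact: hz.
Qed.

Lemma D_gt0 m : (0 < #|` D m|)%N.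
Proof. by rewrite cardfs_gt0; apply/fset0Pn; have [g gD _] := tw_return w m z0; exists g. Qed.

Lemma cover_small (nu : invMeasure Z) m n : (m <= n)%N ->
  (nu (coset_cover (F n) (E n)) <= (#|` D m|%:R^-1 / (2 ^ n)%:R)%:E)%E.
Proof.
move=> mn; have [A sA hA] := tw_small w mn.
have oE : open (E n) by have [] := tw_clopen w n.
have := inv_separates nu (borel_open oE) sA.
have fE : nu (E n) \is a fin_num by apply: fin_num_measure; exact: borel_open.
have nuE : nu (E n) = (fine (nu (E n)))%:E by rewrite fineK.
have e0 : 0 <= fine (nu (E n)) by exact: fine_ge0.
rewrite nuE -EFinM lee_fin; move: (fine _) nuE e0 => e nuE e0 Ae.
have -> : coset_cover (F n) (E n) = hits [fset f^-1 | f in F n]%g%fset (E n).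
  apply/seteqP; split => z [f fF Ef]; last first.
    by case/imfsetP: fF Ef => g /= gF -> Eg; exists g.
  by exists f^-1%g => //; apply/imfsetP; exists f.
apply: le_trans (@hits_measure _ _ Z nu _ (E n) e oE _) _; first by rewrite nuE.
rewrite lee_fin card_imfset; last exact: invg_inj.
have D0 := D_gt0 m.
rewrite -invfM -natrM -[leRHS]div1r ler_pdivlMr; last by rewrite ltr0n muln_gt0 D0 expn_gt0.
apply: le_trans Ae; rewrite -mulrA mulrC -mulrA -natrM mulrC ler_wpM2r// ler_nat.
by move: hA; rewrite (mulnC (#|` D m| * _)%N) mulnA.
Qed.

Definition high m : set Z := [set z | pieces z /\ ~ low m z].

Lemma high_open m : open (high m).
Proof.
have -> : high m = pieces `&` ~` low m by [].
by apply: openI; [exact: pieces_open|apply: closed_openC; have [] := low_clopen m].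
Qed.

Lemma high_small (nu : invMeasure Z) m : (nu (high m) <= (#|` D m|%:R^-1 * (2 * 2^-1 ^+ m))%:E)%E.
Proof.
have mC k : measurable (coset_cover (F (m + k)%N) (E (m + k)%N) : set (borel Z)).
  apply: borel_open; have [] // : clopen (coset_cover (F (m + k)%N) (E (m + k)%N)).
  by apply: coset_cover_clopen; exact: tw_clopen.
have := @measure_sigma_subadditive _ _ _ nu (high m) _ mC (borel_open (high_open m)) _. move=> h; apply: le_trans (h _) _.
  move=> z [[p pz] nl]; case: (pz) => pF pE _; exists (p.1 - m)%N => //.
  rewrite subnKC; first by exists p.2.
  by rewrite leqNgt; apply/negP => /(piece_low pz).
apply: le_trans _ (@epsilon_trick0 R _ xpredT _); last first.
  by rewrite mulr_ge0 ?invr_ge0// mulr_ge0// exprn_ge0// invr_ge0.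
apply: lee_nneseries => // k _; apply: le_trans (cover_small nu (leq_addr k m)) _.
rewrite lee_fin expnS expnD !natrM natrX exprVn.
move: (_^-1) => d; rewrite le_eqVlt; apply/orP; left; apply/eqP; field.
by rewrite natrX !expf_neq0// pnatr_eq0.
Qed.

Lemma high_small1 (nu : invMeasure Z) m : (nu (high m) <= (2 * 2^-1 ^+ m)%:E)%E.
Proof.
apply: le_trans (high_small nu m) _; rewrite lee_fin ler_piMl//.
by rewrite invf_le1 ?ler1n ?ltr0n D_gt0.
Qed.

(** [K] is the complement of the pieces; here it is avoided during the finite time set [D m] only,
    which keeps the condition open. *)
Definition noK m : set Z := [set z | forall g, g \in D m -> pieces (act Z g z)].

Lemma noK_open m : open (noK m).
Proof.
rewrite openE => z nz; apply: near_fset => g gD.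
have /(@act_open _ _ Z g) := pieces_open; rewrite openE; apply; exact: nz.
Qed.

(** By [tw_return] some translate by [D m] is then in [high m]. The number of translates cancels
    against the factor that [tw_small] put into the measure of [high m]. *)
Lemma noK_small (nu : invMeasure Z) m : (nu (noK m) <= (2 * 2^-1 ^+ m)%:E)%E.
Proof.
have sub : noK m `<=` hits (D m) (high m).
  move=> z nz; have [g gD nl] := tw_return w m z; exists g => //; split => //; exact: nz.
apply: le_trans (inv_le nu _ _ sub) _.
- by apply: borel_open; exact: noK_open.
- by apply: borel_open; apply: hits_open; exact: high_open.
apply: le_trans (hits_measure _ (high_open m) (high_small nu m)) _.
by rewrite lee_fin mulVKf// pnatr_eq0 -lt0n D_gt0.
Qed.

Definition nowhereK : set Z := [set z | forall g, pieces (act Z g z)].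

Lemma nowhereK_borel : measurable (nowhereK : set (borel Z)).
Proof.
rewrite (_ : nowhereK = \bigcap_n (act Z (s n) @^-1` pieces)).
  by apply: bigcapT_measurable => n; apply: borel_open; apply: act_open; exact: pieces_open.
by apply/seteqP; split => z hz => [n _|g]; [exact: hz|have [n <-] := sP g; exact: hz].
Qed.

(** These orbits, which make [tau] almost one-to-one, are those over which [theta] cannot recover a
    point of [Y]; they are dense but null. *)
Lemma nowhereK_null (nu : invMeasure Z) : nu nowhereK = 0%E.
Proof.
have mK := nowhereK_borel; apply/eqP; rewrite eq_le measure_ge0 andbT.
have fK : nu nowhereK \is a fin_num by exact: fin_num_measure.
rewrite -(fineK fK) lee_fin; apply/ler_addgt0Pr => e e0; rewrite add0r.
have [m hm] := half_small e0.
rewrite -lee_fin fineK//; apply: le_trans _ (le_trans (noK_small nu m) _); last by rewrite lee_fin ltW.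
apply: inv_le => //; first by apply: borel_open; exact: noK_open.
by move=> z hz g _; exact: hz.
Qed.

Lemma tau_actE g (x : X) : tau (act X g x) = act Z g (tau x).
Proof. exact: tau_act. Qed.

Lemma ypart_act g (x : X) a : ypart (act X g x) a = ypart x (a * g)%g.
Proof. by []. Qed.

Lemma rpart_act g (x : X) a b : rpart (act X g x) a b = rpart x (a * g)%g b.
Proof. by []. Qed.

Lemma code_high n z : ~ low n z -> pieces z -> (n <= (code z).1)%N.
Proof. by move=> nl /codeP pz; rewrite leqNgt; apply/negP => /(piece_low pz). Qed.

(** As [low n] is clopen, a site off the pieces is not in [low n] for nearby points either. Its
    symbols thus come from arbitrarily late stages. *)
Lemma K_approx (x : X) (A B : {fset G}) (e : R) n : 0 < e -> exists z,
  (forall a, a \in A -> mdist (act Z a (tau x)) (act Z a z) < e) /\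
  forall a, a \in A -> [/\ pieces (act Z a z),
    forall b, b \in B -> mdist (xval x (a, b)) (cval b (act Z a z)) < e &
    ~ pieces (act Z a (tau x)) -> (n <= (code (act Z a z)).1)%N].
Proof.
move=> e0.
have N1 : \forall z \near tau x, forall a, a \in A -> (low n (act Z a z) <-> low n (act Z a (tau x))).
  by apply: clopen_act_near; exact: low_clopen.
have N2 := near_act_mdist (tau x) A e0.
have N12 : nbhs (tau x) [set z | (forall a, a \in A -> (low n (act Z a z) <-> low n (act Z a (tau x)))) /\
    forall a, a \in A -> mdist (act Z a (tau x)) (act Z a z) < e] by exact: filterI N1 N2.
have [z [nz1 nz2] hz] := @xval_approx x A B e _ e0 N12.
exists z; split => // a aA; have [pa ha] := hz a aA; split => // npa.
apply: code_high => //; rewrite nz1// => /low_piece[p pz _]; apply: npa; by exists p.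
Qed.

(** The symbol is a limit of points [f y0] for sites in [f E m] with [m] large; these sets have
    small diameter, so [f z0] tends to the site. *)
Lemma pi_ypart (x : X) g : ~ pieces (act Z g (tau x)) -> pi (ypart x g) = act Z g (tau x).
Proof.
move=> ng; apply: mdist_eq0P => e e0.
have e30 : 0 < e / 3 by rewrite divr_gt0.
have /mdist_nbhsP[d d0 hd] := (mdist_continuousP _ _).1 (@piC (ypart x g)) _ e30.
have m0 : 0 < Num.min d (e / 3) by rewrite lt_min d0.
have [n hn] := inv_succ_small e30.
have [z [z1 /(_ g (fset11 g))[pz /(_ 1%g (fset11 1%g)) hx /(_ ng) cn]]] :=
  K_approx x [fset g]%fset [fset 1%g]%fset n m0.
have /(_ g (fset11 g)) := z1; rewrite lt_min => /andP[_ h1].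
move: hx; rewrite xval_site site_mdist /cval /= !lt_min => /and3P[_ /andP[/hd h2 _] _].
have := codeP pz; move: (code (act Z g z)) cn h2 => [m f] /= mn h2 [/= fF fE _].
have := tw_diam fF fE; rewrite actKV => /lt_trans/(_ (hn m mn)) h3.
rewrite piE pi0 in h2.
have t1 := metric_triangle (pi (ypart x g)) (act Z f z0) (act Z g (tau x)).
have t2 := metric_triangle (act Z f z0) (act Z g z) (act Z g (tau x)).
rewrite metric_sym in h1; move: h1 h2 h3 t1 t2.
move: (mdist _ _) (mdist _ _) (mdist _ _) (mdist _ _) (mdist _ _) => a b c d' f'; lra.
Qed.

(** Stated at the site 1 only: the other sites are reached by translating [x], which an invariant
    measure does not notice. *)
Definition incoherent (t : G) : set X := [set x | [/\ ~ pieces (tau x),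
  ~ pieces (act Z t (tau x)) & ypart x t <> act Y t (ypart x 1%g)]].

Definition labelled (t : G) : set X := [set x | ~ pieces (tau x) /\ rpart x 1%g t <> 0].

Lemma neq_open (T : topologicalType) (V : metricType R) (f g : T -> V) :
  continuous f -> continuous g -> open [set t | f t <> g t].
Proof.
move=> cf cg; rewrite openE => t /= ne.
have d0 := mdist_gt0 ne.
have d20 : 0 < mdist (f t) (g t) / 2 by rewrite divr_gt0.
have h1 := (mdist_continuousP _ _).1 (cf t) _ d20; have h2 := (mdist_continuousP _ _).1 (cg t) _ d20.
apply: filterS2 h1 h2 => t' /= h1 h2 e; rewrite -e metric_sym in h2.
have := metric_triangle (f t) (f t') (g t); lra.
Qed.

Lemma K_closed t : closed [set x : X | ~ pieces (act Z t (tau x))].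
Proof.
apply: (@open_closedC _ [set x : X | pieces (act Z t (tau x))]).
have -> : [set x : X | pieces (act Z t (tau x))] = act X t @^-1` (tau @^-1` pieces).
  by apply/seteqP; split => x /=; rewrite tau_actE.
apply: act_open; apply: open_comp; last exact: pieces_open.
by move=> x _; exact: tau_continuous.
Qed.

Lemma incoherent_borel t : measurable (incoherent t : set (borel X)).
Proof.
have -> : incoherent t = [set x : X | ~ pieces (act Z 1%g (tau x))] `&`
    ([set x : X | ~ pieces (act Z t (tau x))] `&` [set x | ypart x t <> act Y t (ypart x 1%g)]).
  by apply/seteqP; split => x; [case => a b c|case => a [b c]]; rewrite /= act1 in a *.
apply: measurableI; first by apply: borel_closed; exact: K_closed.
apply: measurableI; first by apply: borel_closed; exact: K_closed.
apply: borel_open; apply: neq_open; first exact: ypart_continuous.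
by move=> x; apply: (@continuous_comp _ _ _ (ypart^~ 1%g)); [exact: ypart_continuous|exact: act_continuous].
Qed.

Lemma labelled_borel t : measurable (labelled t : set (borel X)).
Proof.
have -> : labelled t = [set x : X | ~ pieces (act Z 1%g (tau x))] `&` [set x | rpart x 1%g t <> 0].
  by apply/seteqP; split => x [a b]; rewrite /= act1 in a *.
apply: measurableI; first by apply: borel_closed; exact: K_closed.
apply: borel_open; apply: (@neq_open X R^o (fun x => rpart x 1%g t) (fun=> 0)).
  exact: rpart_continuous.
exact: cst_continuous.
Qed.

(** The default 0 is also the value on orbits contained in the pieces, which is why [theta_borel]
    treats the index 0 apart. *)
Definition firstK (z : Z) : nat :=
  xget 0%N [set n | ~ pieces (act Z (s n) z) /\ forall k, (k < n)%N -> pieces (act Z (s k) z)].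

Lemma firstK_uniq z n : ~ pieces (act Z (s n) z) -> (forall k, (k < n)%N -> pieces (act Z (s k) z)) ->
  firstK z = n.
Proof.
move=> h1 h2.
have [/= k1 k2] : [set n | ~ pieces (act Z (s n) z) /\ forall k, (k < n)%N -> pieces (act Z (s k) z)] (firstK z).
  by apply: (@xgetI _ 0%N _ n).
by have [/h2|/k2|] := ltngtP (firstK z) n.
Qed.

Lemma firstKP z g : ~ pieces (act Z g z) -> ~ pieces (act Z (s (firstK z)) z) /\
  forall k, (k < firstK z)%N -> pieces (act Z (s k) z).
Proof.
move=> ng; have [n0 sn0] := sP g.
have ex : exists n, `[< ~ pieces (act Z (s n) z) >] by exists n0; apply/asboolP; rewrite sn0.
case: (ex_minnP ex) => n /asboolP hn min.
have h k : (k < n)%N -> pieces (act Z (s k) z).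
  by move=> kn; apply: contrapT => /asboolP/min; rewrite leqNgt kn.
by rewrite (firstK_uniq hn h).
Qed.

(** The inverse of [psi] almost everywhere: a symbol off the pieces is a point of [Y], carried back
    to the site 1. Choosing the first such site makes it Borel. *)
Definition theta (x : X) : Y :=
  let g := s (firstK (tau x)) in act Y g^-1%g (ypart x g).

Lemma piece_act_borel g (B : set Z) : open B -> measurable ([set x : X | B (act Z g (tau x))] : set (borel X)).
Proof.
move=> oB; apply: borel_open; apply: (@open_comp _ _ tau (act Z g @^-1` B)) => [x _|].
  exact: tau_continuous.
exact: act_open.
Qed.

Lemma theta_borel : borel_map theta.
Proof.
apply: borel_mapP => A oA.
pose P n : set (borel X) := [set x | firstK (tau x) = n].
pose T n x := act Y (s n)^-1%g (ypart x (s n)).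
have mS n : measurable ([set x : X | pieces (act Z (s n) (tau x))] : set (borel X)).
  by apply: piece_act_borel; exact: pieces_open.
have mP n : measurable (P n).
  have -> : P n = ((~` [set x : X | pieces (act Z (s n) (tau x))]) `&`
      \bigcap_(k in [set k | (k < n)%N]) [set x : X | pieces (act Z (s k) (tau x))]) `|`
      (if n == 0%N then \bigcap_k [set x : X | pieces (act Z (s k) (tau x))] else set0).
    apply/seteqP; split => x; rewrite /P /=.
      have [h|/existsNP[g ng] <-] := pselect (forall g, pieces (act Z g (tau x))).
        rewrite /firstK; case: xgetP => [m -> [hm _]|_ <-]; first by case: hm; exact: h.
        by right => k _; exact: h.
      by left; have [? ?] := firstKP ng; split.
    case=> [[h1 h2]|]; first exact: firstK_uniq.
    case: eqP => [->|//] h; rewrite /firstK; case: xgetP => // m _ [hm _].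
    by case: hm; exact: h.
  apply: measurableU.
    apply: measurableI; first exact: measurableC.
    by apply: fin_bigcap_measurable => //; exact: finite_II.
  by case: (n == 0)%N => //; apply: bigcapT_measurable.
have -> : theta @^-1` A = \bigcup_n (P n `&` (T n @^-1` A)).
  by apply/seteqP; split => [x Ax|x [n _ [<- Ax]]//]; exists (firstK (tau x)).
apply: bigcupT_measurable => n; apply: measurableI => //; apply: borel_open.
apply: open_comp oA => x _; apply: (@continuous_comp _ _ _ (ypart^~ (s n))).
  exact: ypart_continuous.
exact: act_continuous.
Qed.

Lemma psi_borel : borel_map psi.
Proof.
apply: borel_map_balls; first exact: space_compact.
move=> x r r0.
have m1 g b (u : site) (c : R) : measurable ([set y | mdist u (pval b (act Y g y)) <= c] : set (borel Y)).
  pose C := [set v : site | mdist u v <= c].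
  have clC : closed C.
    have -> : C = ~` [set v | c < mdist u v] by apply/seteqP; split => v; rewrite /C /= leNgt => /negP.
    apply: open_closedC; rewrite openE => v /= cv; apply/mdist_nbhsP.
    exists (mdist u v - c); first by rewrite subr_gt0.
    move=> v' /=; have := metric_triangle u v' v; rewrite (metric_sym v'); lra.
  pose en n := (odflt (0%N, 0%N) (choice.unpickle n : option (nat * nat))).
  pose code_of n := ((en n).1, s (en n).2).
  have -> : [set y | mdist u (pval b (act Y g y)) <= c] = act Y g @^-1` (
      ((~` (pi @^-1` pieces)) `&` ((fun y => (pi y, y, 0 : R^o)) @^-1` C)) `|`
      \bigcup_n ((pi @^-1` piece (code_of n)) `&`
        ((fun y => (pi y, act Y (code_of n).2 y0, lab (code_of n).1 (code_of n).2 b : R^o)) @^-1` C))).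
    apply/seteqP; split => y /=; rewrite /pval; case: asboolP => py.
    - move=> h; right; have pc := codeP py; have [j sj] := sP (code (pi (act Y g y))).2.
      exists (choice.pickle ((code (pi (act Y g y))).1, j)) => //.
      by rewrite /code_of /en /= choice.pickleK /= sj -surjective_pairing.
    - by left.
    - by case=> [[]//|[n _ [pn Cn]]]; rewrite /cval (codeE pn).
    - by case=> [[]//|[n _ [pn Cn]]]; case: py; exists (code_of n).
  apply: borel_preimage; first exact: act_borel.
  have cpi (v : Y) (l : R^o) (y : Y) : {for y, continuous (fun y => (pi y, v, l) : site)}.
    apply: (@cvg_pair _ _ _ _ (nbhs (pi y, v)) (nbhs l)); last exact: cvg_cst.
    by apply: (@cvg_pair _ _ _ _ (nbhs (pi y)) (nbhs v)); [exact: piC|exact: cvg_cst].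
  apply: measurableU.
    apply: measurableI; apply: borel_closed.
      apply: open_closedC; apply: open_comp; [by move=> ? _; exact: piC|exact: pieces_open].
    apply: closed_comp clC => y _.
    apply: (@cvg_pair _ _ _ _ (nbhs (pi y, y)) (nbhs (0 : R^o))); last exact: cvg_cst.
    by apply: (@cvg_pair _ _ _ _ (nbhs (pi y)) (nbhs y)); [exact: piC|exact: cvg_id].
  apply: bigcupT_measurable => n; apply: measurableI.
    by apply: borel_open; apply: open_comp; [by move=> ? _; exact: piC|have [] := piece_clopen (code_of n)].
  by apply: borel_closed; apply: closed_comp clC => y _; exact: cpi.
pose S := config_space.
(* The distance is a supremum, so a strict bound is a countable union over margins [1/(n+1)] of
   large bounds on all coordinates. The second clause keeps these bounds nonnegative, as [fdist_le]
   requires. *)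
have -> : [set y | mdist x (psi y) < r] = \bigcup_n \bigcap_k
    [set y | Num.min (2^-1 ^+ (fs_idx S (fs_en S k))) (mdist (sval x (fs_en S k)) (sval (psi y) (fs_en S k))) <= r - n.+1%:R^-1 /\ n.+1%:R^-1 <= r].
  apply/seteqP; split => y /=.
    rewrite fsub_mdist => xy.
    have d0 : 0 < Num.min (r - fdist (fs_idx S) (sval x) (sval (psi y))) r by rewrite lt_min subr_gt0 xy.
    have [n /(_ n (leqnn n))] := inv_succ_small d0; rewrite lt_min => /andP[hn1 hn2].
    exists n => // k _; split; last exact: ltW.
    by apply: le_trans (fdist_ge (fs_idx S) (sval x) (sval (psi y)) (fs_en S k)) _; rewrite lerBrDr -lerBrDl ltW.
  move=> [n _ h]; have [_ nr] := h 0%N Logic.I; rewrite fsub_mdist.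
  have : (n.+1%:R^-1 : R) > 0 by rewrite invr_gt0.
  have : fdist (fs_idx S) (sval x) (sval (psi y)) <= r - n.+1%:R^-1.
    apply: fdist_le; first by rewrite subr_ge0.
    move=> i; pose i' := fs_en S (fs_idx S i).
    have h1 : Num.min (2^-1 ^+ fs_idx S i') (mdist (sval x i') (sval (psi y) i')) <= r - n.+1%:R^-1.
      exact: (h (fs_idx S i) Logic.I).1.
    by rewrite /i' fs_idxK in h1.
  by move=> h1 c0; apply: le_lt_trans h1 _; rewrite ltrBlDr ltrDl.
apply: bigcupT_measurable => n; apply: bigcapT_measurable => k.
have [nr|nr] := boolP ((n.+1%:R^-1 : R) <= r); last first.
  rewrite (_ : [set _ | _] = set0); first exact: measurable0.
  by apply/seteqP; split => y // -[].
have [h|h] := boolP ((2^-1 : R) ^+ (fs_idx S (fs_en S k)) <= r - n.+1%:R^-1).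
  rewrite (_ : [set _ | _] = setT); first exact: measurableT.
  by apply/seteqP; split => y // _; split => //; rewrite ge_min h.
case: (fs_en S k) h => a b h; rewrite (_ : [set _ | _] = [set y | mdist (sval x (a, b)) (pval b (act Y a y)) <= r - n.+1%:R^-1]); first exact: m1.
by apply/seteqP; split => y /=; rewrite ge_min (negbTE h) /=; [case|].
Qed.

(* An almost sure point of [X] carries a single point of [Y] along its sites
   outside the pieces, with vanishing labels. *)
Definition rigid := forall (lambda : invMeasure X) t,
  lambda (incoherent t) = 0%E /\ lambda (labelled t) = 0%E.

Hypothesis X_rigid : rigid.

Definition bad : set (borel X) := (\bigcup_n \bigcup_m act X (s n) @^-1` (incoherent (s m) `|` labelled (s m)))
  `|` tau @^-1` nowhereK.

Lemma tau_borel : borel_map tau.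
Proof. by apply: continuous_borel; exact: tau_continuous. Qed.

Lemma bad_borel : measurable bad.
Proof.
apply: measurableU.
  apply: bigcupT_measurable => n; apply: bigcupT_measurable => m.
  apply: borel_preimage; first exact: act_borel.
  by apply: measurableU; [exact: incoherent_borel|exact: labelled_borel].
by apply: borel_preimage tau_borel _; exact: nowhereK_borel.
Qed.

Lemma bad_null (lambda : invMeasure X) : lambda bad = 0%E.
Proof.
apply: (measure_negligible bad_borel); apply: negligibleU.
  apply: negligible_bigcup => n; apply: negligible_bigcup => m.
  have mB : measurable (incoherent (s m) `|` labelled (s m) : set (borel X)).
    by apply: measurableU; [exact: incoherent_borel|exact: labelled_borel].
  apply/negligibleP.
    by apply: borel_preimage mB; exact: act_borel.
  rewrite [LHS](inv_measure_act lambda (s n) mB); apply: (measure_negligible mB); apply: negligibleU.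
    apply/negligibleP; first exact: incoherent_borel.
    by have [] := X_rigid lambda (s m).
  apply/negligibleP; first exact: labelled_borel.
  by have [] := X_rigid lambda (s m).
have mN : measurable (nowhereK : set (borel Z)) by exact: nowhereK_borel.
apply/negligibleP; first exact: borel_preimage tau_borel mN.
apply/eqP; rewrite eq_le measure_ge0 andbT.
apply: (@inv_pull _ _ X Z tau (nowhereK) 0%E) => //.
- exact: tau_continuous.
- exact: tau_act.
- by move=> nu; rewrite nowhereK_null.
Qed.

Lemma good_coherent x a b : ~ bad x -> ~ pieces (act Z a (tau x)) -> ~ pieces (act Z b (tau x)) ->
  ypart x b = act Y (b * a^-1)%g (ypart x a).
Proof.
move=> nb na ngb; apply: contrapT => ne; apply: nb; left.
have [n sn] := sP a; have [m sm] := sP (b * a^-1)%g.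
exists n => //; exists m => //; left; rewrite /= sn sm; split.
- by rewrite tau_actE.
- by rewrite tau_actE -actM mulgVK.
- by rewrite !ypart_act mulgVK mul1g.
Qed.

Lemma good_unlabelled x a b : ~ bad x -> ~ pieces (act Z a (tau x)) -> rpart x a b = 0.
Proof.
move=> nb na; apply: contrapT => ne; apply: nb; left.
have [n sn] := sP a; have [m sm] := sP b.
exists n => //; exists m => //; right; rewrite /= sn sm; split; first by rewrite tau_actE.
by rewrite rpart_act mul1g.
Qed.

Lemma good_someK x : ~ bad x -> exists g, ~ pieces (act Z g (tau x)).
Proof.
move=> nb; apply: contrapT => h; apply: nb; right => g /=.
by apply: contrapT => ng; apply: h; exists g.
Qed.

(** On the pieces the symbols depend on [tau x] alone; off them coherence propagates one symbol to
    every site, and the labels vanish. *)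
Lemma psi_theta x : ~ bad x -> psi (theta x) = x.
Proof.
move=> nb; have [g0 ng0] := good_someK nb; have [nK _] := firstKP ng0.
set g := s (firstK (tau x)) in nK.
have pit a : pi (act Y a (theta x)) = act Z a (tau x).
  by rewrite /theta -/g piE piE pi_ypart// -!actM mulgVK.
apply: X_eq => -[a b]; rewrite xval_psi.
have [pa|npa] := pselect (pieces (act Z a (tau x))).
  by rewrite xval_piece// /pval asboolT pit.
rewrite /pval asboolF pit// xval_site (good_unlabelled b nb npa).
by rewrite (good_coherent nb nK npa) actM.
Qed.

Lemma theta_psi y : ~ nowhereK (pi y) -> theta (psi y) = y.
Proof.
move=> /existsNP[g ng]; have := firstKP ng; rewrite /theta tau_psi => -[nK _].
by rewrite /ypart xval_psi /pval asboolF piE//= actVK.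
Qed.

Lemma theta_act g x : ~ bad x -> theta (act X g x) = act Y g (theta x).
Proof.
move=> nb; have e : act X g x = psi (act Y g (theta x)) by rewrite psi_act psi_theta.
rewrite e theta_psi//; rewrite -tau_psi -e tau_actE => h; have [a na] := good_someK nb.
by apply: na; have := h (a * g^-1)%g; rewrite -actM mulgVK.
Qed.

Lemma psi_injective : {in pi @^-1` (~` nowhereK) &, injective psi}.
Proof.
by move=> y y'; rewrite !inE /= => ny ny' e; rewrite -(theta_psi ny) e theta_psi.
Qed.

Lemma stars_exist : exists (F : invMeasure Y -> invMeasure X) (H : invMeasure X -> invMeasure Y),
  (forall mu (A : set (borel X)), measurable A -> F mu A = mu (psi @^-1` A)) /\
  (forall mu (A : set (borel Y)), measurable A -> H mu A = mu (theta @^-1` A)).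
Proof.
have hF (mu : invMeasure Y) : exists nu : invMeasure X, forall A : set (borel X), measurable A -> nu A = mu (psi @^-1` A).
  apply: (@inv_push _ _ Y X psi mu set0 (@psi_borel) measurable0 (measure0 _)).
  by move=> g y _; exact: psi_act.
have hH (mu : invMeasure X) : exists nu : invMeasure Y, forall A : set (borel Y), measurable A -> nu A = mu (theta @^-1` A).
  apply: (@inv_push _ _ X Y theta mu bad (@theta_borel) bad_borel (bad_null mu)).
  by move=> g y; exact: theta_act.
have [F0 hF0] := choice hF; have [H0 hH0] := choice hH; by exists F0, H0.
Qed.

(** * The bijection between invariant measures *)

Section stars.
Variables (Fs : invMeasure Y -> invMeasure X) (Hs : invMeasure X -> invMeasure Y).
Hypotheses (FsE : forall mu (A : set (borel X)), measurable A -> Fs mu A = mu (psi @^-1` A))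
  (HsE : forall mu (A : set (borel Y)), measurable A -> Hs mu A = mu (theta @^-1` A)).
Let mpsi := @psi_borel.
Let mtheta := @theta_borel.

Lemma FsK : cancel Fs Hs.
Proof.
move=> mu; apply: inv_ext => A mA.
have mA' := borel_preimage mtheta mA.
rewrite HsE// FsE//.
have mN : measurable (pi @^-1` nowhereK : set (borel Y)).
  by apply: borel_preimage (continuous_borel piC) _; exact: nowhereK_borel.
apply: (@inv_eq_null _ _ Y mu (pi @^-1` nowhereK)) => //.
- apply/eqP; rewrite eq_le measure_ge0 andbT.
  apply: (@inv_pull _ _ Y Z pi (nowhereK) 0%E) => //.
  + exact: nowhereK_borel.
  + by move=> nu; rewrite nowhereK_null.
- exact: borel_preimage mA'.
- by move=> y ny; rewrite /= theta_psi.
Qed.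

Lemma HsK : cancel Hs Fs.
Proof.
move=> mu; apply: inv_ext => A mA.
have mA' := borel_preimage mpsi mA.
rewrite FsE// HsE//; apply: (@inv_eq_null _ _ X mu bad) => //.
- exact: bad_borel.
- exact: bad_null.
- exact: borel_preimage mA'.
- by move=> x nx; rewrite /= psi_theta.
Qed.

Lemma Fs_affine : affine Fs.
Proof.
move=> t mu nu rho t01 h A mA; rewrite !FsE//; apply: h.
exact: borel_preimage mA.
Qed.

Lemma high_hits_small (A : {fset G}) (e : R) : 0 < e -> exists m, forall nu : invMeasure Z,
  (nu (hits A (high m)) <= e%:E)%E.
Proof.
move=> e0; have [|m hm] := @half_small R (e / #|` A|.+1%:R); first by rewrite divr_gt0.
exists m => nu; apply: le_trans (hits_measure A (high_open m) (high_small1 nu m)) _.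
rewrite lee_fin; move: hm; rewrite ltr_pdivlMr// => hm; apply: le_trans (ltW hm).
by rewrite mulrC ler_wpM2l ?ler_nat.
Qed.

(** Away from [high m], lying in a piece means lying in [low m], which is clopen. *)
Lemma stable_site (A : {fset G}) m z : \forall z' \near z, ~ hits A (high m) z' ->
  ~ hits A (high m) z -> forall a, a \in A -> (pieces (act Z a z') <-> pieces (act Z a z)).
Proof.
have : \forall z' \near z, forall a, a \in A -> (low m (act Z a z') <-> low m (act Z a z)).
  by apply: clopen_act_near; exact: low_clopen.
apply: filterS => z' hz' nh' nh a aA.
have eq u : ~ hits A (high m) u -> pieces (act Z a u) <-> low m (act Z a u).
  move=> nu; split => [pu|/low_piece[p pz _]]; last by exists p.
  by apply: contrapT => nl; apply: nu; exists a.
by rewrite (propext (eq _ nh')) (propext (eq _ nh)); exact: hz'.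
Qed.

(** On a finite window [psi] can jump only when a site enters or leaves the pieces. Nearby points
    that both avoid the late pieces show no such jump, and the late pieces have uniformly small
    measure. *)
Lemma Fs_continuous : totally_disconnected [set: Y] -> continuous Fs.
Proof.
move=> tdY; apply: (push_continuous tdY mpsi FsE) => e e0.
have e20 : 0 < e / 2 by rewrite divr_gt0.
have [n hn] := @fsub_ball _ _ _ (config_space) _ e20.
pose A := firsts (fun k => (pair_en k).1) n.
have [m hm] := high_hits_small A e0.
have oH : open (hits A (high m)) by apply: hits_open; exact: high_open.
have oV : open (pi @^-1` hits A (high m)) by apply: open_comp => // y _; exact: piC.
exists (pi @^-1` hits A (high m)); split => //.
  move=> mu; apply: (@inv_pull _ _ Y Z pi (hits A (high m)) e%:E) => //.
  exact: borel_open.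
move=> y; exists (psi y).
have [Vy|nVy] := pselect ((pi @^-1` hits A (high m)) y).
  by apply: filterS (open_nbhs_nbhs (conj oV Vy)) => y' ?.
have n1 := near_act_mdist y A e20.
have n2 := near_pi (near_act_mdist (pi y) A e20).
have n3 := near_pi (stable_site A m (pi y)).
have n4 := near_pi (near_codes (pi y) A).
near=> y' => nVy'.
apply: le_lt_trans (hn (psi y) (psi y') _) _; last lra.
move=> k kn; change (fs_en _ k) with (pair_en k).
have := mem_firsts (fun k => (pair_en k).1) kn; rewrite -/A.
move: (pair_en k) => [a b] /= aA.
have h1 : mdist (act Y a y) (act Y a y') < e / 2 by move: (a) aA; near: y'.
have h2 : mdist (act Z a (pi y)) (act Z a (pi y')) < e / 2 by move: (a) aA; near: y'.
have h3 : pieces (act Z a (pi y')) <-> pieces (act Z a (pi y)).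
  by move: (a) aA; have := nVy; have := nVy'; near: y'.
have h4 : pieces (act Z a (pi y)) -> code (act Z a (pi y')) = code (act Z a (pi y)).
  by move=> pa; suff: pieces (act Z a (pi y')) /\ code (act Z a (pi y')) = code (act Z a (pi y)); [case|move: (a) aA pa; near: y'].
rewrite /pval piE [in X in mdist _ X]piE (propext h3).
case: asboolP => pa; rewrite site_mdist /cval /= ?(h4 pa) ?mdistxx subrr normr0 e20 ?h2 ?h1//.
Unshelve. all: by end_near. Qed.

Lemma Hs_continuous : totally_disconnected [set: X] -> continuous Hs.
Proof.
move=> tdX; apply: (push_continuous tdX mtheta HsE) => e e0.
have e20 : 0 < e / 2 by rewrite divr_gt0.
have [m0 hm0] := half_small e20.
have [N hN] := seq_bound (D m0).
pose A := firsts s N.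
have sA k : (k < N)%N -> s k \in A by exact: mem_firsts.
have [m hm] := high_hits_small A e20.
(* Off [V] a site off the pieces occurs within a bounded time, and the first one is the same for
   nearby points off [V]; [theta] is there a single continuous expression. *)
pose V := noK m0 `|` hits A (high m).
have oV : open V by apply: openU; [exact: noK_open|apply: hits_open; exact: high_open].
have oV' : open (tau @^-1` V) by apply: open_comp => // x _; exact: tau_continuous.
exists (tau @^-1` V); split => //.
  move=> mu; apply: (@inv_pull _ _ X Z tau V e%:E).
  - exact: tau_continuous.
  - exact: tau_act.
  - exact: borel_open.
  move=> nu; have mN : measurable (noK m0 : set (borel Z)) by apply: borel_open; exact: noK_open.
  have mH : measurable (hits A (high m) : set (borel Z)).
    by apply: borel_open; apply: hits_open; exact: high_open.
  apply: le_trans (measureU2 nu mN mH) _; rewrite (splitr e) EFinD; apply: leeD; last exact: hm.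
  by apply: le_trans (noK_small nu m0) _; rewrite lee_fin ltW.
move=> x; exists (theta x).
have [Vx|nVx] := pselect ((tau @^-1` V) x).
  by apply: filterS (open_nbhs_nbhs (conj oV' Vx)) => x' ?.
have [nN nH] : ~ noK m0 (tau x) /\ ~ hits A (high m) (tau x).
  by split => h; apply: nVx; [left|right].
have [g gD ng] : exists2 g, g \in D m0 & ~ pieces (act Z g (tau x)).
  apply: contrapT => h; apply: nN => g gD; apply: contrapT => ng; apply: h; by exists g.
have [nK fK] := firstKP ng; set n0 := firstK (tau x) in nK fK.
have n0N : (n0 < N)%N.
  rewrite ltnNge; apply/negP => le; have [j jN sj] := hN g gD.
  by apply: ng; rewrite -sj; apply: fK; exact: leq_trans jN le.
have n1 : \forall x' \near x, mdist (theta x) (act Y (s n0)^-1%g (ypart x' (s n0))) < e.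
  have := (mdist_continuousP (fun x' => act Y (s n0)^-1%g (ypart x' (s n0))) x).1; apply => //.
  by apply: (@continuous_comp _ _ _ (ypart^~ (s n0))); [exact: ypart_continuous|exact: act_continuous].
have n2 : \forall x' \near x, ~ hits A (high m) (tau x') ->
    ~ hits A (high m) (tau x) -> forall a, a \in A -> (pieces (act Z a (tau x')) <-> pieces (act Z a (tau x))).
  exact: (@tau_continuous x _ (stable_site A m (tau x))).
apply: filterS2 n1 n2 => x' h1 h2 nVx'.
have {}h2 a : a \in A -> pieces (act Z a (tau x')) <-> pieces (act Z a (tau x)).
  by apply: h2 => // h; apply: nVx'; right.
have e' : firstK (tau x') = n0.
  apply: firstK_uniq; first by rewrite h2// sA.
  by move=> k kn; rewrite h2; [exact: fK|exact: sA (ltn_trans kn n0N)].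
by rewrite {2}/theta e'.
Qed.

End stars.

(** The label values allowed in a tower form a closed set: near a positive limit they are isolated,
    so good approximations agree. *)
Lemma rpart_val (x : X) a b : rpart x a b = 0 \/ exists k, rpart x a b = 2^-1 ^+ k.
Proof.
have /andP[r0 _] := config_lab (a, b) (svalP x).
change (is_true (0 <= rpart x a b)) in r0.
have approx e : 0 < e -> exists l, `|l - rpart x a b| < e /\ (l = 0 \/ exists k, l = 2^-1 ^+ k).
  move=> e0; have [z hz] := svalP x [fset a]%fset [fset b]%fset e e0.
  have [_ /(_ b (fset11 b))] := hz a (fset11 a); rewrite site_mdist => /and3P[_ _ h].
  by eexists; split; [exact: h|exact: tw_labP].
move: (rpart x a b) r0 approx => r; rewrite le_eqVlt => /predU1P[<-|r0] approx; first by left.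
right; have r16 : 0 < r / 16 by rewrite divr_gt0.
have [l [hl [l0|[k lk]]]] := approx _ r16.
  by move: hl; rewrite l0 sub0r normrN gtr0_norm//; lra.
exists k; rewrite -lk; apply/eqP; rewrite -subr_eq0; apply: contraT => ne.
have m0 : 0 < Num.min `|r - l| (r / 16) by rewrite lt_min normr_gt0 ne.
have [l' []] := approx _ m0; rewrite lt_min => /andP[h1 h2] vl'.
have e : l' = 2^-1 ^+ k.
  apply: half_close vl' _; rewrite -lk; move: h2 hl; rewrite !ltr_norml.
  by move=> /andP[? ?] /andP[? ?]; apply/andP; split; lra.
by move: h1; rewrite e -lk distrC ltxx.
Qed.

Lemma configX_totally_disconnected : totally_disconnected [set: Y] -> totally_disconnected [set: X].
Proof.
move=> tdY; apply: zero_dimension_totally_disconnected => x x' /eqP xx'.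
have zZ := totally_disconnected_zero_dimensional (@space_compact _ _ Z) tdZ.
have zY := totally_disconnected_zero_dimensional (@space_compact _ _ Y) tdY.
have [[a b] ne] : exists k, xval x k <> xval x' k.
  by apply: contrapT => h; apply: xx'; apply: X_eq => k; apply: contrapT => ne; apply: h; exists k.
rewrite !xval_site in ne.
have [e1|/eqP/zZ[U [cU Ux nUx]]] := pselect (tau x = tau x'); last first.
  exists (tau @^-1` U); split => //; apply: preimage_clopen => //; exact: tau_continuous.
have [e2|/eqP/zY[U [cU Ux nUx]]] := pselect (ypart x a = ypart x' a); last first.
  exists ((ypart^~ a) @^-1` U); split => //; apply: preimage_clopen => //; exact: ypart_continuous.
have ne3 : rpart x a b <> rpart x' a b by move=> e3; apply: ne; rewrite e1 e2 e3.
have main k : clopen [set x : X | rpart x a b < 2^-1 ^+ k * (3 / 4)].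
  have rc : continuous (fun x : X => rpart x a b : R^o) by exact: rpart_continuous.
  split.
    apply: (@open_comp _ _ (fun x : X => rpart x a b : R^o) [set r : R^o | r < 2^-1 ^+ k * (3 / 4)]) => //.
  have -> : [set x : X | rpart x a b < 2^-1 ^+ k * (3 / 4)] =
      (fun x : X => rpart x a b : R^o) @^-1` [set r : R^o | r <= 2^-1 ^+ k * (3 / 4)].
    apply/seteqP; split => u /=; first exact: ltW.
    exact: half_gap (rpart_val u a b).
  by apply: closed_comp => [u _|]; [exact: rc|exact: (@closed_le R)].
have sep u v : rpart u a b < rpart v a b -> exists k, rpart u a b < 2^-1 ^+ k * (3 / 4) /\ ~ (rpart v a b < 2^-1 ^+ k * (3 / 4)).
  by move=> /(half_sep (rpart_val u a b) (rpart_val v a b))[k [h1 h2]]; exists k; split => //; apply/negP; rewrite -leNgt.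
have [lt|lt|//] := ltgtP (rpart x a b) (rpart x' a b).
  by have [k [h1 h2]] := sep _ _ lt; eexists; split; [exact: main k| |].
have [k [h1 h2]] := sep _ _ lt; exists (~` [set x : X | rpart x a b < 2^-1 ^+ k * (3 / 4)]); split => //.
  by apply: clopenC; [exact: setT|exact: main].
Qed.

(** By minimality finitely many elements bring any point of [S] to an isolated one, so [S] and its
    image [Z] would be finite, and [Z] would have an isolated point. *)
Lemma factor_no_isolated (S : dynSystem R G) (q : S -> Z) : minimal S -> factor_map q ->
  isolated [set: Z] = set0 -> isolated [set: S] = set0.
Proof.
move=> mS [_ qS qE] isoZ; apply/seteqP; split => // x [_ [V xV VT]].
rewrite setIT in VT; move: xV; rewrite nbhsE => -[U [oU Ux] UV].
have Ueq u : U u -> u = x by move=> /UV; rewrite VT.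
have [D hD] := minimal_cover mS oU (ex_intro _ x Ux).
have fin z : exists2 g, g \in D & z = act Z g^-1%g (q x).
  have [u _ <-] := qS z Logic.I; have [g gD /Ueq gu] := hD u.
  by exists g => //; rewrite -gu qE actVK.
have : isolated [set: Z] (q x); last by rewrite isoZ.
apply: (@finite_open_isolated _ _ Z (q x) _ setT [fset g^-1 | g in D]%g%fset openT) => // z _.
by have [g gD zg] := fin z; exists g^-1%g => //; apply/imfsetP; exists g.
Qed.

Lemma configX_cantor : isolated [set: Z] = set0 -> cantor_set Y -> cantor_set X.
Proof.
move=> isoZ [_ tdY _]; split; first exact: space_compact.
  exact: configX_totally_disconnected.
apply: (factor_no_isolated _ _ isoZ); last exact: tau_factor.
exact: configX_minimal.
Qed.

End frame.

(** * Construction of towers *)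

Section build.
Context {R : realType} {G : groupType} {Z Y : dynSystem R G}.
Variables (pi : Y -> Z) (z0 : Z) (y0 : Y) (s : nat -> G).
Hypothesis pi_factor : factor_map pi.
Hypotheses (mZ : minimal Z) (mY : minimal Y) (tdZ : totally_disconnected [set: Z])
  (isoZ : isolated [set: Z] = set0) (Ginf : infinite_set [set: G])
  (free0 : [set g | act Z g z0 = z0] = [set 1%g]).

Let piE g y : pi (act Y g y) = act Z g (pi y). Proof. by have [_ _] := pi_factor; apply. Qed.

(** Compactness and minimality of [Y] bound the return times uniformly in both points; only a finite
    [H] can be put into one stage. *)
Lemma uniform_return (L : set Z) n : clopen L -> exists H : {fset G}, forall y y', exists2 h, h \in H &
  mdist y (act Y h y') < n.+1%:R^-1 /\ forall j, (j < n)%N -> ~ L (act Z (s j) (pi y)) ->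
    ~ L (act Z (s j * h)%g (pi y')).
Proof.
move=> cL.
pose S := firsts s n.
have step u : exists U : set Y, [/\ open U, U u & forall y, U y -> mdist u y < n.+1%:R^-1 / 2 /\
    forall a, a \in S -> (L (act Z a (pi y)) <-> L (act Z a (pi u)))].
  have e0 : 0 < (n.+1%:R^-1 / 2 : R) by rewrite divr_gt0 ?invr_gt0.
  have N1 : \forall y \near u, mdist u y < n.+1%:R^-1 / 2 by apply/mdist_nbhsP; exists (n.+1%:R^-1 / 2).
  have N2 := near_pi pi_factor (clopen_act_near (pi u) S cL).
  have : nbhs u [set y | mdist u y < n.+1%:R^-1 / 2 /\
    forall a, a \in S -> (L (act Z a (pi y)) <-> L (act Z a (pi u)))] by exact: filterI N1 N2.
  by rewrite nbhsE => -[U [oU Uu] hU]; exists U; split => // y /hU.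
have [U hU] := choice step.
have [||C [_ hC]] := @compact_finite_cover R Y Y setT U (@space_compact _ _ Y).
- by move=> u _; have [] := hU u.
- by move=> u; exists u => //; have [] := hU u.
have ex u : exists D : {fset G}, forall y, exists2 g, g \in D & U u (act Y g y).
  have [oU Uu _] := hU u; exact: minimal_cover mY oU (ex_intro _ u Uu).
have [D hD] := choice ex.
exists (\bigcup_(u <- C) D u)%fset => y y'.
have [u uC Uy] := hC y; have [h hDu Uh] := hD u y'.
exists h; first by apply/bigfcupP; exists u; rewrite ?uC.
have [_ _ hu] := hU u; have [d1 c1] := hu _ Uy; have [d2 c2] := hu _ Uh.
split.
  by apply: le_lt_trans (metric_triangle _ u _) _; rewrite (splitr n.+1%:R^-1) ltrD// metric_sym.
move=> j jn; rewrite (propext (c1 _ (mem_firsts s jn))) -(propext (c2 _ (mem_firsts s jn))).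
by rewrite piE actM.
Qed.

Lemma open_not_finite (U : set Z) (A : {fset G}) (z : Z) : open U -> U !=set0 ->
  exists2 u, U u & forall a, a \in A -> u <> act Z a z.
Proof.
move=> oU [u Uu]; apply: contrapT => h.
have hA v : U v -> exists2 a, a \in A & v = act Z a z.
  move=> Uv; apply: contrapT => h'; apply: h; exists v => // a aA va; apply: h'; by exists a.
have : isolated [set: Z] u by exact: finite_open_isolated hA.
by rewrite isoZ.
Qed.

Lemma infinite_fset m : exists A : {fset G}, (m <= #|` A|)%N.
Proof. by have [A _ hA] := infinite_set_fset m Ginf; exists A. Qed.

(** Separation near [z0] comes from its trivial stabiliser, the diameters from continuity. A point
    outside [L] and off the finite set [F z0], which exists since [Z] has no isolated point, is left
    uncovered to make room for later stages. *)
Lemma tiny_base (L : set Z) (F : {fset G}) (M n : nat) (N0 : set Z) : clopen L -> (exists z, ~ L z) ->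
  nbhs z0 N0 -> exists E : set Z, [/\ clopen E, E z0, E `<=` N0, separates F E &
    [/\ (forall f e, f \in F -> E e -> mdist (act Z f z0) (act Z f e) < n.+1%:R^-1),
    (exists2 A : {fset G}, separates A E & (#|` F| * M * 2 ^ n <= #|` A|)%N) &
    exists z, ~ (L `|` coset_cover F E) z]].
Proof.
move=> [oL clL] [z1 nz1] hN0.
have [A hA] := infinite_fset (#|` F| * M * 2 ^ n).
have [N1 hN1 sN1] := separates_near F free0.
have [N2 hN2 sN2] := separates_near A free0.
have n3 : \forall e \near z0, forall f, f \in F -> mdist (act Z f z0) (act Z f e) < n.+1%:R^-1.
  by apply: near_act_mdist; rewrite invr_gt0.
have [z nLz nFz] : exists2 z, (~` L) z & forall f, f \in F -> z <> act Z f z0.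
  by apply: open_not_finite; [exact: closed_openC|exists z1].
have n4 : \forall e \near z0, forall f, f \in F -> z <> act Z f e.
  apply: near_fset => f fF; have : open (~` [set z]).
    by apply: closed_openC; apply: accessible_closed_set1; apply: hausdorff_accessible; exact: metric_hausdorff.
  move=> /(@act_open _ _ Z f) o1; have : nbhs z0 (act Z f @^-1` (~` [set z])).
    by apply: open_nbhs_nbhs; split => //= e; apply: nFz fF _.
  by apply: filterS => e /= h ze; exact: h.
have hN : nbhs z0 ((N0 `&` N1) `&` (N2 `&` [set e | (forall f, f \in F -> mdist (act Z f z0) (act Z f e) < n.+1%:R^-1)
    /\ forall f, f \in F -> z <> act Z f e])).
  by apply: filterI; apply: filterI => //; exact: filterI n3 n4.
have [E [cE Ez hE]] := clopen_nbhs (@space_compact _ _ Z) tdZ hN.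
exists E; split => //.
- by move=> e /hE[[]].
- by apply: separatesS sN1 => e /hE[[]].
split.
- by move=> f e fF /hE[_ [_ [h _]]]; exact: h.
- by exists A => //; apply: separatesS sN2 => e /hE[_ []].
- exists z => -[//|[f fF /hE[_ [_ [_ h]]]]]; apply: (h f fF); by rewrite actKV.
Qed.

Definition stage_data := ({fset G} * set Z * (G -> G -> R))%type.

Record good_stage (n : nat) (L : set Z) (M : nat) (d : stage_data) : Prop := GoodStage {
  gs_clopen : clopen d.1.2 ; gs_base : d.1.2 z0 ; gs_sep : separates d.1.1 d.1.2 ;
  gs_diam : forall f e, f \in d.1.1 -> d.1.2 e -> mdist (act Z f z0) (act Z f e) < n.+1%:R^-1 ;
  gs_small : exists2 A : {fset G}, separates A d.1.2 & (#|` d.1.1| * M * 2 ^ n <= #|` A|)%N ;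
  gs_proper : exists z, ~ (L `|` coset_cover d.1.1 d.1.2) z ;
  gs_labP : forall f t, d.2 f t = 0 \/ exists k, d.2 f t = 2^-1 ^+ k ;
  gs_dense : forall y, exists h, mdist y (act Y h y0) < n.+1%:R^-1 /\
    forall j, (j < n)%N -> ~ L (act Z (s j) (pi y)) ->
    [/\ ~ L (act Z (s j * h)%g z0), (s j * h)%g \in d.1.1 &
        forall t, d.2 (s j * h)%g t <= n.+1%:R^-1] }.

(** The return set [D n] depends on the stages before [n] only, so its size is known when [E n] is
    shrunk; the state carries the maximum of all sizes so far, as [tw_small] asks for every
    [m <= n]. [Q] is the extra property specific to each of the two cases. *)
Lemma build (Q : nat -> set Z -> stage_data -> Prop) :
  (forall n L M, clopen L -> (exists z, ~ L z) -> exists d, good_stage n L M d /\ Q n L d) ->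
  exists w : tower pi z0 y0 s, forall n, Q n (lower (tw_F w) (tw_E w) n) (tw_F w n, tw_E w n, tw_lab w n).
Proof.
move=> stepQ.
pose St := {LM : set Z * nat | clopen LM.1 /\ exists z, ~ LM.1 z}.
have step (p : nat * St) : exists c : {fset G} * nat * stage_data, [/\
    forall z, exists2 g, g \in c.1.1 & ~ (sval p.2).1 (act Z g z),
    c.1.2 = maxn (sval p.2).2 #|` c.1.1|, good_stage p.1 (sval p.2).1 c.1.2 c.2 &
    Q p.1 (sval p.2).1 c.2].
  case: p => n [[L M] [/= cL exL]].
  have oL : open (~` L) by apply: closed_openC; case: cL.
  have [D hD] := minimal_cover mZ oL exL.
  have [d [gd qd]] := stepQ n L (maxn M #|` D|) cL exL.
  by exists (D, maxn M #|` D|, d).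
have [c cP] := choice step.
have nextP n (S : St) : clopen ((sval S).1 `|` coset_cover (c (n, S)).2.1.1 (c (n, S)).2.1.2) /\
    exists z, ~ ((sval S).1 `|` coset_cover (c (n, S)).2.1.1 (c (n, S)).2.1.2) z.
  have [_ _ gd _] := cP (n, S); split; last exact: gs_proper gd.
  by apply: clopenU; [have [[]] := svalP S|apply: coset_cover_clopen; exact: gs_clopen gd].
pose next n (S : St) : St := exist _ ((sval S).1 `|` coset_cover (c (n, S)).2.1.1 (c (n, S)).2.1.2, (c (n, S)).1.2) (nextP n S).
have S0P : clopen (set0 : set Z) /\ exists z : Z, ~ set0 z by split; [exact: clopen0|exists point].
pose fix S n : St := if n is n'.+1 then next n' (S n') else exist _ (set0, 0%N) S0P.
pose dd n := (c (n, S n)).2.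
have lowE n : lower (fun n => (dd n).1.1) (fun n => (dd n).1.2) n = (sval (S n)).1.
  by elim: n => //= n ->.
have gd n : good_stage n (sval (S n)).1 (c (n, S n)).1.2 (dd n) by have [] := cP (n, S n).
have MS n : (sval (S n.+1)).2 = (c (n, S n)).1.2 by [].
have Mle m n : (m <= n)%N -> (#|` (c (m, S m)).1.1| <= (c (n, S n)).1.2)%N.
  elim: n => [|n IH]; first by rewrite leqn0 => /eqP ->; have [_ -> _ _] := cP (0%N, S 0%N); rewrite leq_maxr.
  have [_ e _ _] := cP (n.+1, S n.+1); rewrite leq_eqVlt => /predU1P[->|]; first by rewrite e leq_maxr.
  by rewrite ltnS => /IH h; rewrite e; apply: leq_trans h _; rewrite -MS leq_maxl.
unshelve eexists (@Tower R G Z Y pi z0 y0 s (fun n => (dd n).1.1) (fun n => (dd n).1.2) (fun n => (dd n).2)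
  (fun n => (c (n, S n)).1.1) _ _ _ _ _ _ _ _) => /=.
- by move=> n; exact: gs_clopen (gd n).
- by move=> n; exact: gs_base (gd n).
- by move=> n; exact: gs_sep (gd n).
- by move=> n f e; exact: gs_diam (gd n) f e.
- by move=> n f t; exact: gs_labP (gd n) f t.
- by move=> n z; rewrite lowE; have [h _ _ _] := cP (n, S n); exact: h.
- move=> m n mn; have [A sA hA] := gs_small (gd n); exists A => //.
  by apply: leq_trans hA; rewrite leq_mul2r leq_mul2l Mle// !orbT.
- by move=> n y; rewrite lowE; exact: gs_dense (gd n) y.
by move=> n; rewrite lowE; have [_ _ _] := cP (n, S n); rewrite -surjective_pairing -surjective_pairing.
Qed.

End build.

(** * Nonamenable groups *)

Section sums.
Context {R : realType} {G : groupType} (X : dynSystem R G) (mu : invMeasure X) (I : choiceType).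
Variables (B : I -> set (borel X)) (mB : forall i, measurable (B i)).

Definition seq_union (l : seq I) : set (borel X) := [set x | exists2 i, i \in l & B i x].

Lemma seq_union_nil : seq_union [::] = set0.
Proof. by apply/seteqP; split => x // []. Qed.

Lemma seq_union_cons a l : seq_union (a :: l) = B a `|` seq_union l.
Proof.
apply/seteqP; split => x [].
- by move=> i; rewrite inE => /predU1P[->|il] Bi; [left|right; exists i].
- by move=> Ba; exists a; rewrite ?mem_head.
- by case=> i il Bi; exists i; rewrite // inE il orbT.
Qed.

Lemma seq_union_borel (l : seq I) : measurable (seq_union l).
Proof.
elim: l => [|a l IH]; first by rewrite seq_union_nil.
by rewrite seq_union_cons; exact: measurableU.
Qed.

Lemma inv_sum_disjoint (l : seq I) : uniq l -> (forall i j x, B i x -> B j x -> i = j) ->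
  (\sum_(i <- l) mu (B i) = mu (seq_union l))%E.
Proof.
move=> + dis; elim: l => [_|a l IH /= /andP[al ul]]; first by rewrite big_nil seq_union_nil measure0.
rewrite big_cons IH// seq_union_cons [RHS]measureU//; first exact: seq_union_borel.
by apply/seteqP; split => x // [Ba [i il Bi]]; rewrite (dis _ _ _ Ba Bi) il in al.
Qed.

Lemma inv_sum_cover (l : seq I) (C : set (borel X)) : measurable C ->
  C `<=` seq_union l -> (mu C <= \sum_(i <- l) mu (B i))%E.
Proof.
move=> mC sub; apply: le_trans (inv_le mu mC (seq_union_borel l) sub) _.
elim: l {sub} => [|a l IH]; first by rewrite big_nil seq_union_nil measure0.
rewrite big_cons seq_union_cons; apply: le_trans (leeD (lexx _) IH).
exact: (measureU2 mu (mB a) (seq_union_borel l)).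
Qed.

End sums.

Lemma act_gap (R : realType) (G : groupType) (Y : dynSystem R G) (t : G) (y y' : Y) :
  y' <> act Y t y -> exists2 e : R, 0 < e & forall u u', mdist y u < e -> mdist y' u' < e -> u' <> act Y t u.
Proof.
move=> ne; have d0 := mdist_gt0 ne.
have d20 : 0 < mdist y' (act Y t y) / 2 by rewrite divr_gt0.
have /mdist_nbhsP[e e0 he] := (mdist_continuousP _ _).1 (@act_continuous _ _ Y t y) _ d20.
exists (Num.min e (mdist y' (act Y t y) / 2)); first by rewrite lt_min e0.
move=> u u'; rewrite !lt_min => /andP[/he h1 _] /andP[_ h2] uu; rewrite uu in h2.
have := metric_triangle y' (act Y t u) (act Y t y); rewrite (metric_sym (act Y t u)); lra.
Qed.

(** A site belongs to the earliest stage that covers it. A step from [z] hence stays in its piece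
    when the new index is in [F] and the new site is not of an earlier stage. *)
Lemma code_step (R : realType) (G : groupType) (Z Y : dynSystem R G) (pi : Y -> Z) z0 y0 s
    (w : tower pi z0 y0 s) z t : pieces w z -> pieces w (act Z t z) ->
  ((code w z).1 <= (code w (act Z t z)).1)%N -> (t * (code w z).2)%g \in tw_F w (code w z).1 ->
  code w (act Z t z) = ((code w z).1, (t * (code w z).2)%g).
Proof.
move=> /codeP [fF fE nl] /codeP[_ _ nl'] le tF; apply: codeE; split => //=.
  by rewrite -actM invMg mulgVK.
by move=> /(lowS le).
Qed.

(** * Stages labelled by a paradox *)

Section paradox_stage.
Context {R : realType} {G : groupType} {Z Y : dynSystem R G}.
Variables (pi : Y -> Z) (z0 : Z) (y0 : Y) (s : nat -> G).
Hypotheses (sP : forall g, exists n, s n = g) (pi_factor : factor_map pi) (pi0 : pi y0 = z0).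
Hypotheses (mY : minimal Y) (tdZ : totally_disconnected [set: Z])
  (isoZ : isolated [set: Z] = set0) (Ginf : infinite_set [set: G])
  (free0 : [set g | act Z g z0 = z0] = [set 1%g]).
Variables (T : {fset G}) (O : set Z) (sg : bool -> Z -> G).
Hypotheses (oO : open O) (Oorb : forall g, O (act Z g z0)) (sgT : forall i z, O z -> sg i z \in T)
  (sg_near : forall i z, O z -> \forall z' \near z, sg i z' = sg i z)
  (sg_inj : forall z i j g h, O (act Z g z) -> O (act Z h z) ->
      (sg i (act Z g z) * g)%g = (sg j (act Z h z) * h)%g -> (i, g) = (j, h)).

Definition sgp z : G * G := (sg true z, sg false z).
(** Encodes a pair of choices as the exponent of a label; as [T] is finite, the labels of pairs from
    [T] are bounded away from 0. *)
Definition pidx (p : G * G) : nat := index p (T `*` T)%fset.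

Lemma sgp_TT z : O z -> sgp z \in (T `*` T)%fset.
Proof. by move=> Oz; rewrite in_fsetM /= !sgT. Qed.

(** The label in the direction [s j] records the choice at the site moved by [s j], not at the site
    itself, so a single labelled site displays the paradox along a whole window. Core sites are
    unlabelled, and their moves by [s j] stay in the stage. *)
Definition paradox_data (n : nat) (L : set Z) (d : @stage_data R G Z) : Prop :=
  exists core : pred G, [/\
    forall f j, f \in d.1.1 -> (j < n)%N ->
      d.2 f (s j) = if core f then 0 else 2^-1 ^+ pidx (sgp (act Z (s j * f)%g z0)),
    forall f e j, f \in d.1.1 -> d.1.2 e -> (j < n)%N ->
      O (act Z (s j * f)%g e) /\ sgp (act Z (s j * f)%g e) = sgp (act Z (s j * f)%g z0) &
    forall f j, f \in d.1.1 -> core f -> (j < n)%N -> (s j * f)%g \in d.1.1].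

Lemma paradox_stage n L M : clopen L -> (exists z, ~ L z) ->
  exists d, good_stage pi z0 y0 s n L M d /\ paradox_data n L d.
Proof.
move=> cL exL; have [H hH] := uniform_return s pi_factor mY n cL.
pose S := firsts s n; have sS j := @mem_firsts _ s j n.
(* [C] is the core, where points of [Y] are imitated; the rim is added so that moves of core sites
   remain in [F]. *)
pose C := gmul S H; pose F := (C `|` gmul S C)%fset.
have [|E [cE E0 EN sE [dE smE prE]]] := @tiny_base R G Z z0 tdZ isoZ Ginf free0 L F M n
    [set e | forall a, a \in gmul S F -> O (act Z a e) /\ sgp (act Z a e) = sgp (act Z a z0)] cL exL.
  apply: near_fset => a _.
  have n1 : \forall z \near act Z a z0, O z by apply: open_nbhs_nbhs.
  have N2 : nbhs (act Z a z0) [set z | O z /\ sgp z = sgp (act Z a z0)].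
    have h1 := sg_near true (Oorb a); have h2 := sg_near false (Oorb a).
    apply: filterS3 n1 h1 h2 => z Oz e1 e2; by split => //; rewrite /sgp e1 e2.
  exact: (@act_continuous R G Z a z0 _ N2).
pose lab f t : R := if (f \in C) || (t \notin S) then 0 else 2^-1 ^+ pidx (sgp (act Z (t * f)%g z0)).
exists (F, E, lab); split.
  constructor => //=.
    by move=> f t; rewrite /lab; case: ifP; [left|right; eexists].
  move=> y; have [h hH' [d1 d2]] := hH y y0; exists h; split => // j jn nL.
  have shC : (s j * h)%g \in C by apply: mem_gmul => //; exact: sS.
  split.
  - by have := d2 j jn nL; rewrite pi0.
  - by rewrite in_fsetU shC.
  - by move=> t; rewrite /lab shC /= invr_ge0.
exists (mem C); split => /=.
- by move=> f j fF jn; rewrite /lab sS //= orbF.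
- by move=> f e j fF Ee jn; apply: EN => //; apply: mem_gmul => //; exact: sS.
- by move=> f j _ fC jn; rewrite in_fsetU; apply/orP; right; apply: mem_gmul => //; exact: sS.
Qed.

Section rigid.
Variable w : tower pi z0 y0 s.
Hypothesis wP : forall n, paradox_data n (lower (tw_F w) (tw_E w) n) (tw_F w n, tw_E w n, tw_lab w n).

Local Notation low := (lower (tw_F w) (tw_E w)).
Local Notation X := (configX sP pi_factor pi0 w).

Let core n : pred G := projT1 (cid (wP n)).
Let coreP n := projT2 (cid (wP n)).

Definition label_val (z : Z) : R := 2^-1 ^+ pidx (sgp z).

Lemma site_label n z j : pieces w z -> (n <= (code w z).1)%N -> (j < n)%N ->
  O (act Z (s j) z) /\ tw_lab w (code w z).1 (code w z).2 (s j) =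
    if core (code w z).1 (code w z).2 then 0 else label_val (act Z (s j) z).
Proof.
move=> /codeP; move: (code w z) => [m f] /= [/= fF fE _] nm jn.
have jm := leq_trans jn nm; have [h1 h2 _] := coreP m.
have [hO hs] := h2 f _ j fF fE jm; rewrite -actM mulgK in hO hs.
by split => //; have /= -> := h1 f j fF jm; rewrite /label_val hs.
Qed.

(** A quarter of a lower bound for the nonzero labels: an error below [eps0] is within the reach of
    [half_close]. *)
Definition eps0 : R := 2^-1 ^+ #|` T `*` T|%fset / 4.
Lemma eps0_gt0 : 0 < eps0. Proof. by rewrite /eps0 divr_gt0// half_gt0. Qed.

Lemma pidx_ge p : p \in (T `*` T)%fset -> 4 * eps0 <= 2^-1 ^+ pidx p.
Proof.
move=> pT; rewrite /eps0 mulrCA divff ?mulr1 ?pnatr_eq0//; apply: half_le.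
by rewrite ltnW// index_mem.
Qed.

Lemma label_val_ge z : O z -> 4 * eps0 <= label_val z.
Proof. by move=> Oz; apply: pidx_ge; exact: sgp_TT. Qed.

(** One [z] serves all sites and directions, and [c] is fixed by the code at the site [a]: two
    directions at one site are both in the core case or both labelled. *)
Lemma label_approx (x : X) (A B : {fset G}) (e : R) N : 0 < e -> exists z,
  forall a b, a \in A -> b \in B -> ~ pieces w (act Z a (tau x)) ->
  exists2 c : bool, O (act Z (b * a)%g z) &
   [/\ `|(if c then 0 else label_val (act Z (b * a)%g z)) - rpart x a b| < e,
    pieces w (act Z a z), core (code w (act Z a z)).1 (code w (act Z a z)).2 = c,
    mdist (ypart x a) (act Y (code w (act Z a z)).2 y0) < e & (N <= (code w (act Z a z)).1)%N].
Proof.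
move=> e0; have [n hn] := seq_bound sP B.
have [z [_ hz]] := K_approx x A B (maxn n N) e0; exists z => a b aA bB na.
have [pz hb /(_ na)] := hz a aA; rewrite geq_max => /andP[cn cN].
have := hb b bB; rewrite xval_site site_mdist => /and3P[_ hy h].
have [j jn sj] := hn b bB; have [hO hl] := site_label pz cn jn.
rewrite /cval /= -sj hl in h; rewrite -sj actM.
by exists (core (code w (act Z a z)).1 (code w (act Z a z)).2).
Qed.

Definition wild : set X := [set x | exists2 g, ~ pieces w (act Z g (tau x)) & rpart x g 1%g <> 0].

(** The direction [g^-1] at the site [g] leads back to the site 1, so [t] is the choice [sg i] made
    for the point itself. *)
Definition token (i : bool) (t : G) : set X := [set x | exists g p, [/\ ~ pieces w (act Z g (tau x)),
  p \in (T `*` T)%fset, rpart x g 1%g <> 0, rpart x g g^-1%g = 2^-1 ^+ pidx p &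
  (if i then p.1 else p.2) = t]].

Lemma token_read (x : X) i t g g' p : ~ pieces w (act Z g (tau x)) -> p \in (T `*` T)%fset ->
  rpart x g g' = 2^-1 ^+ pidx p -> (if i then p.1 else p.2) = t ->
  forall z c, O (act Z (g' * g)%g z) ->
  `|(if c then 0 else label_val (act Z (g' * g)%g z)) - rpart x g g'| < eps0 ->
  sg i (act Z (g' * g)%g z) = t.
Proof.
move=> ng pT -> <- z c hO.
have p4 := pidx_ge pT.
move=> h; have e0 := eps0_gt0.
have : (if c then 0 else label_val (act Z (g' * g)%g z)) = 2^-1 ^+ pidx p.
  apply: half_close; first by case: c {h}; [left|right; eexists].
  by apply: lt_le_trans h _; lra.
case: c {h} => [e|]; first by have := @half_gt0 R (pidx p); rewrite -e ltxx.
move=> /eqP; rewrite eq_le /label_val => /andP[h1 h2].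
have /(@index_inj _ _ (T `*` T)%fset) e : pidx (sgp (act Z (g' * g)%g z)) = pidx p.
  have hl i' j' : (2^-1 : R) ^+ i' <= 2^-1 ^+ j' -> (j' <= i')%N.
    rewrite leqNgt => h; apply/negP => lt; have := @half_lt R _ _ lt; have := @half_gt0 R i'; lra.
  by apply/eqP; rewrite eqn_leq !hl.
by rewrite -e//; [case: (i)|exact: sgp_TT].
Qed.

(** One nonzero label shows that the approximating site is outside the core; its label in the
    direction [g^-1] then is a readable choice. *)
Lemma wild_token (x : X) i : wild x -> exists2 t, t \in T & token i t x.
Proof.
move=> [g ng r0].
have e0 : 0 < Num.min eps0 `|rpart x g 1%g| by rewrite lt_min eps0_gt0 normr_gt0; apply/eqP.
have [z hz] := label_approx x [fset g]%fset [fset 1; g^-1]%g%fset 0%N e0.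
have [c _ [h1 p1 c1 _ _]] := hz g 1%g (fset11 g) (fset21 _ _) ng.
have [c' hO [h2 _ c2 _ _]] := hz g g^-1%g (fset11 g) (fset22 _ _) ng.
have cc : c' = c by rewrite -c1 -c2.
rewrite cc in h2; case: c h1 h2 {c1 c2 cc} => h1 h2.
  by move: h1; rewrite sub0r normrN lt_min ltxx andbF.
rewrite mulVg act1 in hO h2.
exists (if i then (sgp z).1 else (sgp z).2); first by case: (i) => /=; exact: sgT.
exists g, (sgp z); split => //; first exact: sgp_TT.
apply: half_close; first exact: rpart_val.
rewrite distrC; move: h2; rewrite lt_min => /andP[h2 _]; apply: lt_le_trans h2 _.
by have := label_val_ge hO; rewrite /label_val; lra.
Qed.

Lemma token_wild i t x : token i t x -> wild x.
Proof. by move=> [g [p [ng _ r0 _ _]]]; exists g. Qed.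

Lemma wild_act g x : wild (act X g x) <-> wild x.
Proof.
split=> [[a na ra]|[a na ra]].
  by exists (a * g)%g; [rewrite tau_actE -actM in na|rewrite rpart_act in ra].
exists (a * g^-1)%g; first by rewrite tau_actE -actM mulgVK.
by rewrite rpart_act mulgVK.
Qed.

(** A token [(i, t)] at the translate of [u] by [t^-1] says that copy [i] of this translate is sent
    to [u]; [sg_inj] allows one such arrow. *)
Lemma token_inj (u : X) i t i' t' : token i t (act X t^-1%g u) -> token i' t' (act X t'^-1%g u) ->
  (i, t) = (i', t').
Proof.
move=> [g [p [ng pT r0 rp pt]]] [g' [p' [ng' pT' r0' rp' pt']]].
rewrite !tau_actE -!actM in ng ng'; rewrite !rpart_act in rp rp'.
have [z hz] := label_approx u [fset g * t^-1; g' * t'^-1]%g%fset [fset g^-1; g'^-1]%g%fset 0%N eps0_gt0.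
have [c hO [h1 _ _ _ _]] := hz _ _ (fset21 _ _) (fset21 _ _) ng.
have [c' hO' [h1' _ _ _ _]] := hz _ _ (fset22 _ _) (fset22 _ _) ng'.
have k1 := token_read ng pT rp pt hO h1; have k2 := token_read ng' pT' rp' pt' hO' h1'.
rewrite !mulKg in hO hO' k1 k2.
have := @sg_inj z i i' t^-1%g t'^-1%g hO hO'; rewrite k1 k2 !mulgV => /(_ erefl)[-> /invg_inj ->].
by [].
Qed.

Lemma rpart_neq_borel g h (r : R) : measurable ([set x : X | rpart x g h <> r] : set (borel X)).
Proof.
apply: borel_open; apply: (@neq_open R X R^o (fun x => rpart x g h) (fun=> r)).
  exact: rpart_continuous.
exact: cst_continuous.
Qed.

Lemma wild_borel : measurable (wild : set (borel X)).
Proof.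
have -> : wild = \bigcup_n ([set x : X | ~ pieces w (act Z (s n) (tau x))] `&` [set x | rpart x (s n) 1%g <> 0]).
  apply/seteqP; split => [x [g ng r0]|x [n _ [ng r0]]]; last by exists (s n).
  by have [n sn] := sP g; exists n => //=; rewrite sn.
apply: bigcupT_measurable => n; apply: measurableI; last exact: rpart_neq_borel.
by apply: borel_closed; exact: K_closed.
Qed.

Lemma token_borel i t : measurable (token i t : set (borel X)).
Proof.
have -> : token i t = \bigcup_n \bigcup_(p in [set p | p \in (T `*` T)%fset /\ (if i then p.1 else p.2) = t])
   ([set x : X | ~ pieces w (act Z (s n) (tau x))] `&` ([set x | rpart x (s n) 1%g <> 0] `&`
     ~` [set x | rpart x (s n) (s n)^-1%g <> 2^-1 ^+ pidx p])).
  apply/seteqP; split => [x [g [p [ng pT r0 rp pt]]]|x [n _ [p [pT pt] [ng [r0 /= /contrapT rp]]]]].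
    have [n sn] := sP g; exists n => //; exists p => //=; rewrite sn; split => //; split => //.
  by exists (s n), p.
apply: bigcupT_measurable => n; apply: fin_bigcup_measurable.
  by apply: sub_finite_set (finite_fset (T `*` T)%fset) => p [].
move=> p _; apply: measurableI; first by apply: borel_closed; exact: K_closed.
by apply: measurableI; [|apply: measurableC]; exact: rpart_neq_borel.
Qed.

(* A wild point sees the two values of [sg] along its whole orbit, so the
   translates of the sets [token i t] are disjoint copies of two partitions. *)
Lemma wild_null (lambda : invMeasure X) : lambda wild = 0%E.
Proof.
pose B (it : bool * G) : set (borel X) := act X it.2^-1%g @^-1` token it.1 it.2.
have mB it : measurable (B it).
  by apply: borel_preimage (token_borel _ _); exact: act_borel.
have dis it jt x : B it x -> B jt x -> it = jt.
  by case: it jt => [i t] [j t'] h1 h2; exact: token_inj h1 h2.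
pose l (i : bool) := [seq (i, t) | t <- enum_fset T].
have ul i : uniq (l i) by rewrite map_inj_uniq ?fset_uniq// => a b [].
have low_i i : (lambda wild <= \sum_(it <- l i) lambda (B it))%E.
  have -> : (\sum_(it <- l i) lambda (B it) = \sum_(it <- l i) lambda (token it.1 it.2))%E.
    by apply: eq_bigr => it _; apply: inv_measure_act; exact: token_borel.
  apply: (inv_sum_cover lambda (B := fun it => token it.1 it.2)).
  - by move=> it; exact: token_borel.
  - exact: wild_borel.
  - by move=> x /(wild_token i)[t tT Dt]; exists (i, t) => //; apply/mapP; exists t.
have ull : uniq (l true ++ l false).
  rewrite cat_uniq !ul /= andbT; apply/hasPn => _ /mapP[t _ ->].
  by apply/mapP => -[t' _].
have := inv_sum_disjoint lambda mB ull dis; rewrite big_cat /= => e.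
have up : (lambda wild + lambda wild <= lambda wild)%E.
  apply: le_trans (leeD (low_i true) (low_i false)) _; rewrite e.
  apply: inv_le; [exact: seq_union_borel|exact: wild_borel|].
  by move=> x [[i t] _ /token_wild]; rewrite wild_act.
have fW : lambda wild \is a fin_num by apply: fin_num_measure; exact: wild_borel.
have ef : lambda wild = (fine (lambda wild))%:E by rewrite fineK.
have a0 : 0 <= fine (lambda wild) by exact: fine_ge0.
move: up; rewrite ef; move: (fine _) a0 => a a0.
by rewrite -EFinD !lee_fin gerDl => h1; congr EFin; apply/eqP; rewrite eq_le a0 h1.
Qed.

Lemma tame_label x g t : ~ wild x -> ~ pieces w (act Z g (tau x)) -> rpart x g t = 0.
Proof.
move=> nw ng; have r1 : rpart x g 1%g = 0.
  by apply: contrapT => r1; apply: nw; exists g.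
apply: contrapT => r0.
have e0 : 0 < Num.min eps0 `|rpart x g t| by rewrite lt_min eps0_gt0 normr_gt0; apply/eqP.
have [z hz] := label_approx x [fset g]%fset [fset 1; t]%g%fset 0%N e0.
have [c hO [h1 p1 c1 _ _]] := hz g 1%g (fset11 g) (fset21 _ _) ng.
have [c' _ [h2 _ c2 _ _]] := hz g t (fset11 g) (fset22 _ _) ng.
have cc : c' = c by rewrite -c1 -c2.
rewrite cc in h2; case: c h1 h2 {c1 c2 cc} => h1 h2.
  by move: h2; rewrite sub0r normrN lt_min ltxx andbF.
move: h1; rewrite r1 subr0 lt_min => /andP[+ _].
have := label_val_ge hO; have := eps0_gt0 => a b; rewrite ger0_norm; lra.
Qed.

(** Unlabelled sites are approximated by core sites. From the one of the earlier stage the move to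
    the other stays in the same piece, so both symbols are translates of [y0] related by [t]. *)
Lemma tame_coherent x t : ~ wild x -> ~ incoherent t x.
Proof.
move=> nw [nK]; rewrite -[tau x]act1 in nK => nKt ne.
have r1 := tame_label 1%g nw nK; have rt := tame_label 1%g nw nKt.
have [e e0 he] := act_gap ne.
have m0 : 0 < Num.min e eps0 by rewrite lt_min e0 eps0_gt0.
have [N hN] := seq_bound sP [fset t; t^-1]%g%fset.
have [z hz] := label_approx x [fset 1; t]%g%fset [fset 1]%g%fset N m0.
have [c hO [h1 p1 c1 d1 N1]] := hz 1%g 1%g (fset21 _ _) (fset11 _) nK.
have [c' hO' [h2 p2 c2 d2 N2]] := hz t 1%g (fset22 _ _) (fset11 _) nKt.
have small u : O u -> `|label_val u - 0| < Num.min e eps0 -> False.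
  move=> Ou; rewrite subr0 lt_min => /andP[_].
  have := label_val_ge Ou; have := eps0_gt0 => a b; rewrite ger0_norm; lra.
rewrite r1 in h1; rewrite rt in h2.
case: c c1 h1 => c1 h1; last exact: small h1.
case: c' c2 h2 => c2 h2; last exact: small h2.
move: d1 d2; rewrite !lt_min => /andP[d1 _] /andP[d2 _]; apply: (he _ _ d1 d2).
rewrite act1 in p1 c1 N1 *; rewrite -actM; congr (act Y _ y0).
have deep u f j k : (N <= (code w u).1)%N -> pieces w u -> core (code w u).1 (code w u).2 ->
    (k < N)%N -> s k = j -> (j * (code w u).2)%g \in tw_F w (code w u).1.
  move=> Nu /codeP[uF _ _] cu kN <-; have [_ _ h3] := coreP (code w u).1.
  by apply: (h3 _ _ uF cu); exact: leq_trans kN Nu.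
have [le|lt] := leqP (code w z).1 (code w (act Z t z)).1.
  have [j jN sj] := hN t (fset21 _ _).
  by rewrite (code_step p1 p2 le)//; exact: deep jN sj.
have [j jN sj] := hN t^-1%g (fset22 _ _).
have := @code_step _ _ _ _ _ _ _ _ w (act Z t z) t^-1%g p2; rewrite actVK => /(_ p1 (ltnW lt)) ->.
  by rewrite mulKVg.
exact: deep jN sj.
Qed.

Lemma paradox_rigid : rigid sP pi_factor pi0 w.
Proof.
move=> lambda t.
have null (A : set (borel X)) : measurable A -> A `<=` wild -> lambda A = 0%E.
  move=> mA AW; apply/eqP; rewrite eq_le measure_ge0 andbT -(wild_null lambda).
  by apply: inv_le => //; exact: wild_borel.
split; apply: null.
- exact: incoherent_borel.
- by move=> x hx; apply: contrapT => /tame_coherent; apply; exact: hx.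
- exact: labelled_borel.
- move=> x [nK r0]; apply: contrapT => nw; apply: r0; apply: tame_label => //.
  by rewrite act1.
Qed.

End rigid.
End paradox_stage.

(** * Amenable groups *)

(** Weights at most 1 before [J], a geometric tail after it. The bound is free of [q], which grows
    with the stage. *)
Lemma weighted_sum (R : realType) (a : nat -> R) (S : R) q J :
  (forall j, 0 <= a j <= S) ->
  \sum_(j < q) 2^-1 ^+ j * a j <= \sum_(j < J) a j + 2 * 2^-1 ^+ J * S.
Proof.
move=> aS; have S0 : 0 <= S by have /andP[h1 h2] := aS 0%N; exact: le_trans h1 h2.
have h0 := @half_gt0 R.
have small q' : (q' <= J)%N -> \sum_(j < q') 2^-1 ^+ j * a j <= \sum_(j < J) a j.
  move=> qJ; rewrite -(subnKC qJ) big_split_ord /=; rewrite -[leLHS]addr0; apply: lerD.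
    apply: ler_sum => j _; have /andP[a0 _] := aS j; rewrite ler_piMl//.
    by rewrite exprn_ile1 ?invr_ge0// invf_le1// ler1n.
  by apply: sumr_ge0 => j _; have /andP[] := aS (q' + j)%N.
have [qJ|Jq] := leqP q J.
  by apply: le_trans (small _ qJ) _; rewrite lerDl mulr_ge0// mulr_ge0// ltW.
have main d : \sum_(j < J + d) 2^-1 ^+ j * a j <= \sum_(j < J) a j + (2 * 2^-1 ^+ J - 2 * 2^-1 ^+ (J + d)) * S.
  elim: d => [|d IH]; first by rewrite addn0 subrr mul0r addr0 small.
  rewrite addnS big_ord_recr /=; have /andP[_ aJ] := aS (J + d)%N.
  have : 2^-1 ^+ (J + d) * a (J + d)%N <= 2^-1 ^+ (J + d) * S by rewrite ler_pM2l.
  rewrite exprS; move: (2^-1 ^+ (J + d)) IH => c IH; move: IH; rewrite !mulrBl; lra.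
rewrite -(subnKC (ltnW Jq)); apply: le_trans (main _) _.
by rewrite lerD2l ler_wpM2r// gerBl mulr_ge0// ltW.
Qed.

Section windows.
Context {R : realType} {G : groupType}.
Variables (s : nat -> G) (r : pred G).

(** Isolating the direction [j0] costs the factor [2 ^ j0]. What remains does not involve [q], and
    involves [p] only through [1/p]: a fixed number of directions is tested on the window at every
    stage. *)
Lemma window_bound (C : {fset G}) (D : pred G) p q J j0 : (0 < p)%N -> (j0 < q)%N ->
  (p * (\sum_(j < q) 2 ^ (q - j) * #|` [fset a in piece_bd s r C j | D a]%fset|) <=
     2 ^ q * #|` [fset a in piece_sites r C | D a]%fset| +
       p * (\sum_(j < q) 2 ^ (q - j) *
         #|` [fset a in piece_sites r C | D a && ~~ D ((s j)^-1 * a)%g]%fset|))%N ->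
  #|` [fset a in piece_bd s r C j0 | D a]%fset|%:R <=
    2 ^+ j0 * ((p%:R^-1 + 2 * 2^-1 ^+ J) * #|` [fset a in piece_sites r C | D a]%fset|%:R +
      \sum_(j < J) #|` [fset a in piece_sites r C | D a && ~~ D ((s j)^-1 * a)%g]%fset|%:R) :> R.
Proof.
move=> p0 jq h.
pose b : nat := #|` [fset a in piece_bd s r C j0 | D a]%fset|.
pose S : nat := #|` [fset a in piece_sites r C | D a]%fset|.
pose a j : nat := #|` [fset a in piece_sites r C | D a && ~~ D ((s j)^-1 * a)%g]%fset|.
have aS j : (a j <= S)%N.
  by apply: fsubset_leq_card; apply/fsubsetP => x; rewrite !inE => /andP[-> /andP[-> _]].
have {}h : (p * (2 ^ (q - j0) * b) <= 2 ^ q * S + p * (\sum_(j < q) 2 ^ (q - j) * a j))%N.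
  apply: leq_trans h; rewrite leq_mul2l; apply/orP; right.
  by rewrite (bigD1 (Ordinal jq)) //= leq_addr.
have pow (j : nat) : (j <= q)%N -> (2 ^ (q - j))%:R = 2 ^+ q * 2^-1 ^+ j :> R.
  move=> jle; rewrite natrX -{2}(subnK jle) exprD exprVn -mulrA mulfV ?mulr1//.
have hR : p%:R * (2 ^+ q * 2^-1 ^+ j0 * b%:R) <= 2 ^+ q * S%:R + p%:R * (2 ^+ q * \sum_(j < q) 2^-1 ^+ j * (a j)%:R) :> R.
  have : (p * (2 ^ (q - j0) * b))%:R <= (2 ^ q * S + p * (\sum_(j < q) 2 ^ (q - j) * a j))%:R :> R by rewrite ler_nat.
  rewrite natrD !natrM pow ?(ltnW jq)// natrX natr_sum => h'; apply: le_trans h' _.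
  rewrite lerD2l ler_wpM2l// big_distrr /= ler_sum// => j _.
  by rewrite natrM pow ?mulrA// ltnW.
have q0 : 0 < 2 ^+ q :> R by rewrite exprn_gt0.
have pR : 0 < p%:R :> R by rewrite ltr0n.
have ws : \sum_(j < q) 2^-1 ^+ j * (a j)%:R <= \sum_(j < J) (a j)%:R + 2 * 2^-1 ^+ J * S%:R :> R.
  by apply: (@weighted_sum R (fun j => (a j)%:R)) => j; rewrite ler0n ler_nat aS.
have hb : 2^-1 ^+ j0 * b%:R <= p%:R^-1 * S%:R + \sum_(j < q) 2^-1 ^+ j * (a j)%:R :> R.
  rewrite -(@ler_pM2l _ (p%:R * 2 ^+ q)) ?mulr_gt0//.
  move: hR; rewrite -!mulrA => hR; apply: le_trans hR _.
  rewrite le_eqVlt; apply/orP; left; apply/eqP; rewrite !mulrDr; congr (_ + _).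
  by rewrite mulrCA !mulrA mulfK ?gt_eqF// mulrC.
have j00 : 0 < 2 ^+ j0 :> R by rewrite exprn_gt0.
have -> : (b%:R : R) = 2 ^+ j0 * (2^-1 ^+ j0 * b%:R).
  by rewrite mulrA -exprMn mulfV ?pnatr_eq0// expr1n mul1r.
rewrite ler_pM2l//; apply: le_trans hb _; rewrite mulrDl -/S -/b.
by rewrite -addrA lerD2l addrC.
Qed.

Lemma fiber_sum (T U : choiceType) (A : {fset T}) (P : T -> U) (c : pred T) :
  (\sum_(u <- [fset P f | f in A]%fset) #|` [fset f in A | (P f == u) && c f]%fset| =
   #|` [fset f in A | c f]%fset|)%N.
Proof.
transitivity (\sum_(u <- [fset P f | f in A]%fset) \sum_(f <- A) ((P f == u) && c f : nat))%N.
  apply: eq_bigr => u _; rewrite card_fset_sum1 -big_fset_condE big_mkcond /=.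
  by apply: eq_bigr => f _; case: ifP.
rewrite exchange_big /= card_fset_sum1 -[RHS]big_fset_condE [RHS]big_mkcond /= big_seq [RHS]big_seq.
apply: eq_bigr => f fA; case: (c f); last by rewrite big1 // => u _; rewrite andbF.
rewrite (bigD1_seq (P f)) ?fset_uniq//=; last by apply/imfsetP; exists f.
by rewrite eqxx big1 // => u; rewrite eq_sym andbT => /negbTE ->.
Qed.

End windows.

(** * Stages of minimal perimeter *)

Section folner_stage.
Context {R : realType} {G : groupType} {Z Y : dynSystem R G}.
Variables (pi : Y -> Z) (z0 : Z) (y0 : Y) (s : nat -> G).
Hypotheses (sP : forall g, exists n, s n = g) (pi_factor : factor_map pi) (pi0 : pi y0 = z0).
Hypotheses (mZ : minimal Z) (mY : minimal Y) (tdZ : totally_disconnected [set: Z])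
  (isoZ : isolated [set: Z] = set0) (Ginf : infinite_set [set: G])
  (free0 : [set g | act Z g z0 = z0] = [set 1%g]).
Hypothesis folG : folner G.

Let piE g y : pi (act Y g y) = act Z g (pi y). Proof. by have [_ _] := pi_factor; apply. Qed.

Definition outside (L : set Z) : pred G := fun g => ~~ `[< L (act Z g z0) >].

Definition folner_data (n : nat) (L : set Z) (d : @stage_data R G Z) : Prop :=
  (forall f t, d.2 f t = 0) /\ exists p q, [/\ (n < p)%N, (n <= q)%N,
    forall (f : G) e, f \in d.1.1 -> d.1.2 e -> (L (act Z f e) <-> L (act Z f z0)) /\
      forall j, (j < q)%N -> (L (act Z (s j * f)%g e) <-> L (act Z (s j * f)%g z0)) &
    forall D : pred G,
      (p * (\sum_(j < q) 2 ^ (q - j) * #|` [fset a in piece_bd s (outside L) d.1.1 j | D a]%fset|) <=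
       2 ^ q * #|` [fset a in piece_sites (outside L) d.1.1 | D a]%fset| +
       p * (\sum_(j < q) 2 ^ (q - j) *
         #|` [fset a in piece_sites (outside L) d.1.1 | D a && ~~ D ((s j)^-1 * a)%g]%fset|))%N].

(** Otherwise every site would be a boundary point in some direction, and the perimeter at least the
    number of sites. *)
Lemma folner_core r (C : {fset G}) p q : (2 ^ q <= p)%N ->
  (p * piece_per s r C q < 2 ^ q * #|` piece_sites r C|)%N ->
  exists2 c, c \in C & forall j, (j < q)%N -> r (s j * c)%g -> (s j * c)%g \in C.
Proof.
move=> qp h; apply: contrapT => no.
have : (#|` piece_sites r C| <= piece_per s r C q)%N.
  apply: leq_trans (_ : \sum_(j < q) #|` piece_bd s r C j| <= _)%N; last first.
    by apply: leq_sum => j _; rewrite leq_pmull// expn_gt0.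
  have : (piece_sites r C `<=` \bigcup_(j <- enum 'I_q) piece_bd s r C j)%fset.
    apply/fsubsetP => c; rewrite inE => /andP[cC rc]; apply/bigfcupP.
    apply: contrapT => h'; apply: no; exists c => // j jq rj; apply: contrapT => /negP nC.
    by apply: h'; exists (Ordinal jq); rewrite ?mem_enum// !inE cC rc rj nC.
  move=> /fsubset_leq_card /leq_trans; apply.
  by apply: leq_trans (leq_card_bigfcup _ _) _; rewrite big_enum.
by move=> h'; move: h; rewrite ltnNge leq_mul.
Qed.

Lemma folner_stage n L M : clopen L -> (exists z, ~ L z) ->
  exists d, good_stage pi z0 y0 s n L M d /\ folner_data n L d.
Proof.
move=> cL exL; have [H hH] := uniform_return s pi_factor mY n cL.
pose S := firsts s n; have sS j := @mem_firsts _ s j n.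
have [N hN] := seq_bound sP (gmul S H).
(* The directions below [q] include all of [S H]; [2 ^ q <= p] is needed by [folner_core], and
   [n < p] makes [1/p] tend to 0 along the stages. *)
pose q := maxn n N; pose p := (2 ^ q + n.+1)%N.
have [T hT] := minimal_cover mZ (closed_openC cL.2) exL.
have [|C [hC1 hC2]] := @folner_piece G s (outside L) folG _ q p.
  exists T => g; have [t tT ht] := hT (act Z g z0); exists t => //.
  by rewrite /outside actM; apply/asboolPn.
have [c cC hc] := folner_core (leq_addr _ _) hC1.
pose Sq := firsts s q; have sSq j := @mem_firsts _ s j q.
have [E [cE E0 EN sE [dE smE prE]]] := @tiny_base R G Z z0 tdZ isoZ Ginf free0 L C M n _ cL exL
  (clopen_act_near z0 (C `|` gmul Sq C)%fset cL).
exists (C, E, fun _ _ => 0); split.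
  constructor => //=; first by move=> *; left.
  (* The core element [c] has its free neighbours in [C], which 1 need not have; the return to [y]
     therefore starts from the translate of [y0] by [c]. *)
  move=> y; have [h hH' [d1 d2]] := hH y (act Y c y0); exists (h * c)%g; split.
    by rewrite actM.
  move=> j jn nL; have := d2 j jn nL; rewrite piE pi0 -actM -mulgA => nL'.
  split => //.
  have [i iN si] := hN (s j * h)%g (mem_gmul (sS _ jn) hH').
  rewrite mulgA -si; apply: hc; first by apply: leq_trans iN (leq_maxr _ _).
  by rewrite /outside si -mulgA; apply/asboolPn.
split => //; exists p, q; split => //=.
- by rewrite /p addnS ltnS leq_addl.
- exact: leq_maxl.
move=> f e fC /EN h; split; first by apply: h; rewrite in_fsetU fC.
by move=> j jq; apply: h; rewrite in_fsetU; apply/orP; right; apply: mem_gmul => //; exact: sSq.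
Qed.

Section rigid.
Variable w : tower pi z0 y0 s.
Hypothesis wP : forall n, folner_data n (lower (tw_F w) (tw_E w) n) (tw_F w n, tw_E w n, tw_lab w n).

Local Notation F := (tw_F w).
Local Notation E := (tw_E w).
Local Notation low := (lower (tw_F w) (tw_E w)).
Local Notation X := (configX sP pi_factor pi0 w).

Definition bdry (W : {fset G}) j : nat := #|` [fset f in W | ((s j)^-1 * f)%g \notin W]%fset|.

(** An edge that leaves its piece, of stage at least [N], without entering an earlier stage: the
    kind of edge that [piece_bd] counts. *)
Definition exits (z : Z) N j0 (f : G) : bool := let c := code w (act Z f z) in
  [&& (N <= c.1)%N, (s j0 * c.2)%g \notin F c.1 & ~~ `[< low c.1 (act Z (s j0 * f)%g z) >]].

(** Group the sites of [W] by piece, [P f] being the stage and the element that takes [z] into [E].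
    Each group obeys the minimality inequality for the trace of [W] on its piece, and the boundaries
    of the traces add up to at most that of [W]. *)
Lemma exits_bound z (W : {fset G}) N j0 J : (forall f, f \in W -> pieces w (act Z f z)) -> (j0 < N)%N ->
  #|` [fset f in W | exits z N j0 f]%fset|%:R <=
    2 ^+ j0 * ((N.+1%:R^-1 + 2 * 2^-1 ^+ J) * #|` W|%:R + \sum_(j < J) (bdry W j)%:R) :> R.
Proof.
move=> Wz jN.
pose P f : nat * G := let c := code w (act Z f z) in (c.1, (c.2^-1 * f)%g).
have PP f : f \in W -> [/\ (f * (P f).2^-1)%g \in F (P f).1, E (P f).1 (act Z (P f).2 z),
    ~ low (P f).1 (act Z f z) & code w (act Z f z) = ((P f).1, (f * (P f).2^-1)%g)].
  move=> /Wz/codeP; rewrite /P; move: (code w (act Z f z)) => [n g] /= [/= gF gE nl].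
  by rewrite invMg invgK mulgA mulgV mul1g actM.
have jpow : 0 <= 2 ^+ j0 :> R by exact: exprn_ge0.
have rho0 : 0 <= N.+1%:R^-1 + 2 * 2^-1 ^+ J :> R.
  by rewrite addr_ge0 ?invr_ge0// mulr_ge0// ltW// half_gt0.
have piece_ineq (u : nat * G) : u \in [fset P f | f in W]%fset ->
  #|` [fset f in W | (P f == u) && exits z N j0 f]%fset|%:R <=
    2 ^+ j0 * ((N.+1%:R^-1 + 2 * 2^-1 ^+ J) * #|` [fset f in W | (P f == u) && true]%fset|%:R +
      \sum_(j < J) #|` [fset f in W | (P f == u) && (((s j)^-1 * f)%g \notin W)]%fset|%:R) :> R.
  move=> /imfsetP[f0 /= f0W eu]; case: u eu => n a eu.
  have [_ Ea _ _] := PP _ f0W; rewrite -eu /= in Ea.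
  have [Nn|nN] := leqP N n; last first.
    rewrite (_ : [fset f in W | (P f == (n, a)) && exits z N j0 f]%fset = fset0).
      rewrite cardfs0 mulr_ge0// addr_ge0 ?sumr_ge0// mulr_ge0//.
    apply/fsetP => f; rewrite !inE; apply/negP => /andP[fW /andP[/eqP Pf /and3P[h _ _]]].
    by have [_ _ _ cf] := PP f fW; rewrite cf Pf /= leqNgt nN in h.
  have [_ [p [q [np nq env win]]]] := wP n; rewrite /= in env win.
  pose D : pred G := fun g => (g * a)%g \in W.
  have out g : g \in F n -> outside (low n) g = ~~ `[< low n (act Z (g * a)%g z) >].
    move=> gF; have [e1 _] := env g _ gF Ea; rewrite /outside actM.
    by congr (~~ _); apply: asbool_equiv_eq; split => /e1.
  have outj j g : g \in F n -> (j < q)%N -> outside (low n) (s j * g)%g = ~~ `[< low n (act Z (s j * g * a)%g z) >].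
    move=> gF jq; have [_ /(_ j jq) e1] := env g _ gF Ea; rewrite /outside (actM _ a).
    by congr (~~ _); apply: asbool_equiv_eq; split => /e1.
  have jq : (j0 < q)%N by apply: leq_trans (leq_trans jN Nn) nq.
  have p0 : (0 < p)%N by exact: leq_ltn_trans np.
  have site_P g : g \in piece_sites (outside (low n)) (F n) -> D g -> P (g * a)%g = (n, a).
    rewrite inE => /andP[gF]; rewrite out// => /asboolPn nl _.
    rewrite /P (_ : code w _ = (n, g)); first by rewrite /= mulKg.
    by apply: codeE; split => //=; rewrite -actM mulKg.
  have c1 : (#|` [fset f in W | (P f == (n, a)) && exits z N j0 f]%fset| <=
      #|` [fset g in piece_bd s (outside (low n)) (F n) j0 | D g]%fset|)%N.
    apply: (leq_card_fset_inj (f := fun f => (f * a^-1)%g)); last by move=> ? ? _ _ /mulIg.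
    move=> f; rewrite in_fset => /andP[fW /andP[/eqP Pf]].
    have [fF _ nl cf] := PP f fW; rewrite Pf /= in fF nl cf; rewrite /exits cf /= => /and3P[_ ex1 ex2].
    rewrite !inE /D mulgVK fW fF out// mulgVK outj// -(mulgA (s j0)) mulgVK ex2 ex1 !andbT.
    by apply/asboolPn.
  have c2 : (#|` [fset g in piece_sites (outside (low n)) (F n) | D g]%fset| <=
      #|` [fset f in W | (P f == (n, a)) && true]%fset|)%N.
    apply: (leq_card_fset_inj (f := fun f => (f * a)%g)); last by move=> ? ? _ _ /mulIg.
    move=> g; rewrite in_fset => /andP[gS gD]; rewrite in_fset.
    apply/andP; split; first exact: gD.
    by apply/andP; split => //; apply/eqP; exact: site_P gS gD.
  have c3 j : (#|` [fset g in piece_sites (outside (low n)) (F n) | D g && ~~ D ((s j)^-1 * g)%g]%fset| <=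
      #|` [fset f in W | (P f == (n, a)) && (((s j)^-1 * f)%g \notin W)]%fset|)%N.
    apply: (leq_card_fset_inj (f := fun f => (f * a)%g)); last by move=> ? ? _ _ /mulIg.
    move=> g; rewrite in_fset => /andP[gS /andP[gD gD']]; rewrite in_fset.
    apply/andP; split; first exact: gD.
    apply/andP; split; first by apply/eqP; exact: site_P gS gD.
    by rewrite mulgA.
  have := window_bound (R := R) J p0 jq (win D).
  move=> wb; apply: le_trans (le_trans wb _); first by rewrite ler_nat.
  rewrite ler_wpM2l// lerD//; last by apply: ler_sum => j _; rewrite ler_nat.
  apply: ler_pM => //; rewrite ?ler_nat//.
  by rewrite lerD2r lef_pV2 ?posrE ?ltr0n// ler_nat; apply: leq_ltn_trans Nn np.
rewrite -(fiber_sum W P) natr_sum big_seq; apply: le_trans (ler_sum _ piece_ineq) _.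
rewrite -big_seq -mulr_sumr ler_wpM2l// big_split /= -mulr_sumr exchange_big /=.
apply: lerD.
  rewrite ler_wpM2l// -natr_sum fiber_sum ler_nat; apply: fsubset_leq_card.
  by apply/fsubsetP => f; rewrite in_fset => /andP[].
by apply: ler_sum => j _; rewrite -natr_sum fiber_sum.
Qed.

(** If neither end exits, [code_step] from the end of the earlier stage puts both in one piece,
    whose symbols are coherent. One [z] approximates [x] on the whole window, within the smallest
    gap. *)
Lemma incoherent_exits (x : X) (W : {fset G}) t j0 j1 N : s j0 = t -> s j1 = t^-1%g -> exists z,
  (forall f, f \in (W `|` [fset t * f | f in W])%g%fset -> pieces w (act Z f z)) /\
  forall f, f \in W -> incoherent t (act X f x) -> exits z N j0 f \/ exits z N j1 (t * f)%g.
Proof.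
move=> s0 s1.
have gap f : exists e : R, 0 < e /\ (incoherent t (act X f x) -> forall u u',
    mdist (ypart x f) u < e -> mdist (ypart x (t * f)%g) u' < e -> u' <> act Y t u).
  have [[_ _]|ni] := pselect (incoherent t (act X f x)); last by exists 1; split => // /ni.
  by rewrite !ypart_act mul1g => /act_gap[e e0 he]; exists e.
have [ge hge] := choice gap.
have [e e0 he] : exists2 e : R, 0 < e & forall f, f \in W -> e <= ge f.
  suff h (l : seq G) : exists2 e : R, 0 < e & forall f, f \in l -> e <= ge f by exact: h (enum_fset W).
  elim: l => [|a l [e e0 he]]; first by exists 1.
  exists (Num.min e (ge a)); first by rewrite lt_min e0; have [] := hge a.
  move=> f; rewrite inE => /predU1P[->|/he h]; first by rewrite ge_min lexx orbT.
  by rewrite ge_min h.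
pose A := (W `|` [fset t * f | f in W])%g%fset.
have [z [_ hz]] := K_approx x A [fset 1%g]%fset N e0; exists z; split.
  by move=> f /hz[].
move=> f fW inc; have := inc; case=> nK nKt _; rewrite tau_actE in nK; rewrite tau_actE -actM in nKt.
have fA : f \in A by rewrite in_fsetU fW.
have tfA : (t * f)%g \in A by rewrite in_fsetU; apply/orP; right; apply/imfsetP; exists f.
have [p1 /(_ 1%g (fset11 _)) d1 /(_ nK) n1] := hz f fA.
have [p2 /(_ 1%g (fset11 _)) d2 /(_ nKt) n2] := hz _ tfA.
move: d1 d2; rewrite !xval_site !site_mdist /= => /and3P[_ d1 _] /and3P[_ d2 _].
have [_ /(_ inc)] := hge f.
move=> /(_ _ _ (lt_le_trans d1 (he f fW)) (lt_le_trans d2 (he f fW))) ne.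
have tfE : act Z (t * f)%g z = act Z t (act Z f z) by rewrite actM.
have nl u : pieces w u -> ~ low (code w u).1 u by move=> /codeP[].
have [le|lt] := leqP (code w (act Z f z)).1 (code w (act Z (t * f)%g z)).1.
  left; apply/and3P; split => //.
    apply/negP; rewrite s0 => tF; apply: ne; rewrite -actM; congr (act Y _ y0).
    by rewrite tfE in p2 le *; rewrite (code_step p1 p2 le tF).
  by rewrite s0; apply/asboolPn => /(lowS le); exact: nl.
right; apply/and3P; split => //.
  apply/negP; rewrite s1 => tF; apply: ne; rewrite -actM; congr (act Y _ y0).
  have := @code_step _ _ _ _ _ _ _ _ w (act Z (t * f)%g z) t^-1%g p2.
  rewrite -actM mulKg => /(_ p1 (ltnW lt) tF) ->; by rewrite /= mulKVg.
by rewrite s1 mulKg; apply/asboolPn => /(lowS (ltnW lt)); exact: nl.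
Qed.

Lemma folner_incoherent t m : exists2 W : {fset G}, W != fset0 & forall x : X,
  (m * #|` [fset f in W | `[< incoherent t (act X f x) >]]%fset| <= #|` W|)%N.
Proof.
have [j0 s0] := sP t; have [j1 s1] := sP t^-1%g.
(* The terms [1/(N+1)], [2 * 2^-J] and the boundary of the window are each made at most [1/c], for
   both directions together [3 * b / c]; and [3 * b * m <= c]. *)
pose b : R := 2 ^+ j0 + 2 ^+ j1; pose c : R := 4 * (b * m%:R + 1).
have b0 : 0 < b by rewrite addr_gt0 ?exprn_gt0.
have c0 : 0 < c by rewrite mulr_gt0// ltr_wpDl// mulr_ge0// ltW.
have c10 : 0 < c^-1 by rewrite invr_gt0.
have [J hJ] := half_small c10; have [N0 hN0] := inv_succ_small c10.
pose N := maxn N0 (maxn j0 j1).+1.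
have hN : (N.+1%:R^-1 : R) < c^-1 by apply: hN0; exact: leq_maxl.
have [k hk] : exists k : nat, c * J%:R < k%:R.
  by have := @archi_boundP R (c * J%:R); rewrite mulr_ge0 ?(ltW c0)// => /(_ isT); eexists; eassumption.
(* The conjugated elements control the boundary of the translated window [t W], brought back to [W]
   by [t^-1]. *)
pose K := ([fset (s j)^-1 | j in iota 0 J] `|` [fset t^-1 * (s j)^-1 * t | j in iota 0 J])%g%fset.
have [W W0 hW] := folG K k; exists W => // x.
pose W' := [fset t * f | f in W]%g%fset.
have cW' : #|` W'| = #|` W| by rewrite card_imfset//; exact: mulgI.
have W1 : 0 < #|` W|%:R :> R by rewrite ltr0n cardfs_gt0.
have k0 : 0 < k%:R :> R by apply: le_lt_trans hk; rewrite mulr_ge0// ltW.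
have bd1 j : (j < J)%N -> (k * bdry W j <= #|` W|)%N.
  move=> jJ; apply: hW; rewrite in_fsetU; apply/orP; left; apply/imfsetP; exists j => //=.
  by rewrite mem_iota.
have bd2 j : (j < J)%N -> (k * bdry W' j <= #|` W|)%N.
  move=> jJ; have h : (t^-1 * (s j)^-1 * t)%g \in K.
    by rewrite in_fsetU; apply/orP; right; apply/imfsetP; exists j => //=; rewrite mem_iota.
  apply: leq_trans (hW _ h); rewrite leq_mul2l; apply/orP; right.
  apply: (leq_card_fset_inj (f := fun u => (t^-1 * u)%g)); last by move=> ? ? _ _ /mulgI.
  move=> u; rewrite in_fset => /andP[/imfsetP[/= f fW ->] nu]; rewrite in_fset mulKg.
  apply/andP; split; first exact: fW.
  apply: contra nu => h'; apply/imfsetP; exists (t^-1 * (s j)^-1 * t * f)%g => //=.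
  by rewrite !mulgA mulgV mul1g.
have [z [Wz hz]] := incoherent_exits x W N s0 s1.
have Wz1 f : f \in W -> pieces w (act Z f z) by move=> fW; apply: Wz; rewrite in_fsetU fW.
have Wz2 f : f \in W' -> pieces w (act Z f z) by move=> fW; apply: Wz; rewrite in_fsetU; apply/orP; right.
have jN0 : (j0 < N)%N by rewrite /N leq_max ltnS leq_max leqnn /= orbT.
have jN1 : (j1 < N)%N by rewrite /N leq_max ltnS leq_max leqnn !orbT.
have e1 := exits_bound J Wz1 jN0; have e2 := exits_bound J Wz2 jN1.
have sum_bd (V : {fset G}) : (forall j, (j < J)%N -> (k * bdry V j <= #|` W|)%N) ->
    \sum_(j < J) (bdry V j)%:R <= c^-1 * #|` W|%:R :> R.
  move=> hV; rewrite -(ler_pM2l k0) mulr_sumr.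
  apply: (@le_trans _ _ (\sum_(j < J) #|` W|%:R)).
    by apply: ler_sum => j _; rewrite -natrM ler_nat; exact: hV.
  rewrite sumr_const card_ord -[leLHS]mulr_natl mulrA ler_pM2r//.
  by rewrite -ler_pdivrMr ?invr_gt0// invrK mulrC ltW.
have tot (V : {fset G}) j : #|` V| = #|` W| -> (forall j, (j < J)%N -> (k * bdry V j <= #|` W|)%N) ->
    2 ^+ j * ((N.+1%:R^-1 + 2 * 2^-1 ^+ J) * #|` V|%:R + \sum_(j < J) (bdry V j)%:R) <=
    2 ^+ j * (3 * c^-1 * #|` W|%:R) :> R.
  move=> -> /sum_bd hV; rewrite ler_pM2l ?exprn_gt0//.
  have : (N.+1%:R^-1 + 2 * 2^-1 ^+ J) * #|` W|%:R <= (c^-1 + c^-1) * #|` W|%:R :> R.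
    by rewrite ler_pM2r// lerD// ltW.
  move=> h; apply: le_trans (lerD h hV) _; rewrite -mulrDl ler_pM2r//.
  by move: (c^-1) => d; lra.
have cnt : (#|` [fset f in W | `[< incoherent t (act X f x) >]]%fset| <=
    #|` [fset f in W | exits z N j0 f]%fset| + #|` [fset f in W' | exits z N j1 f]%fset|)%N.
  apply: (@leq_trans (#|` [fset f in W | exits z N j0 f]%fset| + #|` [fset f in W | exits z N j1 (t * f)%g]%fset|)%N).
    apply: leq_trans (leq_card_fsetU _ _).1; apply: fsubset_leq_card; apply/fsubsetP => f.
    rewrite in_fset => /andP[fW /asboolP/(hz f fW)[h|h]]; rewrite in_fsetU !in_fset; apply/orP; [left|right];
      by apply/andP; split => //; exact: fW.
  rewrite leq_add2l; apply: (leq_card_fset_inj (f := fun f => (t * f)%g)); last by move=> ? ? _ _ /mulgI.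
  move=> f; rewrite in_fset => /andP[fW h]; rewrite in_fset; apply/andP; split; last exact: h.
  by apply/imfsetP; exists f.
rewrite -(ler_nat R) natrM; move: cnt; rewrite -(ler_nat R) natrD => cnt.
have t1 := le_trans e1 (tot W j0 erefl bd1); have t2 := le_trans e2 (tot W' j1 cW' bd2).
have hb := le_trans cnt (lerD t1 t2); rewrite -mulrDl -/b in hb.
apply: le_trans (ler_wpM2l (ler0n R m) hb) _; rewrite !mulrA ler_piMl//.
rewrite ler_pdivrMr// mul1r /c (mulrC m%:R); have : 0 <= b * m%:R by rewrite mulr_ge0// ltW.
lra.
Qed.

Lemma folner_rigid : rigid sP pi_factor pi0 w.
Proof.
move=> lambda t.
split.
  apply: inv_count0; first exact: incoherent_borel.
  by move=> m; exact: folner_incoherent.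
rewrite (_ : labelled t = set0) ?measure0//; apply/seteqP; split => // x [nK]; apply.
apply/eqP; rewrite -normr_le0; apply/ler_addgt0Pr => e e0; rewrite add0r.
have [z [_ /(_ 1%g (fset11 _))[_ /(_ t (fset11 _)) + _]]] := K_approx x [fset 1%g]%fset [fset t]%fset 0%N e0.
have [/= l0 _] := wP (code w (act Z 1%g z)).1.
by rewrite site_mdist /cval /= l0 sub0r normrN => /and3P[_ _ /ltW].
Qed.

End rigid.
End folner_stage.

Theorem theorem1 (R : realType) (G : groupType)
    (G_countable : countable [set: G]) (G_infinite : infinite_set [set: G])
    (G_residually_finite : residually_finite G)
    (Z : dynSystem R G) (Z_minimal : minimal Z)
    (Z_equicontinuous : equicontinuous_system Z)
    (Z_free : has_free_orbit Z) (Z_cantor : cantor_set Z)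
    (Y : dynSystem R G) (Y_minimal : minimal Y)
    (pi : Y -> Z) (pi_factor : factor_map pi) :
  exists (X : dynSystem R G) (tau : X -> Z) (psi : Y -> X),
    [/\ minimal X, factor_map tau, almost_one_to_one tau,
        borel_map psi & equivariant psi] /\
    [/\ tau \o psi = pi,
        exists Zt : set (borel Z),
          [/\ measurable Zt,
              forall nu : invMeasure Z, nu Zt = 1%E &
              {in pi @^-1` Zt &, injective psi}] &
        exists psi_star : invMeasure Y -> invMeasure X,
          [/\ forall (mu : invMeasure Y) (A : set (borel X)), measurable A ->
                psi_star mu A = mu (psi @^-1` A),
              affine psi_star,
              bijective psi_star &
              cantor_set Y -> cantor_set X /\ homeomorphism psi_star]].
Proof.
have [z0 free0] := Z_free; have [_ tdZ isoZ] := Z_cantor.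
have [s sP] := group_enum G_countable.
have [y0 pi0] : exists y, pi y = z0.
  by have [_ h _] := pi_factor; have [y _ <-] := h z0 Logic.I; exists y.
have [w wR] : exists w : tower pi z0 y0 s, rigid sP pi_factor pi0 w.
  have [fol|nfol] := pselect (folner G).
    have [w wP] := build Z_minimal (folner_stage sP pi_factor pi0 Z_minimal Y_minimal tdZ isoZ G_infinite free0 fol).
    by exists w; exact: folner_rigid wP.
  have [T hT] := not_folner_expands nfol.
  have [D [sg [oD Dorb sgT sg_near sg_inj]]] := paradox_exists tdZ free0 hT sP.
  have [w wP] := build Z_minimal (paradox_stage s pi_factor pi0 Y_minimal tdZ isoZ G_infinite free0 T oD Dorb sg_near).
  by exists w; exact: (@paradox_rigid _ _ _ _ _ _ _ _ sP pi_factor pi0 _ _ _ sgT sg_inj w wP).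
exists (configX sP pi_factor pi0 w), (@tau _ _ _ _ _ _ _ _ sP pi_factor pi0 w), (psi sP pi_factor pi0 w).
split.
  split.
  - exact: configX_minimal.
  - exact: tau_factor.
  - exact: tau_almost_one_to_one.
  - exact: psi_borel.
  - exact: psi_act.
split.
- by apply/funext => y; exact: tau_psi.
- have mK := nowhereK_borel sP w; exists (~` nowhereK w); split.
  + exact: measurableC.
  + by move=> nu; rewrite [LHS]probability_setC// (nowhereK_null sP) sube0.
  + exact: psi_injective.
have [Fs [Hs [FsE HsE]]] := stars_exist wR.
have FK := FsK FsE HsE; have HK := HsK wR FsE HsE.
exists Fs; split => //.
- exact: Fs_affine FsE.
- by exists Hs.
move=> cY; have [_ tdY _] := cY; split; first exact: configX_cantor.
split; first exact: Fs_continuous FsE tdY.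
exists Hs; split => //.
by apply: (Hs_continuous HsE); exact: configX_totally_disconnected.
Qed.
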